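(* Let $\omega\in\mathbb{R}^n$ be a $(\gamma,\tau)$-Diophantine frequency vector, for certain $\gamma>0$ and $\tau\ge n$. Then, for any analytic function $v:\mathbb{T}^n_\rho\to\mathbb{C}$ with $\|v\|_\rho<\infty$ and $\rho>0$, there exists a unique zero-average analytic solution $u:\mathbb{T}^n_\rho\to\mathbb{C}$ of $$u(\theta)-u(\theta+\omega)=v(\theta)-\langle v\rangle .$$ Moreover, given $L\in\mathbb{N}$ ($L=0$ allowed), for any $0<\delta<\rho$ we have $$\|u\|_{\rho-\delta}\le\frac{c_R(\delta)}{\gamma\delta^\tau}\|v\|_\rho,$$ where $$c_R(\delta)=\sqrt{\gamma^2\delta^{2\tau}2^n\sum_{0<|k|_1\le L}\frac{e^{-4\pi|k|_1\delta}}{4|\sin(\pi k\cdot\omega)|^2}+2^{n-3}\zeta(2,2^\tau)(2\pi)^{-2\tau}\int_{4\pi\delta(L+1)}^\infty u^{2\tau}e^{-u}\,du}$$ and $\zeta(a,b)=\sum_{j\ge0}(b+j)^{-a}$ is the Hurwitz zeta function.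
   Context: $\mathbb{T}^n_\rho=\{\theta\in\mathbb{C}^n/\mathbb{Z}^n:|\mathrm{Im}\,\theta_i|<\rho,\ i=1,\dots,n\}$, $\|u\|_\rho=\sup_{\mathbb{T}^n_\rho}|u|$, $|k|_1=\sum_i|k_i|$ for $k\in\mathbb{Z}^n$, and $\langle v\rangle=\int_{[0,1]^n}v(\theta)\,d\theta$. The vector $\omega$ is $(\gamma,\tau)$-Diophantine if $|k\cdot\omega-m|\ge\gamma|k|_1^{-\tau}$ for all $k\in\mathbb{Z}^n\setminus\{0\}$ and $m\in\mathbb{Z}$. *)

(* Defs.v *)
From HB Require Import structures.
From mathcomp Require Import all_boot all_order all_algebra complex finmap.
From mathcomp Require Import all_classical all_reals all_analysis.
From mathcomp Require Import summability.

Set Implicit Arguments.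
Unset Strict Implicit.
Unset Printing Implicit Defensive.

Import Order.TTheory GRing.Theory Num.Theory.
Import numFieldNormedType.Exports.

Local Open Scope classical_set_scope.
Local Open Scope ring_scope.
Local Open Scope complex_scope.

Section ComplexTorus.
Context {R : realType} {n : nat}.
Implicit Types (rho : R) (z : 'rV[R[i]]_n) (u : 'rV[R[i]]_n -> R[i]).

Definition real_vec (x : 'rV[R]_n) : 'rV[R[i]]_n := map_mx (real_complex R) x.

Definition strip rho : set 'rV[R[i]]_n :=
  [set z | forall i, `|complex.Im (z 0 i)| < rho].

(* Functions on the quotient T^n_rho are represented by their Z^n-periodic
   lifts; the values outside the strip are irrelevant. *)
Definition periodic_on_strip rho u :=
  forall z, strip rho z -> forall k : 'rV[int]_n,
    u (z + map_mx intr k) = u z.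

(* u is the sum of a power series on a polydisc centred at z; the convergence
   is unordered, that is, along the finite sets of multi-indices, which for
   complex series is the same as absolute convergence. *)
Definition analytic_at u z :=
  exists (a : {ffun 'I_n -> nat} -> R[i]) (r : R), 0 < r /\
    forall h : 'rV[R[i]]_n, (forall i, `|h 0 i| < r%:C) ->
      partial_sum (fun m => a m * \prod_i h 0 i ^+ m i) A @[A --> totally]
        --> (u (z + h) : R[i]^o).

Definition analytic_on_torus rho u :=
  periodic_on_strip rho u /\ forall z, strip rho z -> analytic_at u z.

(* `|u z| lives in R[i]; its real part is the modulus as an element of R. The
   supremum is extended-real, so that it is +oo for unbounded functions. *)
Definition sup_norm rho u : \bar R :=
  ereal_sup [set (complex.Re `|u z|)%:E | z in strip rho].

End ComplexTorus.

Section Average.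
Context {R : realType}.

Definition cons_pair n (p : measurableTypeR R * n.-tuple (measurableTypeR R)) :
  n.+1.-tuple (measurableTypeR R) := [tuple of p.1 :: p.2].

Lemma measurable_cons_pair n : measurable_fun setT (@cons_pair n).
Proof. exact: measurable_cons. Qed.

HB.instance Definition _ n :=
  isMeasurableFun.Build _ _ _ _ (@cons_pair n) (@measurable_cons_pair n).

(* Lebesgue measure restricted to the cube [0,1]^n, as the n-fold product of
   Lebesgue measure restricted to [0,1] (which is the uniform law on [0,1]). *)
Fixpoint lebesgue_cube n : probability (n.-tuple (measurableTypeR R)) R :=
  match n with
  | 0 => \d_ [tuple]
  | n'.+1 => distribution (uniform_prob (@ltr01 R) \x lebesgue_cube n')%E
               (@cons_pair n')
  end.

Definition average n (u : 'rV[R[i]]_n -> R[i]) : R[i] :=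
  let f (t : n.-tuple R) := u (real_vec (\row_i tnth t i)) in
  (\int[lebesgue_cube n]_t complex.Re (f t)) +i*
  (\int[lebesgue_cube n]_t complex.Im (f t)).

End Average.

Section Diophantine.
Context {R : realType} {n : nat}.
Implicit Types (k : 'rV[int]_n) (omega : 'rV[R]_n).

Definition norm1 k : nat := (\sum_i `|k 0%R i|)%N.

Definition dotZ k omega : R := \sum_i (k 0 i)%:~R * omega 0 i.

Definition diophantine (gamma tau : R) omega :=
  forall k, k != 0 -> forall m : int,
    gamma * (norm1 k)%:R `^ (- tau) <= `|dotZ k omega - m%:~R|.

End Diophantine.

Section RussmannConstant.
Context {R : realType}.

Definition hurwitz_zeta (a b : R) : R :=
  limn (series (fun j : nat => (b + j%:R) `^ (- a))).

Definition upper_incomplete_integral (tau x : R) : R :=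
  \int[lebesgue_measure]_(t in `[x, +oo[) (t `^ (2 * tau) * expR (- t)).

(* c_R(delta). The sum ranges over a finite set of k, on which sin (pi * k.omega)
   does not vanish when omega is Diophantine with gamma > 0. *)
Definition russmann_constant n (omega : 'rV[R]_n) (gamma tau : R) (L : nat)
    (delta : R) : R :=
  Num.sqrt
    (gamma ^+ 2 * delta `^ (2 * tau) * 2 ^+ n *
       (\sum_(k \in [set k : 'rV[int]_n | (0 < norm1 k <= L)%N])
          expR (- (4 * pi * (norm1 k)%:R * delta)) /
            (4 * `|sin (pi * dotZ k omega)| ^+ 2)) +
     2 ^ (n%:Z - 3) * hurwitz_zeta 2 (2 `^ tau) * (2 * pi) `^ (- (2 * tau)) *
       upper_incomplete_integral tau (4 * pi * delta * L.+1%:R)).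

End RussmannConstant.

(* u is a zero-average analytic solution of u - u(. + omega) = v - <v>. *)
Definition zero_average_solution (R : realType) (n : nat) (rho : R)
    (omega : 'rV[R]_n) (v u : 'rV[R[i]]_n -> R[i]) :=
  [/\ analytic_on_torus rho u,
      average u = 0
    & forall theta, strip rho theta ->
        u theta - u (theta + real_vec omega) = v theta - average v].

(* Main.v *)
Require Import Defs.
From mathcomp Require Import all_boot all_order all_algebra complex finmap.
From mathcomp Require Import all_classical all_reals all_analysis.
From mathcomp Require Import summability measurable_realfun ring lra zify.

Set Implicit Arguments.
Unset Strict Implicit.
Unset Printing Implicit Defensive.

Import Order.TTheory GRing.Theory Num.Theory.
Import numFieldNormedType.Exports.

Local Open Scope classical_set_scope.
Local Open Scope ring_scope.
Local Open Scope complex_scope.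

(** The equation is diagonal in the Fourier basis: if v is the sum of the
    c_k e_k, where e_k (z) = exp (2 pi i k.z), the only possible solution of
    average 0 has the coefficients a_k = c_k / (1 - exp (2 pi i k.omega)) for
    k <> 0, and a_0 = 0. Three facts make this work.

    Decay of the c_k. The coefficients are defined as generalized limits,
    along an ultrafilter, of means over the finite grids of mesh 1 / (N + 1).
    An analytic periodic function satisfies uniform second order difference
    estimates on every smaller strip (analytic_regular), by compactness of a
    period cell. As a consequence its grid means do not depend, in the limit,
    on the base point of the grid in the strip (amean_cvg0), just as a contour
    integral does not depend on the contour. The Bessel inequality on the grid
    with base point any corner of the strip of half-width s then yields, after
    summation over the 2^n corners (weighted_bessel),
      sum_k |c_k|^2 exp (4 pi |k| s) <= 2^n sup |v|^2.

    Uniqueness. A function whose coefficients all vanish is 0 (fourier_eq0),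
    because its convolutions with the Fejer kernels are 0 and approximate it.
    Hence a function is the sum of its Fourier series as soon as this series
    decays (fourier_expansion), and a function invariant under the translation
    by omega is constant (invariant_constant). The average of a trigonometric
    series is its constant coefficient (average_tseries).

    Small divisors. By the Diophantine condition, the numbers k.omega with
    |k| <= x are separated modulo the integers, so that their distances to the
    integers are, up to the symmetry between k and - k, at least the terms of an
    arithmetic progression. The sum of 1 / |1 - exp (2 pi i k.omega)|^2 over
    these k is therefore at most a Hurwitz zeta value times x^(2 tau)
    (small_div_sum). Writing exp (- 4 pi |k| delta) as an integral turns the
    bound for sharp cutoffs into one for the exponential weights
    (russmann_estimate).

    For z in the strip of half-width s < rho - delta, the Cauchy-Schwarz
    inequality between the weighted c_k and the weighted divisors bounds the sum
    of the |a_k e_k (z)| by c_R (delta) / (gamma delta^tau) sup |v|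
    (sol_coef_bound). This gives both the analyticity of the solution
    (tseries_analytic) and the estimate of its supremum. *)

(** * Moduli of complex numbers *)

Section Modulus.
Context {R : realType}.
Implicit Types (z w : R[i]) (x y : R).

Definition cmod z : R := complex.Re `|z|.

Lemma cmodE z : `|z| = (cmod z)%:C.
Proof. by rewrite /cmod normc_def. Qed.

Lemma cmod_ge0 z : 0 <= cmod z.
Proof. by rewrite -(lecR 0) -cmodE normr_ge0. Qed.

Lemma cmodM z w : cmod (z * w) = cmod z * cmod w.
Proof. by apply: complexI; rewrite rmorphM /= -!cmodE normrM. Qed.

Lemma cmodD z w : cmod (z + w) <= cmod z + cmod w.
Proof. by rewrite -lecR rmorphD /= -!cmodE ler_normD. Qed.

Lemma cmodN z : cmod (- z) = cmod z.
Proof. by rewrite /cmod normrN. Qed.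

Lemma cmodB z w : cmod (z - w) <= cmod z + cmod w.
Proof. by rewrite -(cmodN w) cmodD. Qed.

Lemma cmodBC z w : cmod (z - w) = cmod (w - z).
Proof. by rewrite -cmodN opprB. Qed.

Lemma cmod0 : cmod 0 = 0.
Proof. by rewrite /cmod normr0. Qed.

Lemma cmod1 : cmod 1 = 1.
Proof. by rewrite /cmod normr1. Qed.

Lemma cmod_eq0 z : (cmod z == 0) = (z == 0).
Proof. by rewrite -(inj_eq (@complexI R)) -cmodE normr_eq0. Qed.

Lemma cmod_gt0 z : (0 < cmod z) = (z != 0).
Proof. by rewrite lt0r cmod_eq0 cmod_ge0 andbT. Qed.

Lemma cmodV z : cmod z^-1 = (cmod z)^-1.
Proof. by apply: complexI; rewrite fmorphV /= -!cmodE normfV. Qed.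

Lemma cmodX z n : cmod (z ^+ n) = cmod z ^+ n.
Proof. by apply: complexI; rewrite rmorphXn /= -!cmodE normrX. Qed.

Lemma cmod_real x : cmod x%:C = `|x|.
Proof. by rewrite /cmod normc_def /= expr0n /= addr0 sqrtr_sqr. Qed.

Lemma cmod_nat n : cmod n%:R = n%:R.
Proof. by rewrite -(rmorph_nat (real_complex R)) cmod_real normr_nat. Qed.

Lemma cmod_sum (I : Type) (r : seq I) (P : pred I) (f : I -> R[i]) :
  cmod (\sum_(i <- r | P i) f i) <= \sum_(i <- r | P i) cmod (f i).
Proof.
elim/big_rec2: _ => [|i x z _ le_zx]; first by rewrite cmod0.
by rewrite (le_trans (cmodD _ _))// lerD2l.
Qed.

Lemma cmod_prod (I : Type) (r : seq I) (P : pred I) (f : I -> R[i]) :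
  cmod (\prod_(i <- r | P i) f i) = \prod_(i <- r | P i) cmod (f i).
Proof. exact: (big_morph _ cmodM cmod1). Qed.

Lemma cmod_dist_tri w z t : cmod (z - t) <= cmod (z - w) + cmod (w - t).
Proof. by rewrite -[z - t](subrKA w) cmodD. Qed.

Lemma cmod_sqr z : cmod z ^+ 2 = complex.Re z ^+ 2 + complex.Im z ^+ 2.
Proof. by apply: complexI; rewrite rmorphXn /= -cmodE add_Re2_Im2. Qed.

Lemma cmod_sqrJ z : (cmod z ^+ 2)%:C = z * z^*%C.
Proof. by rewrite rmorphXn /= -cmodE sqr_normc. Qed.

Lemma Re_le_cmod z : `|complex.Re z| <= cmod z.
Proof.
rewrite -(@ler_pXn2r _ 2) ?nnegrE ?cmod_ge0 ?normr_ge0//.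
by rewrite cmod_sqr real_normK ?num_real// lerDl sqr_ge0.
Qed.

Lemma Im_le_cmod z : `|complex.Im z| <= cmod z.
Proof.
rewrite -(@ler_pXn2r _ 2) ?nnegrE ?cmod_ge0 ?normr_ge0//.
by rewrite cmod_sqr real_normK ?num_real// lerDr sqr_ge0.
Qed.

Lemma cmod_le_ReIm z : cmod z <= `|complex.Re z| + `|complex.Im z|.
Proof.
rewrite -(@ler_pXn2r _ 2) ?nnegrE ?cmod_ge0 ?addr_ge0//.
rewrite cmod_sqr sqrrD !real_normK ?num_real// lerD2r lerDl.
by rewrite mulrn_wge0// mulr_ge0.
Qed.

Lemma cReD z w : complex.Re (z + w) = complex.Re z + complex.Re w.
Proof. by case: z w => [? ?] []. Qed.
Lemma cImD z w : complex.Im (z + w) = complex.Im z + complex.Im w.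
Proof. by case: z w => [? ?] []. Qed.
Lemma cReM z w : complex.Re (z * w) =
  complex.Re z * complex.Re w - complex.Im z * complex.Im w.
Proof. by case: z w => [? ?] []. Qed.
Lemma cImM z w : complex.Im (z * w) =
  complex.Re z * complex.Im w + complex.Im z * complex.Re w.
Proof. by case: z w => [? ?] [? ?]. Qed.

Lemma cReN z : complex.Re (- z) = - complex.Re z.
Proof. by case: z. Qed.

Lemma cRe_sum (I : Type) (r : seq I) (P : pred I) (f : I -> R[i]) :
  complex.Re (\sum_(i <- r | P i) f i) = \sum_(i <- r | P i) complex.Re (f i).
Proof. exact: (big_morph _ cReD (erefl _)). Qed.

Lemma cIm_sum (I : Type) (r : seq I) (P : pred I) (f : I -> R[i]) :
  complex.Im (\sum_(i <- r | P i) f i) = \sum_(i <- r | P i) complex.Im (f i).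
Proof. exact: (big_morph _ cImD (erefl _)). Qed.

(** The norm of R[i] takes its values in R[i]; here the radius is an element
    of R. *)
Lemma ccvgP (T : Type) (F : set_system T) {FF : Filter F} (f : T -> R[i]) l :
  f @ F --> (l : R[i]^o) <->
  forall e : R, 0 < e -> \forall t \near F, cmod (f t - l) <= e.
Proof.
split=> [/(@cvgrPdist_le R[i] R[i]^o T F FF f l) fl e e0|fl].
  have := fl e%:C; rewrite ltcR => /(_ e0); apply: filterS => t.
  by rewrite distrC cmodE lecR.
apply/(@cvgrPdist_le R[i] R[i]^o T F FF f l) => e e0.
have eE : e = (complex.Re e)%:C.
  by rewrite RRe_real// ger0_real// ltW.
have := fl (complex.Re e); rewrite -ltcR -eE => /(_ e0); apply: filterS => t.
by rewrite -lecR -eE distrC cmodE.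
Qed.

Lemma ccvg_bound (T : Type) (F : set_system T) {FF : ProperFilter F}
    (f : T -> R[i]) (l : R[i]) (M : R) :
  f @ F --> (l : R[i]^o) -> (\forall t \near F, cmod (f t) <= M) ->
  cmod l <= M.
Proof.
move=> fl fM; apply/ler_addgt0Pr => e e0.
have [t [le1 le2]] := filter_ex (filterI ((ccvgP _ _).1 fl _ e0) fM).
rewrite -[l](subrK (f t)) (le_trans (cmodD _ _))// addrC lerD//.
by rewrite cmodBC.
Qed.

Lemma ccvg_unique (T : Type) (F : set_system T) {FF : ProperFilter F}
    (f : T -> R[i]) (l l' : R[i]) :
  f @ F --> (l : R[i]^o) -> f @ F --> (l' : R[i]^o) -> l = l'.
Proof. by move=> fl fl'; exact: (@cvg_unique _ (@norm_hausdorff _ R[i]^o) _ _ _ _ fl fl'). Qed.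

End Modulus.

(** * Unordered sums *)

#[global] Existing Instance totally_filter.

Section UnorderedSums.
Context {R : realType}.
Local Open Scope fset_scope.
Local Open Scope ring_scope.

Definition has_sum (T : choiceType) (f : T -> R[i]) (S : R[i]) :=
  (partial_sum f A @[A --> @totally T] --> (S : R[i]^o))%classic.

Definition abs_sum_le (T : choiceType) (f : T -> R[i]) (M : R) :=
  forall A : {fset T}, \sum_(x <- A) cmod (f x) <= M.

Definition csum (T : choiceType) (f : T -> R[i]) : R[i] :=
  lim (partial_sum f A @[A --> @totally T] : set_system R[i]^o).

Variable T : choiceType.
Implicit Types (f g : T -> R[i]) (A B : {fset T}).

Lemma partial_sumE f A : partial_sum f A = \sum_(x <- A) f x.
Proof. by rewrite /partial_sum big_seq_fsetE. Qed.

Lemma near_totally (P : {fset T} -> Prop) :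
  (\forall A \near @totally T, P A)%classic <->
  exists A0, forall A, A0 `<=` A -> P A.
Proof.
split=> [[A0 _ A0P]|[A0 A0P]]; first by exists A0 => A /A0P.
by exists A0 => // A; exact: A0P.
Qed.

Lemma has_sumP f S : has_sum f S <->
  forall e, 0 < e -> exists A0, forall A, A0 `<=` A ->
    cmod (\sum_(x <- A) f x - S) <= e.
Proof.
split=> [fS e e0|fS].
  have [A0 A0P] := (near_totally _).1 ((ccvgP _ _).1 fS e e0).
  by exists A0 => A /A0P; rewrite partial_sumE.
apply/ccvgP => e /fS[A0 A0P]; apply/near_totally; exists A0 => A /A0P.
by rewrite partial_sumE.
Qed.

Lemma has_sum_unique f S S' : has_sum f S -> has_sum f S' -> S = S'.
Proof. exact: ccvg_unique. Qed.

Lemma has_sum_csum f S : has_sum f S -> csum f = S.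
Proof.
move=> fS; have c : (cvg ((partial_sum f A @[A --> @totally T]) : set_system R[i]^o))%classic.
  by apply/cvg_ex; exists S.
exact: has_sum_unique (c) fS.
Qed.

Lemma has_sumD f g S S' :
  has_sum f S -> has_sum g S' -> has_sum (fun x => f x + g x) (S + S').
Proof.
move=> /has_sumP fS /has_sumP gS'; apply/has_sumP => e e0.
have e20 : 0 < e / 2 by rewrite divr_gt0.
have [A0 A0P] := fS _ e20; have [A1 A1P] := gS' _ e20.
exists (A0 `|` A1) => A; rewrite fsubUset => /andP[/A0P le0 /A1P le1].
rewrite big_split/= opprD addrACA.
by rewrite (le_trans (cmodD _ _))// [leRHS]splitr lerD.
Qed.

Lemma has_sumZ c f S : has_sum f S -> has_sum (fun x => c * f x) (c * S).
Proof.
move=> /has_sumP fS; apply/has_sumP => e e0.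
have c0 : 0 < cmod c + 1 by rewrite ltr_wpDl// cmod_ge0.
have [A0 A0P] := fS _ (divr_gt0 e0 c0).
exists A0 => A /A0P leA; rewrite -mulr_sumr -mulrBr cmodM.
rewrite (le_trans (ler_wpM2l (cmod_ge0 _) leA))//.
by rewrite mulrCA ler_piMr ?ltW// ltr_pdivrMr// mul1r ltrDl.
Qed.

Lemma has_sum_bound f S M :
  has_sum f S -> (forall A, cmod (\sum_(x <- A) f x) <= M) -> cmod S <= M.
Proof.
move=> fS fM; apply: (ccvg_bound fS); apply/near_totally.
by exists fset0 => A _; rewrite partial_sumE.
Qed.

Lemma cmod_sumA f A : cmod (\sum_(x <- A) f x) <= \sum_(x <- A) cmod (f x).
Proof. exact: cmod_sum. Qed.

Lemma has_sum_abs_bound f S M :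
  has_sum f S -> abs_sum_le f M -> cmod S <= M.
Proof.
by move=> fS fM; apply: (has_sum_bound fS) => A; rewrite (le_trans (cmod_sumA _ _)).
Qed.

Lemma big_fsetU_disj (V : nmodType) (g : T -> V) A B :
  [disjoint A & B] ->
  \sum_(x <- A `|` B) g x = \sum_(x <- A) g x + \sum_(x <- B) g x.
Proof.
move=> dAB; rewrite (big_fsetID _ (mem A))/=; congr (_ + _).
  by apply: eq_fbigl => x; rewrite !inE/=; case: (x \in A) => //=; rewrite andbF.
apply: eq_fbigl => x; rewrite !inE/=; case: (boolP (x \in A)) => //=.
  by move=> /(fdisjointP dAB) /negbTE ->.
by rewrite andbT.
Qed.

Lemma fset_split (V : nmodType) (g : T -> V) A B : A `<=` B ->
  \sum_(x <- B) g x = \sum_(x <- A) g x + \sum_(x <- B `\` A) g x.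
Proof.
move=> AB; rewrite -big_fsetU_disj ?fsetUDl; last first.
  by rewrite -fsetI_eq0 fsetIDA fsetIC -fsetIDA fsetDv fsetI0.
by rewrite fsetDv fsetD0 (fsetUidPr _ _ AB).
Qed.

Lemma fset_le_sum (g : T -> R) A B : (forall x, 0 <= g x) -> A `<=` B ->
  \sum_(x <- A) g x <= \sum_(x <- B) g x.
Proof. by move=> g0 /fset_split->; rewrite lerDl sumr_ge0. Qed.

(** The set A0 nearly attains the supremum of the finite sums, which leaves
    little for the sets disjoint from it. *)
Lemma abs_tail (g : T -> R) M : (forall x, 0 <= g x) ->
  (forall A, \sum_(x <- A) g x <= M) ->
  forall e, 0 < e -> exists A0,
    (forall B, [disjoint A0 & B] -> \sum_(x <- B) g x <= e) /\
    sup [set s | exists A, s = \sum_(x <- A) g x]%classic - e <=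
      \sum_(x <- A0) g x.
Proof.
move=> g0 gM e e0; set E := [set _ | _]%classic.
have E0 : E (\sum_(x <- fset0) g x) by exists fset0.
have supE : has_sup E.
  by split; [exists (\sum_(x <- fset0) g x)|exists M => _ [A ->]].
have [_ [A0 ->] lt0] := sup_adherent e0 supE.
exists A0; split; last exact: ltW.
move=> B A0B; rewrite -(lerD2l (\sum_(x <- A0) g x)) -big_fsetU_disj//.
rewrite (@le_trans _ _ (sup E))//; last by rewrite -lerBlDr ltW.
by apply: ub_le_sup; [exact: supE.2|exists (A0 `|` B)].
Qed.

Lemma disjD A B : [disjoint A & B `\` A].
Proof. by rewrite -fsetI_eq0 fsetIDA fsetIC -fsetIDA fsetDv fsetI0. Qed.

Lemma nneg_sum_cvg (g : T -> R) M : (forall x, 0 <= g x) ->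
  (forall A, \sum_(x <- A) g x <= M) ->
  exists s, forall e, 0 < e -> exists A0, forall A, A0 `<=` A ->
    `|\sum_(x <- A) g x - s| <= e.
Proof.
move=> g0 gM; exists (sup [set s | exists A, s = \sum_(x <- A) g x]%classic).
move=> e e0; have [A0 [_ A0P]] := abs_tail g0 gM e0; exists A0 => A A0A.
set S := sup _ in A0P *.
have leS : \sum_(x <- A) g x <= S.
  by apply: ub_le_sup; [exists M => _ [B ->]|exists A].
by have := fset_le_sum g0 A0A; rewrite ler0_norm ?subr_le0//; lra.
Qed.

(** The moduli, and the terms increased by their moduli, are two nonnegative
    families, and their difference is g. *)
Lemma abs_sum_cvg (g : T -> R) M :
  (forall A, \sum_(x <- A) `|g x| <= M) ->
  exists s, forall e, 0 < e -> exists A0, forall A, A0 `<=` A ->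
    `|\sum_(x <- A) g x - s| <= e.
Proof.
move=> gM; have [s sP] := @nneg_sum_cvg (fun x => `|g x|) M (fun=> normr_ge0 _) gM.
have [||t tP] := @nneg_sum_cvg (fun x => `|g x| + g x) (M + M).
- by move=> x; rewrite -lerBlDr sub0r -normrN ler_norm.
- move=> A; rewrite big_split/= lerD// (le_trans _ (gM A))//.
  by apply: ler_sum => x _; rewrite ler_norm.
exists (t - s) => e e0; have e20 : 0 < e / 2 by rewrite divr_gt0.
have [A0 A0P] := sP _ e20; have [A1 A1P] := tP _ e20.
exists (A0 `|` A1) => A; rewrite fsubUset => /andP[/A0P le0 /A1P le1].
have -> : \sum_(x <- A) g x =
    \sum_(x <- A) (`|g x| + g x) - \sum_(x <- A) `|g x|.
  by rewrite big_split/= addrAC subrr add0r.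
move: le0 le1; set a := \sum_(_ <- _) _; set b := \sum_(_ <- _) _.
rewrite !ler_norml => /andP[? ?] /andP[? ?]; apply/andP; split; lra.
Qed.

Lemma abs_has_sum f M : abs_sum_le f M -> has_sum f (csum f).
Proof.
move=> fM.
have [|s sP] := @abs_sum_cvg (fun x => complex.Re (f x)) M.
  move=> A; rewrite (le_trans _ (fM A))//.
  by apply: ler_sum => x _; exact: Re_le_cmod.
have [|t tP] := @abs_sum_cvg (fun x => complex.Im (f x)) M.
  move=> A; rewrite (le_trans _ (fM A))//.
  by apply: ler_sum => x _; exact: Im_le_cmod.
suff fst : has_sum f (s +i* t) by rewrite (has_sum_csum fst).
apply/has_sumP => e e0; have e20 : 0 < e / 2 by rewrite divr_gt0.
have [A0 A0P] := sP _ e20; have [A1 A1P] := tP _ e20.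
exists (A0 `|` A1) => A; rewrite fsubUset => /andP[/A0P le0 /A1P le1].
rewrite (le_trans (cmod_le_ReIm _))// [leRHS]splitr.
by rewrite cReD cImD cRe_sum cIm_sum lerD.
Qed.

Lemma has_sum_tail f S A0 e :
  has_sum f S -> (forall B, [disjoint A0 & B] -> \sum_(x <- B) cmod (f x) <= e) ->
  cmod (S - \sum_(x <- A0) f x) <= e.
Proof.
move=> /has_sumP fS A0e; apply/ler_addgt0Pr => d /fS[A1 A1P].
have := A1P (A0 `|` A1) (fsubsetUr _ _).
rewrite (fset_split _ (fsubsetUl A0 A1)) => leS.
have := A0e _ (disjD A0 (A0 `|` A1)); move: leS.
set a := \sum_(_ <- _) _; set b := \sum_(_ <- _) _ => leS le1.
have le2 : cmod b <= e by rewrite (le_trans (cmod_sumA _ _)).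
have -> : S - a = b - (a + b - S) by ring.
by rewrite (le_trans (cmodB _ _))// lerD.
Qed.

(** Outside of a finite set all finite sums are bounded by 2. Keeping only the
    terms whose real part, or imaginary part, has a given sign turns this
    bound into one on the sums of the moduli. *)
Lemma has_sum_abs f S : has_sum f S -> exists M, abs_sum_le f M.
Proof.
move=> /has_sumP/(_ 1 ltr01)[A0 A0P].
have small B : [disjoint A0 & B] -> cmod (\sum_(x <- B) f x) <= 2.
  move=> dB; have := A0P _ (fsubsetUl A0 B); have := A0P _ (fsubset_refl A0).
  rewrite big_fsetU_disj//; set a := \sum_(_ <- _) _; set b := \sum_(_ <- _) _.
  move=> le1 le2; have -> : b = (a + b - S) - (a - S) by ring.
  by rewrite (le_trans (cmodB _ _))// -[2]/(1 + 1) lerD.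
have halves (p : R[i] -> R) : (forall z, `|p z| <= cmod z) ->
    (forall B, p (\sum_(x <- B) f x) = \sum_(x <- B) p (f x)) ->
    forall B, [disjoint A0 & B] -> \sum_(x <- B) `|p (f x)| <= 4.
  move=> ple psum B dB.
  have part (Q : pred T) : `|\sum_(x <- B | Q x) p (f x)| <= 2.
    rewrite (_ : \sum_(x <- B | Q x) p (f x) =
                 \sum_(x <- [fset x in B | Q x]) p (f x)).
      rewrite -psum (le_trans (ple _))// small//.
      apply/fdisjointP => x xA0; rewrite !inE/= (negbTE (fdisjointP dB x xA0))//.
    by rewrite big_fset_condE.
  rewrite (bigID (fun x => 0 <= p (f x)))/=.
  rewrite (eq_bigr (fun x => p (f x))) => [|x /ger0_norm//].
  rewrite [X in _ + X](eq_bigr (fun x => - p (f x))); last first.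
    by move=> x; rewrite -ltNge => /ltW /ler0_norm.
  have -> : 4 = 2 + 2 :> R by rewrite -natrD.
  rewrite sumrN lerD//.
    exact: le_trans (ler_norm _) (part (fun x => 0 <= p (f x))).
  apply: le_trans (ler_norm _) _; rewrite normrN.
  exact: (part (fun x => ~~ (0 <= p (f x)))).
exists (\sum_(x <- A0) cmod (f x) + (4 + 4)) => A.
rewrite (le_trans (fset_le_sum (fun=> cmod_ge0 _) (fsubsetUr A0 A)))//.
rewrite (fset_split _ (fsubsetUl A0 A)) lerD2l.
have dD := disjD A0 (A0 `|` A).
rewrite (le_trans (ler_sum _ (fun x _ => cmod_le_ReIm (f x))))// big_split lerD//.
  by apply: (halves _ Re_le_cmod) => // B; rewrite cRe_sum.
by apply: (halves _ Im_le_cmod) => // B; rewrite cIm_sum.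
Qed.

Lemma eq_has_sum f g S : f =1 g -> has_sum f S -> has_sum g S.
Proof. by move=> /funext ->. Qed.

Lemma eq_csum f g : f =1 g -> csum f = csum g.
Proof. by move=> /funext ->. Qed.

End UnorderedSums.

(** * Rearrangements and products of unordered sums *)

Section SumRearrangement.
Context {R : realType}.
Local Open Scope fset_scope.
Local Open Scope ring_scope.

Lemma has_sum_near (T : choiceType) (f : T -> R[i]) S A0 c e :
  has_sum f S -> (forall A, A0 `<=` A -> cmod (\sum_(x <- A) f x - c) <= e) ->
  cmod (S - c) <= e.
Proof.
move=> /has_sumP fS fc; apply/ler_addgt0Pr => d /fS[A1 A1P].
have le1 := fc _ (fsubsetUl A0 A1); have le2 := A1P _ (fsubsetUr A0 A1).
rewrite [leRHS]addrC; apply: le_trans (cmod_dist_tri (\sum_(x <- A0 `|` A1) f x) _ _) _.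
by rewrite lerD// cmodBC.
Qed.

Lemma has_sum_sum (T I : choiceType) (B : {fset I}) (f : I -> T -> R[i]) S :
  (forall i, has_sum (f i) (S i)) ->
  has_sum (fun x => \sum_(i <- B) f i x) (\sum_(i <- B) S i).
Proof.
move=> fS; elim: (B : seq I) => [|i s IH].
  rewrite big_nil; apply/has_sumP => e e0; exists fset0 => A _.
  by rewrite big1 ?subr0 ?cmod0 ?ltW// => x _; rewrite big_nil.
rewrite big_cons; apply: eq_has_sum (has_sumD (fS i) IH) => x.
by rewrite big_cons.
Qed.

(** A finite rectangle which almost attains the supremum of the double sums of
    moduli also determines both iterated sums up to a small error. *)
Lemma has_sum_Fubini (K I : choiceType) (f : K -> I -> R[i]) (M : R) t s S :
  (forall (A : {fset K}) (B : {fset I}), \sum_(k <- A) \sum_(m <- B) cmod (f k m) <= M) ->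
  (forall k, has_sum (f k) (t k)) -> has_sum t S ->
  (forall m, has_sum (f^~ m) (s m)) -> has_sum s S.
Proof.
move=> fM ft tS fs; apply/has_sumP => e e0.
pose E : set R := [set r | exists (A : {fset K}) (B : {fset I}),
  r = \sum_(k <- A) \sum_(m <- B) cmod (f k m)]%classic.
have supE : has_sup E.
  split; first by exists (\sum_(k <- @fset0 K) \sum_(m <- @fset0 I) cmod (f k m)), fset0, fset0.
  by exists M => _ [A [B ->]].
have e20 : 0 < e / 2 by rewrite divr_gt0.
have [_ [A0 [B0 ->]] lt0] := sup_adherent e20 supE.
set c := \sum_(k <- A0) \sum_(m <- B0) f k m.
have close (A : {fset K}) (B : {fset I}) : A0 `<=` A -> B0 `<=` B ->
    cmod (\sum_(k <- A) \sum_(m <- B) f k m - c) <= e / 2.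
  move=> A0A B0B.
  have ub : \sum_(k <- A) \sum_(m <- B) cmod (f k m) <= sup E.
    by apply: ub_le_sup; [exact: supE.2|exists A, B].
  have split (V : nmodType) (g : K -> I -> V) : \sum_(k <- A) \sum_(m <- B) g k m =
      \sum_(k <- A0) \sum_(m <- B0) g k m +
      (\sum_(k <- A0) \sum_(m <- B `\` B0) g k m +
      \sum_(k <- A `\` A0) \sum_(m <- B) g k m).
    rewrite (fset_split _ A0A) addrA; congr (_ + _).
    by rewrite -big_split; apply: eq_bigr => k _; rewrite (fset_split _ B0B).
  move: ub; rewrite !split /c addrAC subrr add0r => ub.
  apply: le_trans (cmodD _ _) _.
  apply: (@le_trans _ _ (\sum_(k <- A0) \sum_(m <- B `\` B0) cmod (f k m) +
      \sum_(k <- A `\` A0) \sum_(m <- B) cmod (f k m))); last by lra.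
  by rewrite lerD//; (apply: le_trans (cmod_sum _ _ _) _; apply: ler_sum => k _;
    exact: cmod_sum).
exists B0 => B B0B.
have le1 : cmod (\sum_(m <- B) s m - c) <= e / 2.
  apply: (@has_sum_near _ _ _ A0 _ _ (has_sum_sum (B := B) fs)) => A A0A.
  exact: close.
have le2 : cmod (S - c) <= e / 2.
  apply: (@has_sum_near _ _ _ A0 _ _ tS) => A A0A.
  apply: (@has_sum_near _ _ _ B0 _ _ (has_sum_sum (B := A) ft)) => B' B0B'.
  by rewrite exchange_big; exact: close.
rewrite [leRHS]splitr (le_trans (cmod_dist_tri c _ _))// lerD//.
by rewrite cmodBC.
Qed.

Definition exhausts (T : choiceType) (B : nat -> {fset T}) :=
  forall A : {fset T}, exists N0, forall N, (N0 <= N)%N -> A `<=` B N.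

Lemma has_sum_exhaust (T : choiceType) (B : nat -> {fset T}) f S :
  exhausts B -> has_sum f S ->
  (\sum_(x <- B N) f x @[N --> \oo] --> (S : R[i]^o))%classic.
Proof.
move=> BA /has_sumP fS; apply/ccvgP => e /fS[A0 A0P].
have [N0 N0P] := BA A0; exists N0 => // N /= /N0P; exact: A0P.
Qed.

(** Absolute boundedness provides some unordered sum, and a single exhausting
    sequence of finite sets then identifies it. *)
Lemma exhaust_has_sum (T : choiceType) (B : nat -> {fset T}) f M S :
  exhausts B -> abs_sum_le f M ->
  (\sum_(x <- B N) f x @[N --> \oo] --> (S : R[i]^o))%classic -> has_sum f S.
Proof.
move=> BA fM fS; have fs := abs_has_sum fM.
by rewrite -(ccvg_unique (has_sum_exhaust BA fs) fS).
Qed.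

Lemma abs_sum_exhaust (T : choiceType) (B : nat -> {fset T}) (f : T -> R[i]) M :
  exhausts B -> (forall N, \sum_(x <- B N) cmod (f x) <= M) -> abs_sum_le f M.
Proof.
move=> BA BM A; have [N /(_ N (leqnn _)) AB] := BA A.
by rewrite (le_trans (fset_le_sum (fun=> cmod_ge0 _) AB)).
Qed.

Definition natbox N : {fset nat} := [fset k in iota 0 N].

Lemma natbox_sum (V : nmodType) (f : nat -> V) N :
  \sum_(k <- natbox N) f k = \sum_(k < N) f k.
Proof.
rewrite -[RHS](big_mkord xpredT) /index_iota subn0; apply: perm_big.
by apply: uniq_perm; rewrite ?iota_uniq// => i; rewrite !inE.
Qed.

Lemma natbox_exhausts : exhausts natbox.
Proof.
move=> A; exists (\max_(k <- A) k).+1 => N leN; apply/fsubsetP => k kA.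
rewrite !inE/= mem_iota/= add0n (leq_trans _ leN)// ltnS.
by rewrite (@leq_bigmax_seq _ _ xpredT id).
Qed.

Variable n : nat.

Definition multibox N : {fset {ffun 'I_n -> nat}} :=
  [fset ([ffun i => val (x i)] : {ffun 'I_n -> nat}) |
     x : {ffun 'I_n -> 'I_N} in {: {ffun 'I_n -> 'I_N}}].

Lemma multibox_sum (V : nmodType) (f : {ffun 'I_n -> nat} -> V) N :
  \sum_(m <- multibox N) f m =
  \sum_(x : {ffun 'I_n -> 'I_N}) f [ffun i => val (x i)].
Proof.
rewrite big_imfset/=.
  by rewrite -big_enum/= enumT.
move=> x y _ _ /ffunP xy; apply/ffunP => i; apply: val_inj.
by have := xy i; rewrite !ffunE.
Qed.

Lemma multibox_exhausts : exhausts multibox.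
Proof.
move=> A; exists (\max_(m <- A) \max_i m i).+1 => N leN; apply/fsubsetP => m mA.
have mN i : (m i < N)%N.
  rewrite (leq_trans _ leN)// ltnS (leq_trans (leq_bigmax i))//.
  by rewrite (@leq_bigmax_seq _ _ xpredT (fun m : {ffun _ -> _} => \max_i m i)%N).
apply/imfsetP; exists [ffun i => Ordinal (mN i)] => //=.
by apply/ffunP => i; rewrite !ffunE.
Qed.

Lemma multibox_prod (V : comNzRingType) (f : 'I_n -> nat -> V) N :
  \sum_(m <- multibox N) \prod_i f i (m i) = \prod_i \sum_(j < N) f i j.
Proof.
rewrite multibox_sum bigA_distr_bigA; apply: eq_bigr => x _.
by apply: eq_bigr => i _; rewrite ffunE.
Qed.

Lemma abs_sum_prod (f : 'I_n -> nat -> R[i]) (M : 'I_n -> R) :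
  (forall i, abs_sum_le (f i) (M i)) ->
  abs_sum_le (fun m : {ffun 'I_n -> nat} => \prod_i f i (m i)) (\prod_i M i).
Proof.
move=> fM; apply: (abs_sum_exhaust multibox_exhausts) => N.
rewrite (eq_bigr (fun m : {ffun 'I_n -> nat} => \prod_i cmod (f i (m i)))); last first.
  by move=> m _; rewrite cmod_prod.
rewrite (multibox_prod (fun i j => cmod (f i j))) ler_prod// => i _.
apply/andP; split; first by apply: sumr_ge0 => j _; exact: cmod_ge0.
by rewrite -(natbox_sum (fun j => cmod (f i j))) fM.
Qed.

(** Over a box of multi-indices the sum of the products is the product of the
    partial sums, whose limit is known. *)
Lemma has_sum_prod (f : 'I_n -> nat -> R[i]) (S : 'I_n -> R[i]) :
  (forall i, has_sum (f i) (S i)) ->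
  has_sum (fun m : {ffun 'I_n -> nat} => \prod_i f i (m i)) (\prod_i S i).
Proof.
move=> fS; have /choice[M fM] : forall i, exists M, abs_sum_le (f i) M.
  by move=> i; exact: has_sum_abs (fS i).
apply: (exhaust_has_sum multibox_exhausts (abs_sum_prod fM)).
under eq_cvg do rewrite multibox_prod.
suff prodC (r : seq 'I_n) : (\prod_(i <- r) \sum_(j < N) f i j @[N --> \oo] -->
    (\prod_(i <- r) S i : R[i]^o))%classic by exact: prodC.
elim: r => [|i r IH].
  by rewrite big_nil; under eq_cvg do rewrite big_nil; exact: (@cvg_cst R[i]^o).
rewrite big_cons; under eq_cvg do rewrite big_cons.
apply: (@cvgM R[i] _ _ _ (fun N => \sum_(j < N) f i j) _ _ _ _ IH).
under eq_cvg do rewrite -natbox_sum.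
exact: has_sum_exhaust natbox_exhausts (fS i).
Qed.

End SumRearrangement.

(** * The complex exponential as the sum of its power series *)

Section ExponentialSeries.

(** The base field is a parameter because the truncated exponentials of
    complex numbers are compared with those of their moduli. *)
Definition exp_sum (F : numFieldType) (N : nat) (a : F) : F :=
  \sum_(m < N) a ^+ m / m`!%:R.

Lemma exp_termD (F : numFieldType) (N : nat) (a b : F) :
  (a + b) ^+ N / N`!%:R =
  \sum_(p < N.+1) a ^+ p / p`!%:R * (b ^+ (N - p) / (N - p)`!%:R).
Proof.
rewrite addrC exprDn mulr_suml; apply: eq_bigr => p _.
have pN : (p <= N)%N by rewrite -ltnS.
rewrite -mulr_natr -(bin_fact pN) !natrM.
have nz m : (m`!%:R : F) != 0 by rewrite pnatr_eq0 -lt0n fact_gt0.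
have nzC : ('C(N, p)%:R : F) != 0 by rewrite pnatr_eq0 -lt0n bin_gt0.
by field; rewrite !nz nzC.
Qed.

Lemma exp_sum_addE (F : numFieldType) (N : nat) (a b : F) :
  exp_sum N (a + b) =
  \sum_(p < N) \sum_(q < N | (p + q < N)%N) a ^+ p / p`!%:R * (b ^+ q / q`!%:R).
Proof.
pose t p q : F := a ^+ p / p`!%:R * (b ^+ q / q`!%:R).
transitivity (\sum_(p < N) \sum_(q < N - p) t p q); last first.
  apply: eq_bigr => p _.
  rewrite (big_ord_widen_cond N xpredT (fun q => t p q) (leq_subr p N)).
  by apply: eq_bigl => q; rewrite ltn_subRL.
rewrite /exp_sum; elim: N => [|N IH]; first by rewrite !big_ord0.
rewrite big_ord_recr/= IH [RHS]big_ord_recr/= subSn// subnn big_ord1.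
rewrite [X in _ = X + _](eq_bigr (fun p : 'I_N => \sum_(q < N - p) t p q + t p (N - p)%N));
  last by move=> p _; rewrite subSn ?big_ord_recr// ltnW.
rewrite big_split/= -addrA; congr (_ + _).
by rewrite exp_termD big_ord_recr/= subnn.
Qed.

(** The failure of the truncated exponential to be multiplicative consists of
    the terms of total degree at least N; for nonnegative arguments it tends to
    0, because the real exponential is multiplicative. *)
Lemma exp_sum_mulE (F : numFieldType) (N : nat) (a b : F) :
  exp_sum N a * exp_sum N b - exp_sum N (a + b) =
  \sum_(p < N) \sum_(q < N | (N <= p + q)%N) a ^+ p / p`!%:R * (b ^+ q / q`!%:R).
Proof.
apply/eqP; rewrite subr_eq exp_sum_addE big_distrl/= -big_split/=; apply/eqP.
apply: eq_bigr => p _; rewrite mulr_sumr (bigID (fun q : 'I_N => (N <= p + q)%N))/=.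
by congr (_ + _); apply: eq_bigl => q; rewrite ltnNge.
Qed.

Context {R : realType}.

Lemma ccvg_ReIm (T : Type) (F : set_system T) {FF : Filter F} (f : T -> R[i]) (a b : R) :
  complex.Re (f t) @[t --> F] --> a -> complex.Im (f t) @[t --> F] --> b ->
  f @ F --> ((a +i* b) : R[i]^o).
Proof.
move=> /cvgrPdist_le fa /cvgrPdist_le fb; apply/ccvgP => e e0.
have e20 : 0 < e / 2 by rewrite divr_gt0.
apply: filterS2 (fa _ e20) (fb _ e20) => t la lb.
rewrite (le_trans (cmod_le_ReIm _))// [leRHS]splitr.
by move: (f t) la lb => [x y]/= la lb; rewrite lerD// distrC.
Qed.

Lemma exp_sum_expR (x : R) : exp_sum N x @[N --> \oo] --> expR x.
Proof.
have := is_cvg_series_exp_coeff x; rewrite /expR /series/= => h.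
by rewrite /exp_sum; under eq_cvg do rewrite -(big_mkord xpredT (fun m => x ^+ m / m`!%:R)).
Qed.

Lemma exp_sum_le_expR N (x : R) : 0 <= x -> exp_sum N x <= expR x.
Proof.
move=> x0; rewrite /exp_sum -(big_mkord xpredT (fun m => x ^+ m / m`!%:R)).
apply: (nondecreasing_cvgn_le (u_ := series (exp_coeff x))); last exact: is_cvg_series_exp_coeff.
by apply: nondecreasing_series => k _ _; exact: exp_coeff_ge0.
Qed.

Definition cexp (z : R[i]) : R[i] :=
  (expR (complex.Re z))%:C * (cos (complex.Im z) +i* sin (complex.Im z)).

Lemma cexpD z w : cexp (z + w) = cexp z * cexp w.
Proof.
rewrite /cexp cReD cImD expRD cosD sinD rmorphM/= mulrACA; congr (_ * _).
by apply/eqP; rewrite eq_complex/= eqxx/= addrC.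
Qed.

Lemma cexp0 : cexp 0 = 1.
Proof. by rewrite /cexp/= expR0 cos0 sin0 mul1r. Qed.

Lemma cmod_cexp z : cmod (cexp z) = expR (complex.Re z).
Proof.
rewrite cmodM cmod_real ger0_norm ?expR_ge0//.
suff -> : cmod (cos (complex.Im z) +i* sin (complex.Im z)) = 1 by rewrite mulr1.
apply/eqP; rewrite -(@eqrXn2 _ 2) ?cmod_ge0// cmod_sqr/= cos2Dsin2.
by rewrite expr1n.
Qed.

Lemma exp_i_coeff (y : R) m :
  ((0 +i* y) ^+ m / m`!%:R : R[i]) = cos_coeff y m +i* sin_coeff y m.
Proof.
have iE : ((0 +i* 1) : R[i]) ^+ m =
    ((~~ odd m)%:R * (-1) ^+ m./2) +i* ((odd m)%:R * (-1) ^+ m.-1./2).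
  elim: m => [|m IH]; first by rewrite expr0 mul1r mul0r.
  rewrite exprS IH; simpc; rewrite /= negbK.
  case: m {IH} => [|m]/=; first by rewrite !mul0r !mul1r oppr0.
  rewrite negbK !uphalf_half/=; case: (odd m) => /=.
    by rewrite ?(mul1r,mul0r,oppr0,exprS, mulN1r,opprK).
  by rewrite ?(mul1r,mul0r,oppr0,exprS, mulN1r,opprK).
have -> : (0 +i* y) = y%:C * (0 +i* 1) :> R[i] by simpc.
rewrite exprMn iE -(rmorphXn (real_complex R)) -(rmorph_nat (real_complex R)).
rewrite -fmorphV/= /cos_coeff /sin_coeff /=; simpc.
by congr (_ +i* _); congr (_ * _); rewrite mulrC.
Qed.

Lemma cvg_cos_coeff (y : R) : series (cos_coeff y) @ \oo --> cos y.
Proof. by rewrite unlock; exact: is_cvg_series_cos_coeff. Qed.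

Lemma cvg_sin_coeff (y : R) : series (sin_coeff y) @ \oo --> sin y.
Proof. by rewrite unlock; exact: is_cvg_series_sin_coeff. Qed.

Lemma exp_sum_cis (y : R) :
  exp_sum N ((0 +i* y) : R[i]) @[N --> \oo] --> ((cos y +i* sin y) : R[i]^o).
Proof.
apply: ccvg_ReIm.
  rewrite (_ : (fun N => _) = series (cos_coeff y)); first exact: cvg_cos_coeff.
  apply/funext => N; rewrite /exp_sum cRe_sum seriesEord/=.
  by apply: eq_bigr => m _; rewrite exp_i_coeff.
rewrite (_ : (fun N => _) = series (sin_coeff y)); first exact: cvg_sin_coeff.
apply/funext => N; rewrite /exp_sum cIm_sum seriesEord/=.
by apply: eq_bigr => m _; rewrite exp_i_coeff.
Qed.

Lemma exp_sum_real N (x : R) : exp_sum N x%:C = (exp_sum N x)%:C :> R[i].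
Proof.
rewrite /exp_sum rmorph_sum; apply: eq_bigr => m _.
by rewrite fmorph_div/= rmorphXn rmorph_nat.
Qed.

Lemma exp_sum_defect_le N (a b : R[i]) :
  cmod (exp_sum N a * exp_sum N b - exp_sum N (a + b)) <=
  exp_sum N (cmod a) * exp_sum N (cmod b) - exp_sum N (cmod a + cmod b).
Proof.
rewrite !exp_sum_mulE (le_trans (cmod_sum _ _ _))//; apply: ler_sum => p _.
rewrite (le_trans (cmod_sum _ _ _))//; apply: ler_sum => q _.
by rewrite !cmodM !cmodV !cmodX !cmod_nat.
Qed.

(** The limit is known for real arguments, and for imaginary ones by the
    series of the sine and the cosine. Their sum is reached by exp_sum_mulE:
    the complex defect of multiplicativity is dominated by the real one, which
    tends to 0. *)
Lemma exp_sum_cexp z : exp_sum N z @[N --> \oo] --> (cexp z : R[i]^o).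
Proof.
case: z => x y; set a : R[i] := x%:C; set b : R[i] := 0 +i* y.
have zE : (x +i* y) = a + b by rewrite /a /b; simpc.
rewrite zE {1}/cexp/= addr0 add0r.
have cP : exp_sum N a * exp_sum N b @[N --> \oo] -->
    ((expR x)%:C * (cos y +i* sin y) : R[i]^o).
  apply: (@cvgM R[i] _ _ _ (fun N => exp_sum N a)); last exact: exp_sum_cis.
  rewrite (_ : (fun N => _) = (fun N => (exp_sum N x)%:C)); last first.
    by apply/funext => N; rewrite exp_sum_real.
  by apply: ccvg_ReIm => /=; [exact: exp_sum_expR|exact: cvg_cst].
have /cvgrPdist_le dP : exp_sum N (cmod a) * exp_sum N (cmod b) -
    exp_sum N (cmod a + cmod b) @[N --> \oo] --> (0 : R).
  rewrite -[0](subrr (expR (cmod a) * expR (cmod b))) -{2}expRD.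
  by apply: cvgB; [apply: cvgM; exact: exp_sum_expR|exact: exp_sum_expR].
apply/ccvgP => e e0; have e20 : 0 < e / 2 by rewrite divr_gt0.
apply: filterS2 (dP _ e20) ((ccvgP _ _).1 cP _ e20) => N.
rewrite sub0r normrN => /(le_trans (ler_norm _)) le1 le2.
rewrite [leRHS]splitr; apply: le_trans (cmod_dist_tri (exp_sum N a * exp_sum N b) _ _) _.
by rewrite lerD// cmodBC (le_trans (exp_sum_defect_le _ _ _)).
Qed.

Lemma abs_sum_exp (z : R[i]) : abs_sum_le (fun m => z ^+ m / m`!%:R) (expR (cmod z)).
Proof.
apply: (abs_sum_exhaust natbox_exhausts) => N.
rewrite natbox_sum (le_trans _ (exp_sum_le_expR N (cmod_ge0 z)))//.
by apply: ler_sum => m _; rewrite cmodM cmodV cmodX cmod_nat.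
Qed.

Lemma has_sum_exp (z : R[i]) : has_sum (fun m => z ^+ m / m`!%:R) (cexp z).
Proof.
apply: (exhaust_has_sum natbox_exhausts (abs_sum_exp z)).
by under eq_cvg do rewrite natbox_sum; exact: exp_sum_cexp.
Qed.

End ExponentialSeries.

(** * The basic character of the circle *)

Section Circle.
Context {R : realType}.
Implicit Types (z w : R[i]) (t : R).

Definition e1 z : R[i] := cexp ((0 +i* (2 * pi)) * z).

Lemma e1D z w : e1 (z + w) = e1 z * e1 w.
Proof. by rewrite /e1 mulrDr cexpD. Qed.

Lemma e1_0 : e1 0 = 1.
Proof. by rewrite /e1 mulr0 cexp0. Qed.

Lemma e1N z : e1 z * e1 (- z) = 1.
Proof. by rewrite -e1D subrr e1_0. Qed.

Lemma e1_real t : e1 t%:C = cos (2 * pi * t) +i* sin (2 * pi * t).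
Proof.
by rewrite /e1 /cexp cReM cImM/= mul0r mulr0 subr0 expR0 mul1r mul0r add0r.
Qed.

Lemma e1_int (m : int) : e1 m%:~R = 1.
Proof.
have e1_1 : e1 1 = 1.
  rewrite -[1 in LHS]/((1 : R)%:C) e1_real mulr1 [2 * pi]mulrC mulr_natr.
  by rewrite cos2pi sin2pi.
have e1_nat p : e1 p%:R = 1.
  elim: p => [|p IH]; first by rewrite e1_0.
  by rewrite -natr1 e1D IH e1_1 mulr1.
case: m => p; first exact: e1_nat.
by have := e1N p.+1%:R; rewrite e1_nat mul1r NegzE mulrNz.
Qed.

Lemma e1_sum (I : Type) (r : seq I) (f : I -> R[i]) :
  e1 (\sum_(i <- r) f i) = \prod_(i <- r) e1 (f i).
Proof. exact: (big_morph _ e1D e1_0). Qed.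

Lemma cmod_e1 z : cmod (e1 z) = expR (- (2 * pi * complex.Im z)).
Proof. by rewrite cmod_cexp cReM/= mul0r sub0r. Qed.

Lemma cmod_e1_real t : cmod (e1 t%:C) = 1.
Proof. by rewrite cmod_e1/= mulr0 oppr0 expR0. Qed.

Lemma cmod_1Be1_sin t : cmod (1 - e1 t%:C) = 2 * `|sin (pi * t)|.
Proof.
apply/eqP; rewrite -(@eqrXn2 _ 2) ?cmod_ge0 ?mulr_ge0// cmod_sqr e1_real.
rewrite !(cReD, cImD)/= exprMn real_normK ?num_real// sub0r sqrrN.
have -> : 2 * pi * t = (pi * t) *+ 2 by rewrite -mulrA mulr_natl.
have := cos2Dsin2 (pi * t); rewrite cos_mulr2n sin_mulr2n.
set c := cos _; set s := sin _ => h; apply/eqP.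
have -> : c ^+ 2 = 1 - s ^+ 2 by rewrite -h addrK.
have -> : (c * s *+ 2) ^+ 2 = 4 * c ^+ 2 * s ^+ 2 by ring.
have -> : c ^+ 2 = 1 - s ^+ 2 by rewrite -h addrK.
by ring.
Qed.

(** Concavity of the sine on [0, pi/2], through two applications of the mean
    value theorem to its difference with the chord. *)
Lemma sin_ge_chord (x : R) : 0 <= x <= pi / 2 -> 2 / pi * x <= sin x.
Proof.
move=> /andP[]; rewrite le_eqVlt => /predU1P[<- _|x0].
  by rewrite mulr0 sin0.
rewrite le_eqVlt => /predU1P[->|x1].
  have pi0 : pi != 0 :> R by rewrite gt_eqF ?pi_gt0.
  by rewrite sin_pihalf mulrA divfK// divff.
rewrite leNgt; apply/negP => lt_sin.
pose g (y : R) := sin y - 2 / pi * y; pose g' (y : R) := cos y - 2 / pi.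
have dg (y : R) : is_derive y 1 g (g' y).
  by rewrite /g /g'; apply: is_derive_eq; rewrite /GRing.scale/= mulr1.
have cg (a b : R) : {within `[a, b], continuous g}.
  apply: continuous_subspaceT => y.
  by apply: differentiable_continuous; apply/derivable1_diffP; have [] := dg y.
have [c1 /[!in_itv]/= /andP[c10 c1x] E1] := MVT x0 (fun y _ => dg y) (cg _ _).
have [c2 /[!in_itv]/= /andP[c2x c2p] E2] := MVT x1 (fun y _ => dg y) (cg _ _).
have g0 : g 0 = 0 by rewrite /g sin0 mulr0 subr0.
have g1 : g (pi / 2) = 0.
  have pi0 : pi != 0 :> R by rewrite gt_eqF ?pi_gt0.
  by rewrite /g sin_pihalf mulrA divfK// divff// subrr.
have gx : g x < 0 by rewrite /g subr_lt0.
have lt1 : g' c1 < 0.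
  by move: E1; rewrite g0 !subr0 => E1; move: gx; rewrite E1 pmulr_llt0.
have lt2 : 0 < g' c2.
  move: E2; rewrite g1 sub0r => E2.
  by move: gx; rewrite -oppr_gt0 E2 pmulr_lgt0// subr_gt0.
have : cos c2 < cos c1.
  rewrite ltr_cos ?in_itv/=; last 2 first.
  - by apply/andP; split; have := pi_gt0 R; lra.
  - by apply/andP; split; have := pi_gt0 R; lra.
  exact: lt_trans c1x c2x.
by move: lt1 lt2; rewrite /g'; lra.
Qed.

(** The chord between two points of the circle controls the arc, here the
    distance from t to the nearest integer. *)
Lemma cmod_1Be1_ge t (m : int) : `|t - m%:~R| <= 1 / 2 ->
  4 * `|t - m%:~R| <= cmod (1 - e1 t%:C).
Proof.
have -> : e1 t%:C = e1 (t - m%:~R)%:C.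
  by rewrite rmorphB/= rmorph_int -[in LHS](subrK m%:~R t%:C) e1D e1_int mulr1.
move: (t - _) => {t m} t tle; rewrite cmod_1Be1_sin.
have -> : `|sin (pi * t)| = sin (pi * `|t|).
  have s0 : 0 <= sin (pi * `|t|).
    apply: sin_ge0_pi; rewrite mulr_ge0 ?pi_ge0//=.
    by rewrite ler_piMr ?pi_ge0//; lra.
  rewrite -[RHS]ger0_norm//; have [//|t0] := ger0P t.
  by rewrite mulrN sinN normrN.
have := @sin_ge_chord (pi * `|t|); rewrite mulrA divfK ?gt_eqF ?pi_gt0//.
rewrite mulr_ge0 ?pi_ge0//=.
have -> : pi * `|t| <= pi / 2 by rewrite ler_pM2l ?pi_gt0//; lra.
by move=> /(_ isT); lra.
Qed.

Lemma near_int t : exists m : int, `|t - m%:~R| <= 1 / 2.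
Proof.
exists (Num.floor (t + 1 / 2)); have := floor_itv (t + 1 / 2).
rewrite intrD => /andP[? ?]; rewrite ler_norml; apply/andP; split; lra.
Qed.

End Circle.

(** * Trigonometric series on a strip *)

Section TrigonometricSeries.
Context {R : realType} {n : nat}.
Implicit Types (k l : 'rV[int]_n) (z w : 'rV[R[i]]_n) (a : 'rV[int]_n -> R[i]).

Definition echar k z : R[i] := e1 (\sum_i (k 0 i)%:~R * z 0 i).

Lemma echarE k z : echar k z = \prod_i e1 ((k 0 i)%:~R * z 0 i).
Proof. exact: e1_sum. Qed.

Lemma echarDr k z w : echar k (z + w) = echar k z * echar k w.
Proof.
rewrite /echar -e1D -big_split/=; congr e1; apply: eq_bigr => i _.
by rewrite mxE mulrDr.
Qed.

Lemma echarDl k l z : echar (k + l) z = echar k z * echar l z.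
Proof.
rewrite /echar -e1D -big_split/=; congr e1; apply: eq_bigr => i _.
by rewrite mxE rmorphD mulrDl.
Qed.

Lemma echar0 z : echar 0 z = 1.
Proof. by rewrite /echar big1 ?e1_0// => i _; rewrite mxE mul0r. Qed.

Lemma echarN k z : echar k z * echar (- k) z = 1.
Proof. by rewrite -echarDl subrr echar0. Qed.

Lemma echar_int k (m : 'rV[int]_n) : echar k (map_mx intr m) = 1.
Proof.
rewrite echarE big1// => i _; rewrite mxE -intrM; exact: e1_int.
Qed.

Lemma echar_periodic k z (m : 'rV[int]_n) :
  echar k (z + map_mx intr m) = echar k z.
Proof. by rewrite echarDr echar_int mulr1. Qed.

Lemma cmod_echar k z :
  cmod (echar k z) = expR (- (2 * pi * \sum_i (k 0 i)%:~R * complex.Im (z 0 i))).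
Proof.
rewrite cmod_e1 cIm_sum; congr (expR (- (_ * _))); apply: eq_bigr => i _.
by rewrite -(rmorph_int (real_complex R)) cImM/= mul0r addr0.
Qed.

Lemma real_vecE (x : 'rV[R]_n) i : real_vec x 0 i = (x 0 i)%:C.
Proof. by rewrite mxE. Qed.

Lemma cmod_echar_real k x : cmod (echar k (real_vec x)) = 1.
Proof.
rewrite cmod_echar big1 ?mulr0 ?oppr0 ?expR0// => i _.
by rewrite real_vecE/= mulr0.
Qed.

Lemma norm1E k : (norm1 k)%:R = \sum_i `|(k 0 i)%:~R| :> R.
Proof.
rewrite /norm1 natr_sum; apply: eq_bigr => i _.
by rewrite natr_absz intr_norm.
Qed.

Lemma cmod_echar_le k z (s : R) : (forall i, `|complex.Im (z 0 i)| <= s) ->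
  cmod (echar k z) <= expR (2 * pi * (norm1 k)%:R * s).
Proof.
move=> zs; rewrite cmod_echar ler_expR -mulrN -mulrA ler_pM2l; last first.
  by rewrite mulr_gt0// pi_gt0.
rewrite norm1E mulr_suml -sumrN; apply: ler_sum => i _.
by rewrite (le_trans (ler_norm _))// normrN normrM ler_wpM2l.
Qed.

Lemma echar_real_dot k (x : 'rV[R]_n) :
  echar k (real_vec x) = e1 (dotZ k x)%:C.
Proof.
rewrite /echar /dotZ rmorph_sum; congr e1; apply: eq_bigr => i _.
by rewrite real_vecE rmorphM/= rmorph_int.
Qed.

Lemma strip_add_real rho z x : strip rho z -> strip rho (z + real_vec x).
Proof. by move=> sz i; rewrite !mxE cImD/= addr0; exact: sz. Qed.

Lemma strip0 rho : 0 < rho -> strip rho (0 : 'rV[R[i]]_n).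
Proof. by move=> r0 i; rewrite mxE/= normr0. Qed.

Lemma strip_real rho x : 0 < rho -> strip rho (real_vec (x : 'rV[R]_n)).
Proof. by move=> r0; rewrite -[real_vec x]add0r; exact/strip_add_real/strip0. Qed.

Lemma strip_sub rho z : 0 < rho -> strip rho z ->
  exists s, [/\ 0 <= s, s < rho & forall i, `|complex.Im (z 0 i)| <= s].
Proof.
move=> r0 sz; exists (\big[Num.max/0]_i `|complex.Im (z 0 i)|); split.
- by elim/big_rec: _ => // i x _ x0; rewrite le_max x0 orbT.
- by elim/big_rec: _ => // i x _ xr; rewrite gt_max sz.
- by move=> i; rewrite (le_bigmax 0 (fun i => `|complex.Im (z 0 i)|)).
Qed.

Lemma strip_le (rho rho' : R) z : rho <= rho' -> strip rho z -> strip rho' z.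
Proof. by move=> le sz i; exact: lt_le_trans (sz i) le. Qed.

(** Coefficients of a function analytic on the strip of half-width rho. *)
Definition decays (rho : R) a := forall s, s < rho ->
  exists B, forall A : {fset 'rV[int]_n},
    \sum_(k <- A) cmod (a k) * expR (2 * pi * (norm1 k)%:R * s) <= B.

Definition tseries a z := csum (fun k => a k * echar k z).

Lemma decays_abs rho a (s : R) : decays rho a -> s < rho ->
  exists B, forall z, (forall i, `|complex.Im (z 0 i)| <= s) ->
  abs_sum_le (fun k => a k * echar k z) B.
Proof.
move=> da /da[B aB]; exists B => {}z zs A; apply: le_trans (aB A).
apply: ler_sum => k _; rewrite cmodM ler_wpM2l ?cmod_ge0//.
exact: cmod_echar_le.
Qed.

Lemma has_sum_tseries rho a z : 0 < rho -> decays rho a -> strip rho z ->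
  has_sum (fun k => a k * echar k z) (tseries a z).
Proof.
move=> r0 da sz; have [s [_ sr zs]] := strip_sub r0 sz.
by have [B aB] := decays_abs da sr; apply: abs_has_sum (aB z zs).
Qed.

Lemma tseries_periodic rho a : periodic_on_strip rho (tseries a).
Proof.
move=> z _ k; apply: eq_csum => l; by rewrite echar_periodic.
Qed.

(** The coefficient of h^m in the power series of the character k at 0. *)
Definition exp_coef k (m : {ffun 'I_n -> nat}) : R[i] :=
  \prod_i (((0 +i* (2 * pi)) * (k 0 i)%:~R) ^+ m i / (m i)`!%:R).

Lemma exp_coefE k m (h : 'rV[R[i]]_n) : exp_coef k m * \prod_i h 0 i ^+ m i =
  \prod_i (((0 +i* (2 * pi)) * ((k 0 i)%:~R * h 0 i)) ^+ m i / (m i)`!%:R).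
Proof.
rewrite -big_split/=; apply: eq_bigr => i _.
by rewrite [in RHS]mulrA [in RHS]exprMn mulrAC.
Qed.

Lemma has_sum_echar k (h : 'rV[R[i]]_n) :
  has_sum (fun m => exp_coef k m * \prod_i h 0 i ^+ m i) (echar k h).
Proof.
rewrite echarE; apply: eq_has_sum (has_sum_prod _); last first.
  by move=> i; exact: has_sum_exp.
by move=> m; rewrite exp_coefE.
Qed.

Lemma abs_sum_echar k (h : 'rV[R[i]]_n) (r : R) : (forall i, cmod (h 0 i) <= r) ->
  abs_sum_le (fun m => exp_coef k m * \prod_i h 0 i ^+ m i)
    (expR (2 * pi * (norm1 k)%:R * r)).
Proof.
move=> hr A.
pose f i (j : nat) := ((0 +i* (2 * pi)) * ((k 0 i)%:~R * h 0 i)) ^+ j / j`!%:R.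
have := @abs_sum_prod R n f _ (fun i => abs_sum_exp _) A.
rewrite -expR_sum => le1; apply: le_trans (le_trans le1 _).
  by apply: ler_sum => m _; rewrite exp_coefE.
rewrite ler_expR norm1E -mulrA mulr_suml mulr_sumr; apply: ler_sum => i _.
rewrite !cmodM (_ : cmod (0 +i* (2 * pi)) = 2 * pi); last first.
  apply/eqP; rewrite -(@eqrXn2 _ 2) ?cmod_ge0 ?mulr_ge0 ?pi_ge0//.
  by rewrite cmod_sqr/= expr0n add0r.
rewrite ler_wpM2l ?mulr_ge0 ?pi_ge0// -(rmorph_int (real_complex R)) cmod_real.
by rewrite ler_wpM2l.
Qed.

(** Each character is expanded around z, and the two sums are exchanged: the
    double series is dominated by the decay of the coefficients on the strip
    of half-width s + r, which is less than rho. *)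
Lemma tseries_analytic rho a z : 0 < rho -> decays rho a -> strip rho z ->
  analytic_at (tseries a) z.
Proof.
move=> r0 da sz; have [s [s0 sr zs]] := strip_sub r0 sz.
pose r := (rho - s) / 2.
have rgt0 : 0 < r by rewrite divr_gt0// subr_gt0.
have srr : s + r < rho by rewrite /r; lra.
have [B aB] := da _ srr.
have abs2 (h : 'rV[R[i]]_n) (A : {fset 'rV[int]_n}) (C : {fset {ffun 'I_n -> nat}}) :
    (forall i, cmod (h 0 i) <= r) ->
    \sum_(k <- A) \sum_(m <- C)
      cmod (a k * echar k z * (exp_coef k m * \prod_i h 0 i ^+ m i)) <= B.
  move=> hr; apply: le_trans (aB A); apply: ler_sum => k _.
  under eq_bigr do rewrite cmodM.
  rewrite -mulr_sumr mulrDr expRD [leRHS]mulrA cmodM.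
  apply: ler_pM; rewrite ?mulr_ge0 ?cmod_ge0 ?sumr_ge0//.
  - by move=> m _; exact: cmod_ge0.
  - by rewrite ler_wpM2l ?cmod_ge0 ?cmod_echar_le.
  - exact: abs_sum_echar.
pose am m := csum (fun k => a k * echar k z * exp_coef k m).
have amP m : has_sum (fun k => a k * echar k z * exp_coef k m) (am m).
  apply: (@abs_has_sum _ _ _ (B / r ^+ (\sum_i m i))) => A.
  have rm : 0 < r ^+ (\sum_i m i) by rewrite exprn_gt0.
  rewrite ler_pdivlMr// mulr_suml.
  have := abs2 (const_mx r%:C) A [fset m]%fset.
  have hr i : cmod ((const_mx r%:C : 'rV_n) 0 i) <= r.
    by rewrite mxE cmod_real gtr0_norm.
  move=> /(_ hr); apply: le_trans; apply: ler_sum => k _.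
  rewrite big_seq_fset1 mulrA [leRHS]cmodM ler_wpM2l ?cmod_ge0//.
  rewrite cmod_prod expr_sum; apply: ler_prod => i _.
  by rewrite exprn_ge0 ?(ltW rgt0)//= mxE cmodX cmod_real gtr0_norm.
exists am, r; split=> // h hr.
have hr' i : cmod (h 0 i) < r by rewrite -ltcR -cmodE.
have szh : strip rho (z + h).
  move=> i; rewrite mxE cImD (le_lt_trans (ler_normD _ _))//.
  by rewrite (le_lt_trans _ srr)// lerD// ltW// (le_lt_trans (Im_le_cmod _)).
apply: (@has_sum_Fubini _ _ _
  (fun k m => a k * echar k z * (exp_coef k m * \prod_i h 0 i ^+ m i)) B
  (fun k => a k * echar k (z + h))).
- by move=> A C; apply: abs2 => i; exact: ltW.
- by move=> k; rewrite echarDr mulrA; exact/has_sumZ/has_sum_echar.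
- exact: has_sum_tseries szh.
- move=> m; have := has_sumZ (c := \prod_i h 0 i ^+ m i) (amP m).
  by rewrite [_ * am m]mulrC; apply: eq_has_sum => k; rewrite mulrC mulrA.
Qed.

Lemma tseries_analytic_on rho a : 0 < rho -> decays rho a ->
  analytic_on_torus rho (tseries a).
Proof.
by move=> r0 da; split=> [|z]; [exact: tseries_periodic|exact: tseries_analytic].
Qed.

End TrigonometricSeries.

(** * Uniform difference estimates for analytic functions *)

Section Regularity.
Context {R : realType} {n : nat}.
Implicit Types (z w : 'rV[R[i]]_n) (f g : 'rV[R[i]]_n -> R[i]).

Definition delta g (j : 'I_n) (h : R[i]) z : R[i] :=
  g (z + h *: delta_mx 0 j) - g z.

(** The last estimate compares the difference quotients of g for the
    increments h and s. It follows from the Taylor formula of order 2, but it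
    involves no derivative, and it passes to products and to sums of series. *)
Definition reg_at (C eta : R) g z :=
  cmod (g z) <= C /\ forall j h s, cmod h <= eta -> cmod s <= eta ->
    cmod (delta g j h z) <= C * cmod h /\
    cmod (s * delta g j h z - h * delta g j s z) <=
      C * (cmod h * cmod s * (cmod h + cmod s)).

Definition regular (sigma : R) g := exists C eta,
  [/\ 0 <= C, 0 < eta & forall z, strip sigma z -> reg_at C eta g z].

Lemma reg_at_le C C' eta eta' g z : C <= C' -> eta' <= eta ->
  reg_at C eta g z -> reg_at C' eta' g z.
Proof.
move=> CC ee [gC gh]; split; first exact: le_trans CC.
move=> j h s hh ss; have [le1 le2] := gh j h s (le_trans hh ee) (le_trans ss ee).
split; first by rewrite (le_trans le1)// ler_wpM2r ?cmod_ge0.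
by rewrite (le_trans le2)// ler_wpM2r// !mulr_ge0 ?addr_ge0 ?cmod_ge0.
Qed.

Lemma reg_atD C C' eta f g z : reg_at C eta f z -> reg_at C' eta g z ->
  reg_at (C + C') eta (fun w => f w + g w) z.
Proof.
move=> [fC fh] [gC gh]; split; first by rewrite (le_trans (cmodD _ _))// lerD.
move=> j h s hh ss; have [f1 f2] := fh j h s hh ss; have [g1 g2] := gh j h s hh ss.
have dE h' : delta (fun w => f w + g w) j h' z = delta f j h' z + delta g j h' z.
  by rewrite /delta; ring.
rewrite !dE !mulrDl; split; first by rewrite (le_trans (cmodD _ _))// lerD.
have -> (a b c d : R[i]) : s * (a + b) - h * (c + d) =
  (s * a - h * c) + (s * b - h * d) by ring.
by rewrite (le_trans (cmodD _ _))// lerD.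
Qed.

Lemma reg_atM C C' eta f g z : 0 <= C -> 0 <= C' -> eta <= 1 ->
  reg_at C eta f z -> reg_at C' eta g z ->
  reg_at (3 * C * C') eta (fun w => f w * g w) z.
Proof.
move=> C0 C'0 e1 [fC fh] [gC gh]; have CC0 : 0 <= C * C' by exact: mulr_ge0.
split.
  rewrite cmodM (le_trans (ler_pM (cmod_ge0 _) (cmod_ge0 _) fC gC))//.
  by rewrite -mulrA ler_peMl// ler1n.
move=> j h s hh ss; have [f1 f2] := fh j h s hh ss; have [g1 g2] := gh j h s hh ss.
have [f3 _] := fh j s s ss ss; have [g3 _] := gh j s s ss ss.
have dE h' : delta (fun w => f w * g w) j h' z =
    delta f j h' z * g z + f z * delta g j h' z + delta f j h' z * delta g j h' z.
  by rewrite /delta; ring.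
have h1 : cmod h <= 1 by exact: le_trans hh e1.
have prod (a b : R[i]) (x y : R) : cmod a <= x -> cmod b <= y -> cmod (a * b) <= x * y.
  by move=> ax bxy; rewrite cmodM ler_pM ?cmod_ge0.
have h0 := cmod_ge0 h; have s0 := cmod_ge0 s.
split.
  rewrite dE; have le1 := prod _ _ _ _ f1 gC; have le2 := prod _ _ _ _ fC g1.
  have le3 := prod _ _ _ _ f1 g1.
  rewrite (le_trans (cmodD _ _))// (le_trans (lerD (cmodD _ _) (lexx _)))//.
  (* the product of the two increments is of order 2, and |h| <= 1 *)
  have : C * cmod h * (C' * cmod h) <= C * C' * cmod h.
    by rewrite mulrACA ler_wpM2l// ler_piMr.
  by move: le1 le2 le3; lra.
rewrite !dE.
have -> : s * (delta f j h z * g z + f z * delta g j h z +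
               delta f j h z * delta g j h z) -
          h * (delta f j s z * g z + f z * delta g j s z +
               delta f j s z * delta g j s z) =
  (s * delta f j h z - h * delta f j s z) * g z +
  f z * (s * delta g j h z - h * delta g j s z) +
  (s * (delta f j h z * delta g j h z) - h * (delta f j s z * delta g j s z)).
  by ring.
have le1 := prod _ _ _ _ f2 gC; have le2 := prod _ _ _ _ fC g2.
have le3 := prod _ _ _ _ (lexx (cmod s)) (prod _ _ _ _ f1 g1).
have le4 := prod _ _ _ _ (lexx (cmod h)) (prod _ _ _ _ f3 g3).
rewrite (le_trans (cmodD _ _))// (le_trans (lerD (cmodD _ _) (cmodB _ _)))//.
rewrite (le_trans (lerD (lerD le1 le2) (lerD le3 le4)))//.
by rewrite le_eqVlt; apply/orP; left; apply/eqP; ring.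
Qed.

Lemma regularD sigma f g :
  regular sigma f -> regular sigma g -> regular sigma (fun z => f z + g z).
Proof.
move=> [C [e [C0 e0 fP]]] [C' [e' [C'0 e'0 gP]]].
exists (C + C'), (Num.min e e'); split; rewrite ?addr_ge0// ?lt_min ?e0//.
move=> z sz; apply: reg_atD.
  by apply: reg_at_le (fP z sz) => //; rewrite ge_min lexx.
by apply: reg_at_le (gP z sz) => //; rewrite ge_min lexx orbT.
Qed.

Lemma regularM sigma f g :
  regular sigma f -> regular sigma g -> regular sigma (fun z => f z * g z).
Proof.
move=> [C [e [C0 e0 fP]]] [C' [e' [C'0 e'0 gP]]].
exists (3 * C * C'), (Num.min 1 (Num.min e e')); split.
- by rewrite !mulr_ge0.
- by rewrite !lt_min e0 e'0 ltr01.
- move=> z sz; apply: reg_atM; rewrite ?ge_min ?lexx//.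
    by apply: reg_at_le (fP z sz); rewrite // !ge_min lexx orbT.
  by apply: reg_at_le (gP z sz); rewrite // !ge_min lexx !orbT.
Qed.

(** The first two Taylor estimates of a power, with the loss of radius eta
    absorbed by the same power at a larger point, so that they can be summed
    over all monomials of a convergent power series. *)
Lemma pow_taylor (w : R[i]) (eta : R) (m : nat) : 0 < eta ->
  exists d, forall h, cmod h <= eta ->
    cmod ((w + h) ^+ m - w ^+ m) <= cmod h / eta * (cmod w + eta) ^+ m /\
    cmod ((w + h) ^+ m - w ^+ m - d * h) <=
      (cmod h / eta) ^+ 2 * (cmod w + eta) ^+ m.
Proof.
move=> e0; elim: m => [|m [d IH]].
  exists 0 => h hh; rewrite !expr0 !subrr mul0r subr0 cmod0.
  by rewrite !mulr1 exprn_ge0 ?divr_ge0 ?cmod_ge0 ?(ltW e0).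
exists (w * d + w ^+ m) => h hh; have [le1 le2] := IH h hh.
have wh : cmod (w + h) <= cmod w + eta by rewrite (le_trans (cmodD _ _))// lerD2l.
have whm : cmod ((w + h) ^+ m) <= (cmod w + eta) ^+ m.
  by rewrite cmodX lerXn2r ?nnegrE ?addr_ge0 ?cmod_ge0 ?(ltW e0).
have -> : (w + h) ^+ m.+1 - w ^+ m.+1 =
    w * ((w + h) ^+ m - w ^+ m) + h * (w + h) ^+ m by rewrite !exprS; ring.
have -> : w * ((w + h) ^+ m - w ^+ m) + h * (w + h) ^+ m - (w * d + w ^+ m) * h =
    w * ((w + h) ^+ m - w ^+ m - d * h) + h * ((w + h) ^+ m - w ^+ m) by ring.
have en0 : eta != 0 by rewrite gt_eqF.
split; apply: le_trans (cmodD _ _) _; rewrite !cmodM.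
  have -> : cmod h / eta * (cmod w + eta) ^+ m.+1 =
      cmod w * (cmod h / eta * (cmod w + eta) ^+ m) + cmod h * (cmod w + eta) ^+ m.
    by rewrite (exprS (cmod w + eta)); field.
  by rewrite lerD// ler_wpM2l ?cmod_ge0.
have -> : (cmod h / eta) ^+ 2 * (cmod w + eta) ^+ m.+1 =
    cmod w * ((cmod h / eta) ^+ 2 * (cmod w + eta) ^+ m) +
    cmod h * (cmod h / eta * (cmod w + eta) ^+ m).
  by rewrite (exprS (cmod w + eta)); field.
by rewrite lerD// ler_wpM2l ?cmod_ge0.
Qed.

Definition monom (m : {ffun 'I_n -> nat}) w : R[i] := \prod_i w 0 i ^+ m i.

Lemma monom_shift m w j h : monom m (w + h *: delta_mx 0 j) =
  (w 0 j + h) ^+ m j * \prod_(i | i != j) w 0 i ^+ m i.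
Proof.
rewrite /monom (bigD1 j)//= !mxE !eqxx mulr1; congr (_ * _).
by apply: eq_bigr => i ij; rewrite !mxE eqxx (negbTE ij) mulr0 addr0.
Qed.

(** The factors of a monomial other than the j-th one do not vary, so that
    only powers of one coordinate are to be expanded. *)
Lemma monom_reg (m : {ffun 'I_n -> nat}) w (eta r : R) : 0 < eta ->
  (forall i, cmod (w 0 i) + eta <= r) ->
  reg_at (\prod_i r ^+ m i * (1 + eta^-1 + eta^-2)) eta (monom m) w.
Proof.
move=> e0 wr; set X := \prod_i _.
have r0 (i : 'I_n) : 0 <= r by rewrite (le_trans _ (wr i))// addr_ge0 ?cmod_ge0 ?(ltW e0).
have X0 : 0 <= X by apply: prodr_ge0 => i _; rewrite exprn_ge0 ?r0.
have iw i : cmod (w 0 i) <= r by rewrite (le_trans _ (wr i))// lerDl ltW.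
have ie0 : 0 < eta^-1 by rewrite invr_gt0.
have ie2 : 0 <= eta^-2 by rewrite invr_ge0 exprn_ge0// ltW.
have X1 : X <= X * (1 + eta^-1 + eta^-2).
  by rewrite ler_peMr// -addrA lerDl addr_ge0// (ltW ie0).
have X2 : X * eta^-1 <= X * (1 + eta^-1 + eta^-2).
  by rewrite ler_wpM2l// addrAC lerDr addr_ge0.
have X3 : X * eta^-2 <= X * (1 + eta^-1 + eta^-2).
  by rewrite ler_wpM2l// lerDr addr_ge0// ltW.
split.
  apply: le_trans X1; rewrite cmod_prod; apply: ler_prod => i _.
  by rewrite cmod_ge0 cmodX lerXn2r ?nnegrE ?cmod_ge0 ?r0.
move=> j h s hh ss; have [d dP] := pow_taylor (w 0 j) (m j) e0.
have [h1 h2] := dP h hh; have [_ s2] := dP s ss.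
set Y := \prod_(i | i != j) w 0 i ^+ m i.
have dE h' : delta (monom m) j h' w = ((w 0 j + h') ^+ m j - w 0 j ^+ m j) * Y.
  have mE : monom m w = w 0 j ^+ m j * Y by rewrite /monom (bigD1 j).
  by rewrite /delta monom_shift mE -mulrBl.
have YX : (cmod (w 0 j) + eta) ^+ m j * cmod Y <= X.
  rewrite /X (bigD1 j)//= ler_pM ?exprn_ge0 ?addr_ge0 ?cmod_ge0 ?(ltW e0)//.
    by rewrite lerXn2r ?nnegrE ?addr_ge0 ?cmod_ge0 ?(ltW e0) ?r0.
  rewrite cmod_prod; apply: ler_prod => i _.
  by rewrite cmod_ge0 cmodX lerXn2r ?nnegrE ?cmod_ge0 ?r0.
rewrite !dE; split.
  rewrite cmodM; apply: (@le_trans _ _ (cmod h * (X * eta^-1))); last first.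
    by rewrite mulrC ler_wpM2r ?cmod_ge0.
  apply: (@le_trans _ _ (cmod h / eta * (cmod (w 0 j) + eta) ^+ m j * cmod Y)).
    by rewrite ler_wpM2r ?cmod_ge0.
  rewrite -mulrA [X / eta]mulrC [leRHS]mulrA.
  by rewrite ler_wpM2l// divr_ge0 ?cmod_ge0 ?(ltW e0).
have -> : s * (((w 0 j + h) ^+ m j - w 0 j ^+ m j) * Y) -
          h * (((w 0 j + s) ^+ m j - w 0 j ^+ m j) * Y) =
  s * (((w 0 j + h) ^+ m j - w 0 j ^+ m j - d * h) * Y) -
  h * (((w 0 j + s) ^+ m j - w 0 j ^+ m j - d * s) * Y) by ring.
apply: (@le_trans _ _ (X * eta^-2 * (cmod h * cmod s * (cmod h + cmod s)))); last first.
  by rewrite ler_wpM2r// !mulr_ge0 ?addr_ge0 ?cmod_ge0.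
apply: le_trans (cmodB _ _) _; rewrite !cmodM.
have half h' s' : cmod ((w 0 j + h') ^+ m j - w 0 j ^+ m j - d * h') <=
      (cmod h' / eta) ^+ 2 * (cmod (w 0 j) + eta) ^+ m j ->
    cmod s' * (cmod ((w 0 j + h') ^+ m j - w 0 j ^+ m j - d * h') * cmod Y) <=
    cmod s' * (cmod h' / eta) ^+ 2 * X.
  move=> le; rewrite -mulrA ler_wpM2l ?cmod_ge0//.
  apply: (@le_trans _ _ ((cmod h' / eta) ^+ 2 * (cmod (w 0 j) + eta) ^+ m j * cmod Y)).
    by rewrite ler_wpM2r ?cmod_ge0.
  by rewrite -mulrA ler_wpM2l// exprn_ge0// divr_ge0 ?cmod_ge0 ?(ltW e0).
apply: le_trans (lerD (half _ _ h2) (half _ _ s2)) _.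
have en0 : eta != 0 by rewrite gt_eqF.
by rewrite le_eqVlt; apply/orP; left; apply/eqP; field.
Qed.

(** The estimates of the monomials are summed. The power series converges on
    the polydisc of radius r, hence absolutely at the point with coordinates r
    / 2, and the points w + h with w and h of size at most r / 4 stay within
    that radius. *)
Lemma analytic_reg_at g z0 : analytic_at g z0 -> exists C eta,
  [/\ 0 <= C, 0 < eta & forall z, (forall i, cmod (z 0 i - z0 0 i) <= eta) ->
    reg_at C eta g z].
Proof.
move=> [a [r [r0 ga]]]; pose eta := r / 4.
have e0 : 0 < eta by rewrite divr_gt0.
have gsum w : (forall i, cmod (w 0 i) < r) ->
    has_sum (fun m => a m * monom m w) (g (z0 + w)).
  by move=> wr; apply: ga => i; rewrite cmodE ltcR.
have [|B aB] := has_sum_abs (gsum (const_mx (r / 2)%:C) _).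
  by move=> i; rewrite mxE cmod_real gtr0_norm ?divr_gt0// ltr_pdivrMr//; lra.
pose K := 1 + eta^-1 + eta^-2.
have K0 : 0 <= K.
  by rewrite !addr_ge0 ?invr_ge0 ?exprn_ge0 ?(ltW e0).
have B0 : 0 <= B by have := aB fset0; rewrite big_seq_fset0.
exists (B * K), eta; split; rewrite ?mulr_ge0// => z zz0.
pose w := z - z0.
have zE : z = z0 + w by rewrite /w addrC subrK.
have we i : cmod (w 0 i) <= eta by rewrite !mxE.
have wr (m : {ffun 'I_n -> nat}) : reg_at (\prod_i (r / 2) ^+ m i * K) eta (monom m) w.
  apply: monom_reg => // i; rewrite (le_trans (lerD (we i) (lexx _)))//.
  by rewrite /eta; lra.
have sumB (F : {ffun 'I_n -> nat} -> R[i]) (c : R) : 0 <= c ->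
    (forall m, cmod (F m) <= \prod_i (r / 2) ^+ m i * K * c) ->
    abs_sum_le (fun m => a m * F m) (B * K * c).
  move=> c0 Fc A; apply: (@le_trans _ _ (\sum_(m <- A)
      cmod (a m * monom m (const_mx (r / 2)%:C)) * (K * c))).
    apply: ler_sum => m _; rewrite !cmodM -mulrA ler_wpM2l ?cmod_ge0//.
    rewrite (le_trans (Fc m))// -mulrA ler_wpM2r ?mulr_ge0//.
    rewrite cmod_prod; apply: ler_prod => i _; rewrite cmodX mxE cmod_real.
    by rewrite exprn_ge0 ?divr_ge0 ?(ltW r0)//= gtr0_norm ?divr_gt0.
  by rewrite -mulr_suml -[leRHS]mulrA ler_wpM2r ?mulr_ge0.
have gw : has_sum (fun m => a m * monom m w) (g z).
  by rewrite zE; apply: gsum => i; rewrite (le_lt_trans (we i))// /eta; lra.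
have gd j h : cmod h <= eta ->
    has_sum (fun m => a m * delta (monom m) j h w) (delta g j h z).
  move=> hh; have gwh : has_sum (fun m => a m * monom m (w + h *: delta_mx 0 j))
      (g (z + h *: delta_mx 0 j)).
    have -> : z + h *: delta_mx 0 j = z0 + (w + h *: delta_mx 0 j).
      by rewrite addrA -zE.
    apply: gsum => i; rewrite !mxE.
    apply: le_lt_trans (cmodD _ _) _.
    apply: (@le_lt_trans _ _ (eta + eta)); last by rewrite /eta; lra.
    apply: lerD; first by have := we i; rewrite !mxE.
    rewrite cmodM (le_trans _ hh)// ler_piMr ?cmod_ge0//.
    by rewrite eqxx cmod_nat lern1 leq_b1.
  have := has_sumD gwh (has_sumZ (c := -1) gw); rewrite mulN1r.
  by apply: eq_has_sum => m; rewrite /delta; ring.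
split.
  apply: (has_sum_abs_bound gw); have := sumB (monom^~ w) 1 ler01.
  by rewrite mulr1; apply => m; have [] := wr m; rewrite mulr1.
move=> j h s hh ss; split.
  apply: (has_sum_abs_bound (gd j h hh)); apply: sumB => [|m].
    exact: cmod_ge0.
  by have [_ /(_ j h s hh ss)[]] := wr m.
have gq : has_sum (fun m => a m * (s * delta (monom m) j h w - h * delta (monom m) j s w))
    (s * delta g j h z - h * delta g j s z).
  have := has_sumD (has_sumZ (c := s) (gd j h hh)) (has_sumZ (c := - h) (gd j s ss)).
  by rewrite mulNr; apply: eq_has_sum => m; ring.
apply: (has_sum_abs_bound gq); apply: sumB => [|m].
  by rewrite !mulr_ge0 ?addr_ge0 ?cmod_ge0.
by have [_ /(_ j h s hh ss)[]] := wr m.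
Qed.

(** The constants of the local estimates are uniform on a closed strip, by
    compactness of a period rectangle and by periodicity. *)
Lemma analytic_regular (rho sigma : R) g : sigma < rho ->
  analytic_on_torus rho g -> regular sigma g.
Proof.
move=> sr [gper gan].
pose K : set ('rV[R]_n * 'rV[R]_n) :=
  [set x : 'rV[R]_n | forall i, `[0, 1]%classic (x ord0 i)] `*`
  [set y : 'rV[R]_n | forall i, `[- sigma, sigma]%classic (y ord0 i)].
have cK : compact K.
  apply: compact_setX.
    exact: (@rV_compact R n (fun=> `[0, 1]%classic) (fun=> @segment_compact R 0 1)).
  exact: (@rV_compact R n (fun=> `[- sigma, sigma]%classic)
    (fun=> @segment_compact R (- sigma) sigma)).
pose zv (v : 'rV[R]_n * 'rV[R]_n) : 'rV[R[i]]_n := \row_i (v.1 0 i +i* v.2 0 i).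
pose P (N : nat) v := reg_at N%:R (N.+1%:R^-1) g (zv v).
have [|N _ NP] := (compact_near_coveringP K).1 cK nat \oo P _.
  move=> v0 v0K.
  have [|C [eta [C0 e0 CP]]] := @analytic_reg_at g (zv v0).
    apply: gan => i; rewrite mxE/=; have [_ /(_ i)] := v0K.
    rewrite /= in_itv/= => /andP[? ?]; rewrite (le_lt_trans _ sr)//.
    by rewrite ler_norml; apply/andP.
  have e20 : 0 < eta / 2 by rewrite divr_gt0.
  exists (ball v0 (eta / 2), [set N | C <= N%:R /\ N.+1%:R^-1 <= eta]).
    split; first exact: nbhsx_ballx.
    near=> N; split; first by near: N; exact: nbhs_infty_ger.
    by apply: ltW; near: N; exact: near_infty_natSinv_lt (PosNum e0).
  move=> [v N] [/= vb [CN eN]]; apply: (reg_at_le CN eN).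
  apply: CP => i; rewrite !mxE.
  have [[_ /(_ ord0 i) b1] [_ /(_ ord0 i) b2]] := vb.
  rewrite (le_trans (cmod_le_ReIm _))// [leRHS]splitr.
  by rewrite lerD//= distrC ltW.
have NK := NP N (leqnn N).
exists N%:R, (Num.min (N.+1%:R^-1) (rho - sigma)); split => //.
  by rewrite lt_min subr_gt0 sr invr_gt0 ltr0n.
move=> z sz; pose m : 'rV[int]_n := \row_i (- Num.floor (complex.Re (z 0 i))).
pose v : 'rV[R]_n * 'rV[R]_n :=
  (\row_i (complex.Re (z 0 i) - (Num.floor (complex.Re (z 0 i)))%:~R),
   \row_i complex.Im (z 0 i)).
have vE : zv v = z + map_mx intr m.
  apply/rowP => i; rewrite !mxE /= -(rmorph_int (real_complex R)).
  by case: (z 0 i) => x y; simpc; rewrite /= rmorphN/=.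
have : reg_at N%:R N.+1%:R^-1 g (zv v).
  apply: NK; split=> i /=; rewrite mxE in_itv/=.
    have := floor_itv (complex.Re (z 0 i)); rewrite intrD => /andP[? ?].
    by apply/andP; split; lra.
  by have := sz i; rewrite ltr_norml => /andP[? ?]; apply/andP; split; exact: ltW.
have szr : strip rho z by apply: strip_le sz; exact: ltW.
have shift j h : cmod h <= Num.min (N.+1%:R^-1) (rho - sigma) ->
    strip rho (z + h *: delta_mx 0 j).
  rewrite le_min => /andP[_ hr] i; rewrite !mxE cImD.
  rewrite (le_lt_trans (ler_normD _ _))//.
  have : `|complex.Im (h * ((0 == 0 :> 'I_1) && (i == j))%:R)| <= rho - sigma.
    rewrite (le_trans (Im_le_cmod _))// cmodM cmod_nat (le_trans _ hr)//.
    by rewrite ler_piMr ?cmod_ge0// lern1 leq_b1.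
  by have := sz i; lra.
have dE j h : cmod h <= Num.min (N.+1%:R^-1) (rho - sigma) ->
    delta g j h (zv v) = delta g j h z.
  by move=> hh; rewrite vE /delta gper// addrAC gper//; exact: shift.
move=> [le1 le2]; split; first by move: le1; rewrite vE gper.
move=> j h s hh ss; rewrite -!dE//; apply: le2.
  by move: hh; rewrite le_min => /andP[].
by move: ss; rewrite le_min => /andP[].
Unshelve. all: by end_near.
Qed.

End Regularity.

(** * Means over finite grids of the torus *)

Section ComplexLimits.
Context {R : realType} {T : Type} (F : set_system T) {FF : Filter F}.
Implicit Types (f g : T -> R[i]) (l : R[i]).

Lemma ccvgD f g l l' : f @ F --> (l : R[i]^o) -> g @ F --> (l' : R[i]^o) ->
  f t + g t @[t --> F] --> (l + l' : R[i]^o).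
Proof. exact: (@cvgD _ R[i]^o). Qed.

Lemma eq_ccvg f g l : f =1 g -> f @ F --> (l : R[i]^o) -> g @ F --> (l : R[i]^o).
Proof. by move=> /funext ->. Qed.

Lemma ccvgM f g l l' : f @ F --> (l : R[i]^o) -> g @ F --> (l' : R[i]^o) ->
  f t * g t @[t --> F] --> (l * l' : R[i]^o).
Proof. exact: (@cvgM R[i]). Qed.

Lemma ccvg_cst l : l @[_ --> F] --> (l : R[i]^o).
Proof. exact: (@cvg_cst R[i]^o). Qed.

Lemma ccvg_sum (I : Type) (r : seq I) (f : I -> T -> R[i]) (l : I -> R[i]) :
  (forall i, f i @ F --> (l i : R[i]^o)) ->
  \sum_(i <- r) f i t @[t --> F] --> (\sum_(i <- r) l i : R[i]^o).
Proof.
move=> fl; elim: r => [|i r IH].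
  by rewrite big_nil; under eq_cvg do rewrite big_nil; exact: ccvg_cst.
rewrite big_cons; under eq_cvg do rewrite big_cons.
exact: ccvgD (fl i) IH.
Qed.

End ComplexLimits.

Section GridMeans.
Context {R : realType} {n : nat}.
Implicit Types (z w : 'rV[R[i]]_n) (g : 'rV[R[i]]_n -> R[i]) (N : nat)
  (f : 'rV[R]_n -> R[i]).

Definition gpt N (x : {ffun 'I_n -> 'I_N.+1}) : 'rV[R]_n :=
  \row_i ((x i)%:R / N.+1%:R).

Definition gmean N f : R[i] :=
  (#|{ffun 'I_n -> 'I_N.+1}|)%:R^-1 * \sum_(x : {ffun 'I_n -> 'I_N.+1}) f (gpt x).

Lemma card_grid_gt0 N : (0 < #|{ffun 'I_n -> 'I_N.+1}|)%N.
Proof. by rewrite card_ffun card_ord expn_gt0. Qed.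

Lemma card_grid_neq0 N : (#|{ffun 'I_n -> 'I_N.+1}|)%:R != 0 :> R[i].
Proof. by rewrite pnatr_eq0 -lt0n card_grid_gt0. Qed.

Lemma eq_gmean N f f' : (forall x, f x = f' x) -> gmean N f = gmean N f'.
Proof. by move=> ff; rewrite /gmean (eq_bigr _ (fun x _ => ff _)). Qed.

Lemma gmeanD N f f' : gmean N (fun x => f x + f' x) = gmean N f + gmean N f'.
Proof. by rewrite /gmean big_split mulrDr. Qed.

Lemma gmeanZ N c f : gmean N (fun x => c * f x) = c * gmean N f.
Proof. by rewrite /gmean -mulr_sumr mulrCA. Qed.

Lemma gmeanB N f f' : gmean N (fun x => f x - f' x) = gmean N f - gmean N f'.
Proof.
rewrite -mulN1r -gmeanZ -gmeanD; apply: eq_gmean => x.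
by rewrite mulN1r.
Qed.

Lemma gmean_sum (I : Type) (r : seq I) N (F : I -> 'rV[R]_n -> R[i]) :
  gmean N (fun x => \sum_(i <- r) F i x) = \sum_(i <- r) gmean N (F i).
Proof. by rewrite /gmean exchange_big mulr_sumr. Qed.

Lemma gmean_cst N c : gmean N (fun=> c) = c.
Proof.
by rewrite /gmean sumr_const -[c *+ _]mulr_natl mulrA mulVf ?mul1r ?card_grid_neq0.
Qed.

Lemma gmean_le N f (b : 'rV[R]_n -> R) (M : R) :
  (forall x, cmod (f x) <= b x) ->
  (#|{ffun 'I_n -> 'I_N.+1}|)%:R^-1 *
     \sum_(x : {ffun 'I_n -> 'I_N.+1}) b (gpt x) <= M ->
  cmod (gmean N f) <= M.
Proof.
move=> fb; apply: le_trans; rewrite cmodM cmodV cmod_nat ler_wpM2l//.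
by rewrite (le_trans (cmod_sum _ _ _))// ler_sum.
Qed.

Lemma gmean_bound N f (M : R) : (forall x, cmod (f x) <= M) ->
  cmod (gmean N f) <= M.
Proof.
move=> fM; apply: (gmean_le fM); rewrite sumr_const -[M *+ _]mulr_natl mulrA mulVf ?mul1r//.
by rewrite pnatr_eq0 -lt0n card_grid_gt0.
Qed.

(** The grid is a subgroup of the torus, which translation by one step
    permutes. *)
Lemma gmean_shift N j f : (forall x, f (x + delta_mx 0 j) = f x) ->
  gmean N (fun x => f (x + N.+1%:R^-1 *: delta_mx 0 j)) = gmean N f.
Proof.
move=> fper; rewrite /gmean; congr (_ * _).
pose s (x : {ffun 'I_n -> 'I_N.+1}) : {ffun 'I_n -> 'I_N.+1} :=
  [ffun i => if i == j then ordS (x i) else x i].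
have s_inj : injective s.
  move=> x y /ffunP xy; apply/ffunP => i; have := xy i; rewrite !ffunE.
  by case: ifP => // _ /(bij_inj (ordS_bij _)).
rewrite [RHS](reindex_inj s_inj)/=; apply: eq_bigr => x _.
have [xN|xN] := eqVneq (x j : nat) N; last first.
  congr f; apply/rowP => i; rewrite !mxE ffunE eqxx/=; case: eqVneq => [->|_].
    have xlt : (x j < N)%N by rewrite ltn_neqAle xN -ltnS /=.
    by rewrite /= modn_small ?ltnS// mulr1 -[in RHS]natr1 [RHS]mulrDl mul1r.
  by rewrite mulr0 addr0.
rewrite -(fper (gpt (s x))); congr f; apply/rowP => i.
rewrite !mxE ffunE eqxx/=; case: eqVneq => [->|_]; last by rewrite mulr0.
by rewrite /= xN modnn mul0r add0r mulr1 -[X in _ + X = _]mul1r -mulrDl natr1 divff// pnatr_eq0.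
Qed.

Definition amean N g z : R[i] := gmean N (fun x => g (z + real_vec x)).

(** The increment of g over one step s of the grid has mean 0. Subtracting the
    multiple h / s of it from the increment h leaves only the second order
    term of reg_at. *)
Lemma amean_step (sigma C eta : R) g z j h N :
  periodic_on_strip sigma g -> 0 < eta ->
  (forall z, strip sigma z -> reg_at C eta g z) ->
  strip sigma z -> cmod h <= eta -> N.+1%:R^-1 <= eta ->
  cmod (amean N g (z + h *: delta_mx 0 j) - amean N g z) <=
    C * cmod h * (cmod h + N.+1%:R^-1).
Proof.
move=> gper e0 gC sz hh Ne; pose s : R[i] := (N.+1%:R^-1 : R)%:C.
have N0 : 0 < N.+1%:R^-1 :> R by rewrite invr_gt0 ltr0n.
have sE : cmod s = N.+1%:R^-1 by rewrite cmod_real gtr0_norm.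
have s0 : 0 < cmod s by rewrite sE.
have shift : gmean N (fun x => delta g j s (z + real_vec x)) = 0.
  rewrite /delta gmeanB; apply/eqP; rewrite subr_eq0; apply/eqP.
  rewrite -[RHS](@gmean_shift N j); last first.
    move=> x; rewrite -[RHS](gper _ (strip_add_real x sz) (delta_mx 0 j)).
    congr g; rewrite -addrA; congr (_ + _); apply/rowP => i; rewrite !mxE.
    by rewrite rmorphD; congr (_ + _); case: (_ && _).
  apply: eq_gmean => x; congr g; rewrite -addrA; congr (_ + _).
  by apply/rowP => i; rewrite !mxE rmorphD rmorphM/= rmorph_nat.
have dE : amean N g (z + h *: delta_mx 0 j) - amean N g z =
    gmean N (fun x => delta g j h (z + real_vec x)).
  rewrite /amean -gmeanB; apply: eq_gmean => x.
  by rewrite /delta addrAC.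
rewrite dE -(ler_pM2l s0) -cmodM -gmeanZ.
have -> : gmean N (fun x => s * delta g j h (z + real_vec x)) =
    gmean N (fun x => s * delta g j h (z + real_vec x) -
                      h * delta g j s (z + real_vec x)).
  by rewrite gmeanB gmeanZ [in X in _ - X]gmeanZ shift mulr0 subr0.
apply: gmean_bound => x.
have [_ /(_ j h s hh)[|_]] := gC _ (strip_add_real x sz); first by rewrite sE.
by move=> /le_trans; apply; rewrite sE le_eqVlt; apply/orP; left; apply/eqP; ring.
Qed.

Lemma strip_segment (sigma : R) z h j (t : R) : 0 <= t <= 1 ->
  strip sigma z -> strip sigma (z + h *: delta_mx 0 j) ->
  strip sigma (z + (t%:C * h) *: delta_mx 0 j).
Proof.
move=> /andP[t0 t1] sz szh i; have := sz i; have := szh i; rewrite !mxE eqxx/=.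
case: eqVneq => [_|_]; last by rewrite !mulr0 addr0.
rewrite !mulr1 !cImD cImM/= mul0r addr0.
set a := complex.Im _; set b := complex.Im _.
rewrite !ltr_norml => /andP[? ?] /andP[? ?].
have -> : a + t * b = (1 - t) * a + t * (a + b) by ring.
apply/andP; split.
  have [->|t_neq0] := eqVneq t 0; first by lra.
  have t_gt0 : 0 < t by rewrite lt0r t_neq0.
  have : t * - sigma < t * (a + b) by rewrite ltr_pM2l.
  have : (1 - t) * - sigma <= (1 - t) * a by rewrite ler_wpM2l ?subr_ge0// ltW.
  lra.
have [->|t_neq0] := eqVneq t 0; first by lra.
have t_gt0 : 0 < t by rewrite lt0r t_neq0.
have : t * (a + b) < t * sigma by rewrite ltr_pM2l.
have : (1 - t) * a <= (1 - t) * sigma by rewrite ler_wpM2l ?subr_ge0// ltW.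
lra.
Qed.

(** Cutting the segment into N + 1 pieces of length |h| / (N + 1), each of
    which changes the grid mean by a multiple of 1 / (N + 1)^2, gives a total
    change of order 1 / (N + 1). This takes the place of the Cauchy theorem:
    means along parallel real tori agree in the limit. *)
Lemma amean_line (sigma : R) g z j h : periodic_on_strip sigma g ->
  regular sigma g -> strip sigma z -> strip sigma (z + h *: delta_mx 0 j) ->
  amean N g (z + h *: delta_mx 0 j) - amean N g z @[N --> \oo] --> (0 : R[i]^o).
Proof.
move=> gper [C [eta [C0 e0 gC]]] sz szh; apply/ccvgP => e ep.
pose B := C * cmod h * (cmod h + 1).
have B0 : 0 <= B by rewrite !mulr_ge0 ?addr_ge0 ?cmod_ge0.
have p0 : 0 < e / (B + 1) by rewrite divr_gt0// ltr_wpDl.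
have p1 : 0 < eta / (cmod h + 1) by rewrite divr_gt0// ltr_wpDl ?cmod_ge0.
near=> N; rewrite subr0.
have N0 : 0 < N.+1%:R^-1 :> R by rewrite invr_gt0 ltr0n.
have N1 : N.+1%:R^-1 <= eta.
  by apply: ltW; near: N; exact: near_infty_natSinv_lt (PosNum e0).
have N2 : N.+1%:R^-1 <= e / (B + 1).
  by apply: ltW; near: N; exact: near_infty_natSinv_lt (PosNum p0).
have N3 : N.+1%:R^-1 <= eta / (cmod h + 1).
  by apply: ltW; near: N; exact: near_infty_natSinv_lt (PosNum p1).
pose d : R[i] := (N.+1%:R^-1 : R)%:C * h.
have dE : cmod d = N.+1%:R^-1 * cmod h by rewrite cmodM cmod_real gtr0_norm.
have de : cmod d <= eta.
  rewrite dE (le_trans (ler_wpM2r (cmod_ge0 _) N3))//.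
  rewrite -mulrA ler_piMr ?(ltW e0)// ler_pdivrMl ?ltr_wpDl ?cmod_ge0//.
  by rewrite mulr1 lerDl.
have path (l : nat) : (l <= N.+1)%N -> cmod (amean N g (z + (l%:R * d) *: delta_mx 0 j) - amean N g z)
    <= l%:R * (C * cmod d * (cmod d + N.+1%:R^-1)).
  elim: l => [_|l IH lN]; first by rewrite mul0r scale0r addr0 subrr cmod0 mul0r.
  apply: le_trans (cmod_dist_tri (amean N g (z + (l%:R * d) *: delta_mx 0 j)) _ _) _.
  have -> (x : R) : l.+1%:R * x = x + l%:R * x by rewrite -natr1 mulrDl mul1r addrC.
  apply: lerD; last by apply: IH; exact: ltnW.
  have -> : l.+1%:R * d = l%:R * d + d by rewrite -natr1 mulrDl mul1r.
  rewrite scalerDl addrA.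
  apply: (amean_step _ gper e0 gC) => //.
  rewrite /d mulrA -(rmorph_nat (real_complex R)) -rmorphM/=.
  apply: strip_segment => //; rewrite mulr_ge0 ?(ltW N0)//=.
  by rewrite ler_pdivrMr ?ltr0n// mul1r ler_nat ltnW.
have := path N.+1 (leqnn _).
have -> : N.+1%:R * d = h.
  by rewrite /d mulrA -(rmorph_nat (real_complex R)) -rmorphM/= divff ?mul1r.
move=> /le_trans; apply; rewrite dE.
apply: (@le_trans _ _ (B * N.+1%:R^-1)).
  have -> : N.+1%:R * (C * (N.+1%:R^-1 * cmod h) * (N.+1%:R^-1 * cmod h + N.+1%:R^-1))
     = B * N.+1%:R^-1.
    have : N.+1%:R != 0 :> R by rewrite pnatr_eq0.
    by rewrite /B; move: (N.+1%:R : R) => q q0; field.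
  by [].
rewrite (le_trans (ler_wpM2l B0 N2))// mulrCA ler_piMr ?(ltW ep)//.
by rewrite ler_pdivrMr ?ltr_wpDl// mul1r lerDl.
Unshelve. all: by end_near.
Qed.

Lemma amean_cvg0 (sigma : R) g z z' : periodic_on_strip sigma g ->
  regular sigma g -> strip sigma z -> strip sigma z' ->
  amean N g z' - amean N g z @[N --> \oo] --> (0 : R[i]^o).
Proof.
move=> gper gr sz sz'.
pose y m : 'rV[R[i]]_n := \row_i (if (i < m)%N then z' 0 i else z 0 i).
have sy m : strip sigma (y m) by move=> i; rewrite mxE; case: ifP.
have yn : y n = z' by apply/rowP => i; rewrite mxE ltn_ord.
have y0 : y 0 = z by apply/rowP => i; rewrite mxE.
suff path m : (m <= n)%N ->
    amean N g (y m) - amean N g z @[N --> \oo] --> (0 : R[i]^o).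
  by have := path n (leqnn n); rewrite yn.
elim: m => [_|m IH mn].
  by under eq_cvg do rewrite y0 subrr; exact: (@cvg_cst R[i]^o).
pose j := Ordinal mn.
have yE : y m.+1 = y m + (z' 0 j - z 0 j) *: delta_mx 0 j.
  apply/rowP => i; rewrite !mxE eqxx/= ltnS.
  have [ij|ij|ij] := ltngtP i m.
  - by rewrite -val_eqE /= (ltn_eqF ij) mulr0 addr0.
  - by rewrite -val_eqE /= (gtn_eqF ij) mulr0 addr0.
  - have -> : i = j by exact: val_inj.
    by rewrite eqxx mulr1 addrC subrK.
have line : amean N g (y m.+1) - amean N g (y m) @[N --> \oo] --> (0 : R[i]^o).
  by rewrite yE; apply: (amean_line gper gr (sy m)); rewrite -yE.
rewrite -[0]addr0; apply: eq_ccvg (ccvgD line (IH (ltnW mn))) => N.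
by rewrite subrKA.
Qed.

(** A generalized limit of bounded sequences: the limit along an ultrafilter
    refining the Frechet filter exists without any further estimate. *)
Definition nat_ultra : set_system nat :=
  projT1 (cid (@ultraFilterLemma nat \oo _)).

Lemma nat_ultra_ultra : UltraFilter nat_ultra.
Proof. by rewrite /nat_ultra; case: cid => G []. Qed.

#[global] Instance nat_ultra_proper : ProperFilter nat_ultra.
Proof. exact: (@ultra_proper _ _ nat_ultra_ultra). Qed.

Lemma nat_ultra_oo : \oo `<=` nat_ultra.
Proof. by rewrite /nat_ultra; case: cid => G []. Qed.

(** The limit is the supremum of the lower bounds which hold on a set of the
    ultrafilter. *)
Lemma ultra_cvg_real (f : nat -> R) M : (forall N, `|f N| <= M) ->
  exists l : R, f @ nat_ultra --> l.
Proof.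
move=> fM; pose E : set R := [set t | nat_ultra [set N | t <= f N]].
have ubE : ubound E M.
  move=> t Et; rewrite leNgt; apply/negP => Mt.
  have [N /= tN] := filter_ex Et.
  by have := le_lt_trans (le_trans tN (ler_norm _)) (le_lt_trans (fM N) Mt); rewrite ltxx.
have supE : has_sup E.
  split; last by exists M.
  exists (- M); rewrite /E/=; apply: nearW => N /=.
  by have := fM N; rewrite ler_norml => /andP[].
exists (sup E); apply/cvgrPdist_le => e e0.
have [t Et lt_t] := sup_adherent e0 supE.
have nE : ~ E (sup E + e).
  by move=> /(ub_le_sup supE.2); rewrite gerDl leNgt e0.
have [//|U2] := in_ultra_setVsetC [set N | sup E + e <= f N] nat_ultra_ultra.
apply: filterS2 Et U2 => N /= tN /negP; rewrite -ltNge => Ne.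
by rewrite ler_norml; apply/andP; split; lra.
Qed.

Lemma ultra_cvg (f : nat -> R[i]) M : (forall N, cmod (f N) <= M) ->
  exists l : R[i], f @ nat_ultra --> (l : R[i]^o).
Proof.
move=> fM.
have [|a fa] := @ultra_cvg_real (fun N => complex.Re (f N)) M.
  by move=> N; apply: le_trans (fM N); exact: Re_le_cmod.
have [|b fb] := @ultra_cvg_real (fun N => complex.Im (f N)) M.
  by move=> N; apply: le_trans (fM N); exact: Im_le_cmod.
by exists (a +i* b); exact: ccvg_ReIm.
Qed.

(** The generalized limit of the grid means plays the role of the integral of
    g over the torus. *)
Definition mean g : R[i] := lim (amean N g 0 @[N --> nat_ultra] : set_system R[i]^o).

Lemma mean_cvg (sigma : R) g z : 0 < sigma -> periodic_on_strip sigma g ->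
  regular sigma g -> strip sigma z ->
  amean N g z @[N --> nat_ultra] --> (mean g : R[i]^o).
Proof.
move=> s0 gper gr sz; have [C [eta [C0 _ gC]]] := gr.
have [|l gl] := @ultra_cvg (fun N => amean N g 0) C.
  move=> N; apply: gmean_bound => x.
  by have [] := gC _ (strip_add_real x (strip0 s0)).
have -> : mean g = l.
  have cg : cvg (amean N g 0 @[N --> nat_ultra] : set_system R[i]^o).
    by apply/cvg_ex; exists l.
  exact: ccvg_unique (cg) gl.
have d0 : amean N g z - amean N g 0 @[N --> nat_ultra] --> (0 : R[i]^o).
  apply: cvg_trans (amean_cvg0 gper gr (strip0 s0) sz).
  by move=> A /=; exact: nat_ultra_oo.
by rewrite -[l]add0r; apply: eq_ccvg (ccvgD d0 gl) => N; rewrite subrK.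
Qed.

End GridMeans.

(** * Orthogonality, the Bessel inequality and the Fejer kernel *)

Section Orthogonality.
Context {R : realType} {n : nat}.
Implicit Types (z w : 'rV[R[i]]_n) (g : 'rV[R[i]]_n -> R[i]) (N P : nat)
  (f : 'rV[R]_n -> R[i]) (k l : 'rV[int]_n).

Lemma e1_neq1 (t : R) : 0 < `|t| < 1 -> e1 t%:C != 1.
Proof.
move=> /andP[t0 t1]; rewrite eq_sym -subr_eq0 -cmod_gt0 cmod_1Be1_sin.
rewrite mulr_gt0// normr_gt0.
have -> : (sin (pi * t) == 0) = (sin (pi * `|t|) == 0).
  by have [//|_] := ger0P t; rewrite mulrN sinN oppr_eq0.
rewrite gt_eqF// sin_gt0_pi// mulr_gt0 ?pi_gt0//=.
by rewrite gtr_pMr ?pi_gt0.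
Qed.

Lemma e1X (z : R[i]) m : e1 (m%:R * z) = e1 z ^+ m.
Proof.
elim: m => [|m IH]; first by rewrite mul0r e1_0 expr0.
by rewrite -natr1 mulrDl mul1r e1D IH exprSr.
Qed.

Lemma conjcM (z w : R[i]) : (z * w)^*%C = z^*%C * w^*%C.
Proof. exact: rmorphM. Qed.

Lemma conjcB (z w : R[i]) : (z - w)^*%C = z^*%C - w^*%C.
Proof. exact: rmorphB. Qed.

Lemma conjc_sum (I : Type) (r : seq I) (F : I -> R[i]) :
  (\sum_(i <- r) F i)^*%C = \sum_(i <- r) (F i)^*%C.
Proof. exact: rmorph_sum. Qed.

Lemma echar_real_conj k (x : 'rV[R]_n) :
  (echar k (real_vec x))^*%C = echar (- k) (real_vec x).
Proof.
have h := cmod_echar_real k x.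
have c0 : echar k (real_vec x) != 0 by rewrite -cmod_gt0 h ltr01.
apply: (mulfI c0); rewrite -cmod_sqrJ h expr1n.
by rewrite echarN.
Qed.

(** Translation by one step of the grid multiplies the character by a number
    different from 1. *)
Lemma gmean_echar N k j : k 0 j != 0 -> (absz (k 0%R j) <= N)%N ->
  gmean N (fun x => echar k (real_vec x) : R[i]) = 0.
Proof.
move=> k0 kN; pose h : 'rV[R]_n := N.+1%:R^-1 *: delta_mx 0 j.
have dot_h : dotZ k h = (k 0 j)%:~R / N.+1%:R.
  rewrite /dotZ (bigD1 j)//= big1 => [|i ij]; last first.
    by rewrite !mxE (negbTE ij) andbF !mulr0.
  by rewrite !mxE !eqxx mulr1 addr0.
have eh : echar k (real_vec h) != 1.
  rewrite echar_real_dot; apply: e1_neq1; rewrite dot_h normrM normfV normr_nat.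
  rewrite divr_gt0 ?normr_gt0 ?intr_eq0// ltr_pdivrMr// mul1r.
  by rewrite -intr_norm -abszE -[N.+1%:R]/(N.+1%:~R) ltr_int ltz_nat ltnS.
have per x : echar k (real_vec (x + delta_mx 0 j)) = echar k (real_vec x) :> R[i].
  rewrite -[RHS](echar_periodic _ _ (delta_mx 0 j)); congr echar.
  by apply/rowP => i; rewrite !mxE rmorphD; congr (_ + _); case: (_ && _).
have := gmean_shift N per.
under eq_gmean => x.
  rewrite (_ : real_vec _ = real_vec h + real_vec x); last first.
    by apply/rowP => i; rewrite !mxE rmorphD addrC.
  rewrite echarDr; over.
rewrite gmeanZ => /eqP; rewrite -subr_eq0 -[X in _ - X]mul1r -mulrBl mulf_eq0.
by rewrite subr_eq0 (negbTE eh) => /eqP.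
Qed.

(** Distinct frequencies stop being aliased once the grid is fine enough. *)
Lemma near_orthogonal k : k != 0 ->
  \forall N \near \oo, gmean N (fun x => echar k (real_vec x) : R[i]) = 0.
Proof.
move=> k0; have [j kj] : exists j, k 0 j != 0.
  apply/existsP; rewrite -negb_forall; apply: contraNN k0 => /forallP k0.
  by apply/eqP/rowP => i; rewrite mxE; apply/eqP.
by exists (absz (k 0 j)) => // N /= /(gmean_echar kj).
Qed.

Definition rmean N (r : 'rV[R]_n -> R) : R :=
  (#|{ffun 'I_n -> 'I_N.+1}|)%:R^-1 * \sum_(x : {ffun 'I_n -> 'I_N.+1}) r (gpt x).

Lemma rmean_le N r r' : (forall x, r x <= r' x) -> rmean N r <= rmean N r'.
Proof. by move=> rr; rewrite ler_wpM2l// ler_sum. Qed.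

Lemma rmeanD N r r' : rmean N (fun x => r x + r' x) = rmean N r + rmean N r'.
Proof. by rewrite /rmean big_split mulrDr. Qed.

Lemma rmeanZ N c r : rmean N (fun x => c * r x) = c * rmean N r.
Proof. by rewrite /rmean -mulr_sumr mulrCA. Qed.

Lemma rmean_sum (I : Type) (s : seq I) N (r : I -> 'rV[R]_n -> R) :
  rmean N (fun x => \sum_(i <- s) r i x) = \sum_(i <- s) rmean N (r i).
Proof. by rewrite /rmean exchange_big mulr_sumr. Qed.

Lemma rmean_cst N c : rmean N (fun=> c) = c.
Proof.
rewrite /rmean sumr_const -[c *+ _]mulr_natl mulrA mulVf ?mul1r//.
by rewrite pnatr_eq0 -lt0n card_grid_gt0.
Qed.

Lemma gmean_real N r : gmean N (fun x => (r x)%:C) = (rmean N r)%:C.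
Proof. by rewrite rmorphM/= fmorphV/= rmorph_nat rmorph_sum. Qed.

Lemma cmod_gmean N f : cmod (gmean N f) <= rmean N (fun x => cmod (f x)).
Proof. exact: (gmean_le (fun x => lexx (cmod (f x)))). Qed.

Lemma gmean_conj N f : (gmean N f)^*%C = gmean N (fun x => (f x)^*%C).
Proof. by rewrite rmorphM/= fmorphV/= rmorph_nat rmorph_sum. Qed.

(** The mean of |f - p|^2 is nonnegative, where p is the combination of the
    characters of F with the coefficients of f. *)
Lemma bessel N f (F : {fset 'rV[int]_n}) :
  (forall k l, k \in F -> l \in F -> k != l ->
    gmean N (fun x => echar (k - l) (real_vec x) : R[i]) = 0) ->
  \sum_(k <- F) cmod (gmean N (fun x => f x * echar (- k) (real_vec x))) ^+ 2 <=
  rmean N (fun x => cmod (f x) ^+ 2).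
Proof.
move=> orth; pose a k := gmean N (fun x => f x * echar (- k) (real_vec x)).
pose p x : R[i] := \sum_(k <- F) a k * echar k (real_vec x).
pose S := \sum_(k <- F) cmod (a k) ^+ 2.
have SE : S%:C = \sum_(k <- F) a k * (a k)^*%C.
  by rewrite rmorph_sum; apply: eq_bigr => k _; rewrite -cmod_sqrJ.
have fp : gmean N (fun x => f x * (p x)^*%C) = S%:C.
  rewrite SE; under eq_gmean => x.
    rewrite conjc_sum mulr_sumr; over.
  rewrite gmean_sum; apply: eq_bigr => k _; rewrite mulrC -gmeanZ.
  by apply: eq_gmean => x; rewrite conjcM echar_real_conj mulrCA.
have pf : gmean N (fun x => p x * (f x)^*%C) = S%:C.
  rewrite -[RHS]conjc_real -fp gmean_conj; apply: eq_gmean => x.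
  by rewrite conjcM conjcK mulrC.
have pp : gmean N (fun x => p x * (p x)^*%C) = S%:C.
  rewrite SE; under eq_gmean => x.
    rewrite {1}/p mulr_suml /=; over.
  rewrite gmean_sum big_seq [RHS]big_seq; apply: eq_bigr => k kF.
  under eq_gmean => x.
    rewrite conjc_sum mulr_sumr; over.
  rewrite gmean_sum (big_fsetD1 k)//= big_seq big1 ?addr0 => [|l]; last first.
    rewrite in_fsetD1 => /andP[lk lF]; rewrite eq_sym in lk.
    rewrite -[RHS](mulr0 (a k * (a l)^*%C)) -(orth k l kF lF lk) -gmeanZ.
    apply: eq_gmean => x; rewrite conjcM echar_real_conj echarDl.
    by rewrite mulrACA.
  rewrite -[RHS](@gmean_cst R n N); apply: eq_gmean => x.
  by rewrite conjcM echar_real_conj mulrACA echarN mulr1.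
have : 0 <= rmean N (fun x => cmod (f x - p x) ^+ 2).
  by rewrite -[X in X <= _](rmean_cst N) rmean_le// => x; rewrite sqr_ge0.
suff -> : rmean N (fun x => cmod (f x - p x) ^+ 2) =
    rmean N (fun x => cmod (f x) ^+ 2) - S by rewrite subr_ge0.
apply: complexI; rewrite rmorphB/= -gmean_real.
have -> : (rmean N (fun x => cmod (f x) ^+ 2))%:C =
    gmean N (fun x => f x * (f x)^*%C) :> R[i].
  by rewrite -gmean_real; apply: eq_gmean => x; rewrite cmod_sqrJ.
transitivity (gmean N (fun x => f x * (f x)^*%C) - S%:C - (S%:C - S%:C)).
  rewrite -{1}fp -{1}pf -{1}pp -!gmeanB; apply: eq_gmean => x.
  by rewrite cmod_sqrJ conjcB; ring.
by rewrite subrr subr0.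
Qed.

Definition mean1 N (phi : R -> R) : R :=
  N.+1%:R^-1 * \sum_(m < N.+1) phi (m%:R / N.+1%:R).

Lemma rmean_prod N (phi : 'I_n -> R -> R) :
  rmean N (fun x => \prod_i phi i (x 0 i)) = \prod_i mean1 N (phi i).
Proof.
rewrite /rmean big_split/= prodr_const card_ffun !card_ord natrX exprVn.
congr (_ * _); rewrite bigA_distr_bigA; apply: eq_bigr => x _.
by apply: eq_bigr => i _; rewrite mxE.
Qed.

(** The square of the modulus of a geometric sum is small away from the
    integers, and its mean is the number of its diagonal terms. *)
Definition fejer P (t : R) : R :=
  P.+1%:R^-1 * cmod (\sum_(a < P.+1) e1 (a%:R * t%:C)) ^+ 2.

Lemma fejer_ge0 P t : 0 <= fejer P t.
Proof. by rewrite mulr_ge0// ?invr_ge0// sqr_ge0. Qed.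

Lemma fejer_expand P t : (fejer P t)%:C = P.+1%:R^-1 *
  \sum_(c : 'I_P.+1 * 'I_P.+1) e1 (((c.1)%:Z - (c.2)%:Z)%:~R * t%:C).
Proof.
rewrite /fejer rmorphM/= fmorphV/= rmorph_nat cmod_sqrJ conjc_sum; congr (_ * _).
rewrite mulr_suml -(pair_bigA _ (fun a b : 'I_P.+1 => e1 ((a%:Z - b%:Z)%:~R * t%:C)))/=.
apply: eq_bigr => a _; rewrite mulr_sumr; apply: eq_bigr => b _.
rewrite intrB mulrBl e1D; congr (_ * _).
have u0 : e1 (b%:R * t%:C) != 0 :> R[i].
  by rewrite -cmod_gt0 -(rmorph_nat (real_complex R)) -rmorphM cmod_e1_real ltr01.
apply: (mulfI u0); rewrite e1N -cmod_sqrJ.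
by rewrite -(rmorph_nat (real_complex R)) -rmorphM cmod_e1_real expr1n.
Qed.

Lemma fejer_concentrated P t : fejer P t * cmod (1 - e1 t%:C) ^+ 2 <= 4 / P.+1%:R.
Proof.
rewrite /fejer -mulrA -exprMn -cmodM mulrC ler_wpM2r ?invr_ge0//.
under eq_bigr do rewrite e1X.
have -> : (\sum_(a < P.+1) e1 t%:C ^+ a) * (1 - e1 t%:C) = 1 - e1 t%:C ^+ P.+1.
  by rewrite mulrC -opprB mulNr -subrX1 opprB.
have -> : 4 = 2 ^+ 2 :> R by rewrite -natrX.
rewrite lerXn2r ?nnegrE ?cmod_ge0//.
by rewrite (le_trans (cmodB _ _))// cmodX cmod_e1_real expr1n cmod1.
Qed.

(** A grid of more than P points per direction separates the frequencies of
    the kernel, and the diagonal terms contribute 1. *)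
Lemma mean1_fejer N P : (P <= N)%N -> mean1 N (fejer P) = 1.
Proof.
move=> PN; apply: complexI; rewrite /mean1 rmorphM/= fmorphV/= rmorph_nat rmorph_sum/=.
under eq_bigr do rewrite fejer_expand.
rewrite -mulr_sumr exchange_big/= mulrCA.
have orth (c : 'I_P.+1 * 'I_P.+1) : N.+1%:R^-1 * \sum_(m < N.+1)
    e1 (((c.1)%:Z - (c.2)%:Z)%:~R * (m%:R / N.+1%:R : R)%:C) =
    (c.1 == c.2)%:R :> R[i].
  have [->|c12] := eqVneq c.1 c.2.
    rewrite subrr; under eq_bigr do rewrite mul0r e1_0.
    by rewrite sumr_const card_ord mulVf// pnatr_eq0.
  pose d : int := (c.1)%:Z - (c.2)%:Z.
  pose xi : R[i] := e1 (d%:~R / N.+1%:R : R)%:C.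
  have xi1 : xi != 1.
    apply: e1_neq1; rewrite normrM normfV normr_nat divr_gt0 ?normr_gt0//=.
      rewrite ltr_pdivrMr// mul1r -intr_norm -[N.+1%:R]/(N.+1%:~R) ltr_int.
      rewrite -abszE ltz_nat ltnS (leq_trans _ PN)// /d.
      have := ltn_ord c.1; have := ltn_ord c.2; lia.
    rewrite intr_eq0 subr_eq0; apply: contraNneq c12 => -[c12].
    by apply/eqP/val_inj.
  have xiN : xi ^+ N.+1 = 1.
    rewrite -e1X -(rmorph_nat (real_complex R)) -rmorphM/= mulrCA divff ?pnatr_eq0//.
    by rewrite mulr1 rmorph_int e1_int.
  have -> : \sum_(m < N.+1) e1 (d%:~R * (m%:R / N.+1%:R : R)%:C) =
      \sum_(m < N.+1) xi ^+ m.
    apply: eq_bigr => m _; rewrite -e1X; congr e1.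
    by rewrite !rmorphM/= rmorph_nat rmorph_int mulrCA.
  have : (xi - 1) * \sum_(m < N.+1) xi ^+ m = 0 by rewrite -subrX1 xiN subrr.
  by move=> /eqP; rewrite mulf_eq0 subr_eq0 (negbTE xi1)/= => /eqP ->; rewrite mulr0.
rewrite mulr_sumr (eq_bigr _ (fun c _ => orth c)).
rewrite -(pair_bigA _ (fun a b : 'I_P.+1 => ((a == b)%:R : R[i])))/=.
rewrite (eq_bigr (fun=> 1)) => [|a _].
  by rewrite sumr_const card_ord mulVf// pnatr_eq0.
rewrite (bigD1 a)//= eqxx big1 ?addr0// => b ba.
by rewrite eq_sym (negbTE ba).
Qed.

Definition fejerK P (x : 'rV[R]_n) : R := \prod_i fejer P (x 0 i).

Lemma fejerK_ge0 P x : 0 <= fejerK P x.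
Proof. by apply: prodr_ge0 => i _; exact: fejer_ge0. Qed.

Lemma rmean_fejerK N P : (P <= N)%N -> rmean N (fejerK P) = 1.
Proof. move=> PN; rewrite [LHS](rmean_prod N (fun=> fejer P)) big1// => i _.
exact: mean1_fejer. Qed.

Lemma rmean_fejerK_dist N P j : (P <= N)%N ->
  rmean N (fun x => fejerK P x * cmod (1 - e1 (x 0 j)%:C) ^+ 2) <= 4 / P.+1%:R.
Proof.
move=> PN; pose phi i t := if i == j then fejer P t * cmod (1 - e1 t%:C) ^+ 2
  else fejer P t.
have -> : rmean N (fun x => fejerK P x * cmod (1 - e1 (x 0 j)%:C) ^+ 2) =
    rmean N (fun x => \prod_i phi i (x 0 i)).
  congr (_ * _); apply: eq_bigr => x _; rewrite /fejerK (bigD1 j)//=.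
  rewrite [RHS](bigD1 j)//= [phi j _]/phi eqxx mulrAC; congr (_ * _).
  by apply: eq_bigr => i ij; rewrite /phi (negbTE ij).
rewrite rmean_prod (bigD1 j)//= [X in _ * X]big1 ?mulr1 => [|i ij]; last first.
  by rewrite /phi (negbTE ij) mean1_fejer.
rewrite /phi eqxx /mean1.
apply: (@le_trans _ _ (N.+1%:R^-1 * \sum_(m < N.+1) (4 / P.+1%:R))).
  by rewrite ler_wpM2l ?invr_ge0// ler_sum// => m _; exact: fejer_concentrated.
move: (4 / P.+1%:R) => q.
by rewrite sumr_const card_ord -[q *+ _]mulr_natl mulrA mulVf ?mul1r ?pnatr_eq0.
Qed.

Lemma fejerK_expand P x : (fejerK P x)%:C = (P.+1%:R^-1) ^+ n *
  \sum_(c : {ffun 'I_n -> 'I_P.+1 * 'I_P.+1})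
    echar (\row_i ((c i).1%:Z - (c i).2%:Z)) (real_vec x).
Proof.
rewrite /fejerK rmorph_prod (eq_bigr _ (fun i _ => fejer_expand P (x 0 i))).
rewrite big_split/= prodr_const card_ord; congr (_ * _).
rewrite bigA_distr_bigA; apply: eq_bigr => c _; rewrite echarE.
by apply: eq_bigr => i _; rewrite !mxE.
Qed.

End Orthogonality.

(** * Fourier coefficients *)

Section FourierCoefficients.
Context {R : realType} {n : nat}.
Implicit Types (z w : 'rV[R[i]]_n) (g : 'rV[R[i]]_n -> R[i]) (N P : nat)
  (k l : 'rV[int]_n) (sigma M : R).

Lemma echar_analytic sigma k : analytic_on_torus sigma (echar k : 'rV[R[i]]_n -> R[i]).
Proof.
split=> [z _ m|z _]; first exact: echar_periodic.
exists (fun m => echar k z * exp_coef k m), 1; split=> // h _.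
rewrite echarDr; have := has_sumZ (c := echar k z) (@has_sum_echar R n k h).
by apply: eq_has_sum => m; rewrite mulrA.
Qed.

Lemma echar_regular sigma k : regular sigma (echar k : 'rV[R[i]]_n -> R[i]).
Proof. by apply: (@analytic_regular _ _ (sigma + 1)); rewrite ?ltrDl//; exact: echar_analytic. Qed.

Lemma periodicM sigma (f g : 'rV[R[i]]_n -> R[i]) :
  periodic_on_strip sigma f -> periodic_on_strip sigma g ->
  periodic_on_strip sigma (fun z => f z * g z).
Proof. by move=> fp gp z sz k; rewrite fp// gp. Qed.

Lemma echar_per sigma k : periodic_on_strip sigma (echar k : 'rV[R[i]]_n -> R[i]).
Proof. by move=> z _ m; exact: echar_periodic. Qed.

Definition fourier g k : R[i] := mean (fun z => g z * echar (- k) z).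

(** Base points with different imaginary parts yield the same coefficient, up
    to the factor echar k z. Since the means are bounded by the supremum of
    |g|, this is what makes the coefficients decay exponentially. *)
Lemma fourier_cvg sigma g k z : 0 < sigma -> periodic_on_strip sigma g ->
  regular sigma g -> strip sigma z ->
  gmean N (fun x => g (z + real_vec x) * echar (- k) (real_vec x))
    @[N --> nat_ultra] --> (fourier g k * echar k z : R[i]^o).
Proof.
move=> s0 gp gr sz.
have := mean_cvg s0 (periodicM gp (@echar_per sigma (- k)))
  (regularM gr (echar_regular sigma (- k))) sz.
move=> /(ccvgM (@ccvg_cst R nat nat_ultra _ (echar k z))).
rewrite [_ * mean _]mulrC; apply: eq_ccvg => N.
rewrite /amean -gmeanZ; apply: eq_gmean => x.
by rewrite echarDr mulrCA [echar k z * _]mulrA echarN mul1r.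
Qed.

Lemma ccvg_cmod (T : Type) (F : set_system T) {FF : Filter F} (f : T -> R[i]) (l : R[i]) :
  f @ F --> (l : R[i]^o) -> (cmod (f t))%:C @[t --> F] --> ((cmod l)%:C : R[i]^o).
Proof.
move=> fl; apply/ccvgP => e e0; apply: filterS ((ccvgP _ _).1 fl e e0) => t.
apply: le_trans; rewrite -rmorphB cmod_real ler_norml.
have := cmod_dist_tri (f t) l 0; have := cmod_dist_tri l (f t) 0.
by rewrite !subr0 [cmod (l - f t)]cmodBC => *; apply/andP; split; lra.
Qed.

Lemma near_fset (T : Type) (F : set_system T) {FF : Filter F} (I : choiceType)
    (D : {fset I}) (Q : I -> T -> Prop) :
  (forall i, i \in D -> \forall t \near F, Q i t) ->
  \forall t \near F, forall i, i \in D -> Q i t.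
Proof.
move=> DQ; apply: filterS (@filter_bigI T I D (fun i => [set t | Q i t]) F FF DQ).
by move=> t tD i iD; exact: (tD i).
Qed.

Lemma bessel_fourier sigma g M z (F : {fset 'rV[int]_n}) : 0 < sigma ->
  periodic_on_strip sigma g -> regular sigma g ->
  (forall z, strip sigma z -> cmod (g z) <= M) -> strip sigma z ->
  \sum_(k <- F) (cmod (fourier g k) * cmod (echar k z)) ^+ 2 <= M ^+ 2.
Proof.
move=> s0 gp gr gM sz.
have M0 : 0 <= M by rewrite (le_trans (cmod_ge0 _) (gM _ sz)).
pose b k N := gmean N (fun x => g (z + real_vec x) * echar (- k) (real_vec x)).
have bl : \sum_(k <- F) (cmod (b k N))%:C * (cmod (b k N))%:C @[N --> nat_ultra] -->
    (\sum_(k <- F) (cmod (fourier g k * echar k z))%:C *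
                   (cmod (fourier g k * echar k z))%:C : R[i]^o).
  apply: ccvg_sum => k; apply: ccvgM; apply: ccvg_cmod; exact: fourier_cvg s0 gp gr sz.
have orth : \forall N \near \oo, forall k, k \in F -> forall l, l \in F -> k != l ->
    gmean N (fun x => echar (k - l) (real_vec x) : R[i]) = 0.
  apply: near_fset => k _; apply: near_fset => l _.
  have [->|kl] := eqVneq k l; first exact: nearW.
  have kl0 : k - l != 0 by rewrite subr_eq0.
  by apply: filterS (@near_orthogonal R n _ kl0) => N -> _.
have := @ccvg_bound _ _ _ _ _ _ (M ^+ 2) bl.
rewrite (_ : \sum_(k <- F) _ =
    (\sum_(k <- F) (cmod (fourier g k) * cmod (echar k z)) ^+ 2)%:C); last first.
  by rewrite rmorph_sum; apply: eq_bigr => k _; rewrite -rmorphM -cmodM.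
rewrite cmod_real ger0_norm ?sumr_ge0// => [|k _]; last exact: sqr_ge0.
apply; apply: nat_ultra_oo; apply: filterS orth => N orthN.
rewrite (_ : \sum_(k <- F) _ = (\sum_(k <- F) cmod (b k N) ^+ 2)%:C); last first.
  by rewrite rmorph_sum; apply: eq_bigr => k _; rewrite -rmorphM.
rewrite cmod_real ger0_norm ?sumr_ge0// => [|k _]; last exact: sqr_ge0.
apply: le_trans (bessel _ _) _.
  by move=> k l kF lF; exact: orthN.
rewrite -[leRHS](@rmean_cst _ n N); apply: rmean_le => x.
by rewrite lerXn2r ?nnegrE ?cmod_ge0 ?gM//; exact: strip_add_real.
Qed.

(** The Bessel inequality is added up over the 2^n corners of the polystrip of
    half-width s. For each frequency k, one of the corners makes |echar k|
    equal to exp (2 pi |k| s). *)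
Lemma weighted_bessel sigma g M (s : R) (F : {fset 'rV[int]_n}) : 0 < sigma ->
  periodic_on_strip sigma g -> regular sigma g ->
  (forall z, strip sigma z -> cmod (g z) <= M) -> 0 <= s < sigma ->
  \sum_(k <- F) cmod (fourier g k) ^+ 2 * expR (4 * pi * (norm1 k)%:R * s) <=
    2 ^+ n * M ^+ 2.
Proof.
move=> s0 gp gr gM /andP[sge0 ss].
pose corner (e : {ffun 'I_n -> bool}) : 'rV[R[i]]_n :=
  \row_i (0 +i* (if e i then s else - s)).
have scorner e : strip sigma (corner e).
  by move=> i; rewrite mxE/=; case: (e i); rewrite ?normrN ger0_norm.
have -> : 2 ^+ n * M ^+ 2 = \sum_(e : {ffun 'I_n -> bool}) M ^+ 2.
  by rewrite sumr_const card_ffun card_bool card_ord -[_ *+ (2 ^ n)%N]mulr_natl natrX.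
apply: (@le_trans _ _ (\sum_(e : {ffun 'I_n -> bool}) \sum_(k <- F)
    (cmod (fourier g k) * cmod (echar k (corner e))) ^+ 2)); last first.
  by apply: ler_sum => e _; apply: bessel_fourier (scorner e).
rewrite exchange_big/=; apply: ler_sum => k _.
(* the corner at which echar k is largest *)
pose e : {ffun 'I_n -> bool} := [ffun i => k 0 i < 0].
have ek : cmod (echar k (corner e)) ^+ 2 = expR (4 * pi * (norm1 k)%:R * s).
  rewrite cmod_echar -expRM_natl; congr expR.
  have -> : \sum_i (k 0 i)%:~R * complex.Im (corner e 0 i) = - ((norm1 k)%:R * s).
    rewrite norm1E mulr_suml -sumrN; apply: eq_bigr => i _; rewrite !mxE ffunE/=.
    have [k0|k0] := ltrP (k 0 i) 0.
      by rewrite ltr0_norm ?ltrz0// mulNr opprK.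
    by rewrite ger0_norm ?ler0z// mulrN.
  by ring.
by rewrite (bigD1 e)//= exprMn ek lerDl sumr_ge0// => i _; exact: sqr_ge0.
Qed.

(** The distance on the torus is measured by chords, which is what the Fejer
    kernel integrates. An increment t is first reduced modulo the integers; if
    it still exceeds eta, the bound on |g| is enough. *)
Lemma regular_torus_lip sigma g : periodic_on_strip sigma g -> regular sigma g ->
  exists C, 0 <= C /\ forall z x, strip sigma z ->
    cmod (g z - g (z + real_vec x)) <= \sum_j C * cmod (1 - e1 (x 0 j)%:C).
Proof.
move=> gp [C [eta [C0 e0 gC]]]; pose C' := C + C / eta.
have C'0 : 0 <= C' by rewrite addr_ge0// divr_ge0// ltW.
have lip1 z j (t : R) : strip sigma z ->
    cmod (delta g j t%:C z) <= C' * cmod (1 - e1 t%:C).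
  move=> sz; have [m mt] := near_int t; have le4 := cmod_1Be1_ge mt.
  pose s := t - m%:~R.
  have -> : delta g j t%:C z = delta g j s%:C z.
    rewrite /delta -[in RHS](gp (z + _) _ (m *: delta_mx 0 j)); last first.
      have -> : s%:C *: delta_mx 0 j = real_vec (s *: delta_mx 0 j).
        by apply/rowP => i; rewrite !mxE rmorphM/= rmorph_nat.
      exact: strip_add_real.
    congr (g _ - _); rewrite -addrA; congr (_ + _); apply/rowP => i; rewrite !mxE.
    rewrite rmorphM/= mulrz_nat -mulrDl rmorphB/= rmorph_int subrK.
    by [].
  have [se|se] := leP `|s| eta.
    have [_ /(_ j s%:C s%:C)] := gC z sz; rewrite cmod_real => /(_ se se)[le1 _].
    rewrite (le_trans le1)//; apply: (@le_trans _ _ (C * cmod (1 - e1 t%:C))).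
      by rewrite ler_wpM2l// (le_trans _ le4)// /s; have := normr_ge0 (t - m%:~R); lra.
    by rewrite ler_wpM2r ?cmod_ge0// lerDl divr_ge0// ltW.
  have szs : strip sigma (z + s%:C *: delta_mx 0 j).
    have -> : s%:C *: delta_mx 0 j = real_vec (s *: delta_mx 0 j).
      by apply/rowP => i; rewrite !mxE rmorphM/= rmorph_nat.
    exact: strip_add_real.
  rewrite (le_trans (cmodB _ _))//.
  have [l1 _] := gC _ szs; have [l2 _] := gC _ sz.
  apply: (@le_trans _ _ (C / eta * cmod (1 - e1 t%:C))); last first.
    by rewrite ler_wpM2r ?cmod_ge0// lerDr.
  apply: (@le_trans _ _ (C / eta * (2 * eta))); last first.
    rewrite ler_wpM2l ?divr_ge0// ?(ltW e0)//; apply: le_trans le4.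
    by rewrite -/s; lra.
  have -> : C / eta * (2 * eta) = C + C by field; rewrite gt_eqF// e0.
  exact: lerD.
exists C'; split=> // z x sz.
pose y m : 'rV[R]_n := \row_i (if (i < m)%N then x 0 i else 0).
have yn : y n = x by apply/rowP => i; rewrite mxE ltn_ord.
suff path m : (m <= n)%N -> cmod (g z - g (z + real_vec (y m))) <=
    \sum_(j < n | (j < m)%N) C' * cmod (1 - e1 (x 0 j)%:C).
  rewrite -[in X in X <= _]yn (le_trans (path n (leqnn n)))// le_eqVlt.
  by apply/orP; left; apply/eqP/eq_bigl => j; rewrite ltn_ord.
elim: m => [_|m IH mn].
  have -> : real_vec (y 0) = 0 by apply/rowP => i; rewrite !mxE.
  by rewrite addr0 subrr cmod0 sumr_ge0// => j _; rewrite mulr_ge0 ?cmod_ge0.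
pose j := Ordinal mn.
have yE : real_vec (y m.+1) = real_vec (y m) + (x 0 j)%:C *: delta_mx 0 j.
  apply/rowP => i; rewrite !mxE eqxx/= ltnS.
  have [ij|ij|ij] := ltngtP i m.
  - by rewrite -val_eqE /= (ltn_eqF ij) mulr0 addr0.
  - by rewrite -val_eqE /= (gtn_eqF ij) mulr0 addr0.
  - have -> : i = j by exact: val_inj.
    by rewrite eqxx mulr1 add0r.
rewrite (bigD1 j)//=; apply: le_trans (cmod_dist_tri (g (z + real_vec (y m))) _ _) _.
rewrite [leRHS]addrC lerD//.
  rewrite (le_trans (IH (ltnW mn)))// le_eqVlt; apply/orP; left; apply/eqP.
  by apply: eq_bigl => i; rewrite ltnS -val_eqE/= ltn_neqAle andbC.
rewrite yE addrA cmodBC; apply: lip1; exact: strip_add_real.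
Qed.

(** Uniqueness of Fourier coefficients: the convolution of g with the Fejer
    kernel is a trigonometric polynomial built from the coefficients of g, hence
    0, and it is close to g because the kernel is concentrated near 0. *)
Lemma fourier_eq0 sigma g z : 0 < sigma -> periodic_on_strip sigma g ->
  regular sigma g -> (forall k, fourier g k = 0) -> strip sigma z -> g z = 0.
Proof.
move=> s0 gp gr g0 sz; have [C [C0 lip]] := regular_torus_lip gp gr.
have conv P : gmean N (fun x => g (z + real_vec x) * (fejerK P x)%:C)
    @[N --> nat_ultra] --> (0 : R[i]^o).
  pose kc (c : {ffun 'I_n -> 'I_P.+1 * 'I_P.+1}) : 'rV[int]_n :=
    \row_i ((c i).1%:Z - (c i).2%:Z).
  have lim : \sum_c P.+1%:R^-1 ^+ n * gmean N (fun x =>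
      g (z + real_vec x) * echar (- - kc c) (real_vec x)) @[N --> nat_ultra] -->
      (\sum_(c : {ffun 'I_n -> 'I_P.+1 * 'I_P.+1})
         P.+1%:R^-1 ^+ n * (fourier g (- kc c) * echar (- kc c) z) : R[i]^o).
    apply: ccvg_sum => c; apply: ccvgM; first exact: ccvg_cst.
    exact: fourier_cvg s0 gp gr sz.
  rewrite (_ : \sum_c _ = 0) in lim; last first.
    by rewrite big1// => c _; rewrite g0 mul0r mulr0.
  apply: eq_ccvg lim => N; under [RHS]eq_gmean => x.
    rewrite fejerK_expand mulrCA mulr_sumr; over.
  rewrite gmeanZ gmean_sum -mulr_sumr; congr (_ * _).
  by apply: eq_bigr => c _; apply: eq_gmean => x; rewrite opprK.
have approx P N (e : R) : 0 < e -> (P <= N)%N ->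
    cmod (g z - gmean N (fun x => g (z + real_vec x) * (fejerK P x)%:C)) <=
    n%:R * (C * ((e + e^-1 * (4 / P.+1%:R)) / 2)).
  move=> e0 PN; have en0 : e != 0 by rewrite gt_eqF.
  have -> : g z = gmean N (fun x : 'rV[R]_n => g z * (fejerK P x)%:C).
    by rewrite gmeanZ gmean_real rmean_fejerK// mulr1.
  rewrite -gmeanB (le_trans (cmod_gmean _ _))//.
  pose r j (x : 'rV[R]_n) := C / 2 * (e * fejerK P x +
    e^-1 * (fejerK P x * cmod (1 - e1 (x 0 j)%:C) ^+ 2)).
  apply: (@le_trans _ _ (rmean N (fun x => \sum_j r j x))).
    apply: rmean_le => x; rewrite -mulrBl cmodM cmod_real ger0_norm ?fejerK_ge0//.
    rewrite (le_trans (ler_wpM2r (fejerK_ge0 _ _) (lip z x sz)))//.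
    rewrite mulr_suml; apply: ler_sum => j _; rewrite /r.
    set q := cmod _; set K := fejerK P x.
    have K0 : 0 <= K by exact: fejerK_ge0.
    (* 2 q <= e + q ^+ 2 / e trades the chord q for its square *)
    have -> : C / 2 * (e * K + e^-1 * (K * q ^+ 2)) =
      C * q * K + C * K / 2 * e^-1 * (e - q) ^+ 2 by field.
    by rewrite lerDl mulr_ge0 ?sqr_ge0// mulr_ge0 ?invr_ge0 ?(ltW e0)// !mulr_ge0.
  rewrite rmean_sum (_ : n%:R * _ = \sum_(j < n) (C * ((e + e^-1 * (4 / P.+1%:R)) / 2))).
    apply: ler_sum => j _; rewrite /r rmeanZ rmeanD !rmeanZ rmean_fejerK// mulr1.
    rewrite -mulrA ler_wpM2l// mulrC ler_wpM2r ?invr_ge0// lerD2l.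
    by rewrite ler_wpM2l ?invr_ge0 ?(ltW e0)// rmean_fejerK_dist.
  by rewrite sumr_const card_ord mulr_natl.
apply/eqP; rewrite -cmod_eq0 eq_le cmod_ge0 andbT; apply/ler_addgt0Pr => d d0.
rewrite add0r; pose c := n%:R * C.
have c0 : 0 <= c by rewrite mulr_ge0.
pose e := d / 2 / (c + 1).
have e0 : 0 < e by rewrite !divr_gt0// ltr_wpDl.
(* then both terms of approx are at most e *)
have [P Pe] : exists P, 4 / P.+1%:R <= e ^+ 2.
  have q0 : 0 < e ^+ 2 / 4 by rewrite divr_gt0// exprn_gt0.
  have [P _ /(_ P (leqnn P)) PP] := near_infty_natSinv_lt (PosNum q0).
  have PP' : P.+1%:R^-1 < e ^+ 2 / 4 by [].
  by exists P; rewrite mulrC -ler_pdivlMr//; exact: ltW.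
have d20 : 0 < d / 2 by rewrite divr_gt0.
have big : nat_ultra [set N | (P <= N)%N].
  by apply: nat_ultra_oo; exists P.
have [N [/= PN]] := filter_ex (filterI big ((ccvgP _ _).1 (conv P) _ d20)).
rewrite subr0 => le2; have le1 := approx P N e e0 PN.
rewrite -[g z](subrK (gmean N (fun x => g (z + real_vec x) * (fejerK P x)%:C))).
rewrite (le_trans (cmodD _ _))// [leRHS]splitr lerD// (le_trans le1)//.
have le3 : e^-1 * (4 / P.+1%:R) <= e.
  by rewrite ler_pdivrMl// -expr2.
apply: (@le_trans _ _ (c * e)).
  rewrite /c -mulrA ler_wpM2l// ler_wpM2l// ler_pdivrMr// mulr_natr mulr2n.
  by rewrite lerD2l.
by rewrite /e mulrCA ler_piMr// ?(ltW d20)// ler_pdivrMr ?ltr_wpDl// mul1r lerDl.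
Qed.

End FourierCoefficients.

(** * Averages of trigonometric series *)

Section Averages.
Context {R : realType}.
Local Open Scope ereal_scope.
Local Open Scope ring_scope.
Local Notation mu := (@lebesgue_measure R).
Local Notation unif := (uniform_prob (@ltr01 R)).

Lemma bounded_integrable d (T : measurableType d) (P : probability T R)
    (f : T -> R) (M : R) : measurable_fun setT f -> (forall x, `|f x| <= M) ->
  P.-integrable setT (EFin \o f).
Proof.
move=> mf fM; apply: measurable_bounded_integrable => //.
  by have := probability_setT P => /= ->; rewrite ltry.
by exists M; split; rewrite ?num_real// => N MN x _; rewrite /= (le_trans (fM x))// ltW.
Qed.

Lemma integral_uniform_cos (m : int) (b : R) :
  (\int[unif]_t (cos (2 * pi * (m%:~R * t) + b))%:E =
   (if m == 0 then cos b else 0)%:E)%E.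
Proof.
have [->|m0] := eqVneq m 0.
  under eq_integral do rewrite mul0r mulr0 add0r.
  by rewrite integral_cst//= probability_setT mule1.
pose w : R := 2 * pi * m%:~R.
have w0 : w != 0 by rewrite mulf_neq0 ?intr_eq0// mulf_neq0 ?pnatr_eq0// gt_eqF ?pi_gt0.
pose f (t : R) := cos (w * t + b).
have fE t : cos (2 * pi * (m%:~R * t) + b) = f t by rewrite /f /w mulrA.
under eq_integral do rewrite fE.
have cf : continuous f.
  move=> t; apply: (@continuous_comp _ _ _ (fun t => w * t + b) cos).
    by apply: cvgD; [apply: cvgMr; exact: cvg_id|exact: cvg_cst].
  exact: continuous_cos.
have mf : measurable_fun setT f by exact: continuous_measurable_fun.
(* adding 1 makes the integrand nonnegative, which reduces its integral for
   the uniform law to the Lebesgue integral of a continuous function *)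
have int1 : (\int[unif]_t (1 + f t)%:E = 1)%E.
  rewrite (@integral_uniform R 0 1 ltr01 (fun t => (1 + f t)%:E)); last 2 first.
  - by apply/measurable_EFinP/measurable_funD.
  - by move=> t; rewrite lee_fin -lerBlDl sub0r cos_geN1.
  rewrite subr0 invr1 mul1e.
  pose F (t : R) := t + w^-1 * sin (w * t + b).
  have dF (t : R) : is_derive t 1 F (1 + f t).
    by rewrite /F; apply: is_derive_eq; rewrite /GRing.scale/= /f; field.
  have cF : continuous F.
    move=> t; apply: differentiable_continuous; apply/derivable1_diffP.
    by have [] := dF t.
  rewrite (@continuous_FTC2 R (fun t => 1 + f t) F 0 1 ltr01).
  - rewrite /F mulr0 add0r add0r mulr1.
    have -> : sin (w + b) = sin b.
      have e1m : e1 (m%:~R : R)%:C = 1 by rewrite rmorph_int e1_int.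
      have := e1_real (m%:~R : R); rewrite e1m => -[c1 s1].
      by rewrite sinD -/w -c1 -s1 mul0r add0r mul1r.
    by rewrite -EFinB addrK.
  - apply: continuous_subspaceT => t; apply: cvgD; [exact: cvg_cst|exact: cf].
  - split.
    + by move=> t _; have [] := dF t.
    + by apply: cvg_at_right_filter; exact: cF.
    + by apply: cvg_at_left_filter; exact: cF.
  - by move=> t _; rewrite derive1E; exact: derive_val.
have if_ : unif.-integrable setT (EFin \o f).
  exact: (@bounded_integrable _ _ (uniform_prob (@ltr01 R)) f 1 mf (fun t => cos_max _)).
have i1 : unif.-integrable setT (EFin \o (fun=> 1 : R)).
  apply: (@bounded_integrable _ _ (uniform_prob (@ltr01 R)) _ 1) => // t.
  by rewrite normr1.
have int2 : (\int[unif]_t (1 + f t)%:E = 1 + \int[unif]_t (f t)%:E)%E.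
  under eq_integral do rewrite EFinD.
  rewrite integralD// integral_cst//=.
  by have := probability_setT unif => /= ->; rewrite mule1.
move: int1; rewrite int2.
have [r ->] : exists r, (\int[unif]_x (f x)%:E)%E = r%:E.
  exists (fine (\int[unif]_x (f x)%:E)%E).
  by rewrite fineK//; exact: (integrable_fin_num measurableT if_).
by rewrite -EFinD => -[/eqP]; rewrite -subr_eq0 addrAC subrr add0r => /eqP ->.
Qed.

Definition tdot n (k : 'I_n -> int) (t : n.-tuple R) : R :=
  \sum_i (k i)%:~R * tnth t i.

Lemma measurable_tdot n (k : 'I_n -> int) :
  measurable_fun setT (tdot k : n.-tuple (measurableTypeR R) -> R).
Proof.
apply: measurable_sum => i; apply: measurable_funM => //.
exact: measurable_tnth.
Qed.

Lemma measurable_cos_tdot n (k : 'I_n -> int) (b : R) :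
  measurable_fun setT (fun t : n.-tuple (measurableTypeR R) => cos (2 * pi * tdot k t + b)).
Proof.
apply: (@measurableT_comp _ _ _ _ _ _ (@cos R)).
  by apply: continuous_measurable_fun; exact: continuous_cos.
apply: measurable_funD => //; apply: measurable_funM => //; exact: measurable_tdot.
Qed.

(** The phase b makes the induction on the dimension go through without
    separating the trigonometric functions of a sum into products. *)
Lemma integral_cube_cos n (k : 'I_n -> int) (b : R) :
  (\int[@lebesgue_cube R n]_t (cos (2 * pi * tdot k t + b))%:E =
   (if [forall i, k i == 0] then cos b else 0)%:E)%E.
Proof.
elim: n k b => [|n IH] k b.
  rewrite (_ : [forall i, k i == 0] = true); last by apply/forallP => -[].
  rewrite /= integral_dirac//.
    by rewrite diracT mul1e /tdot big_ord0 mulr0 add0r.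
  by apply/measurable_EFinP; exact: measurable_cos_tdot.
pose f (t : n.+1.-tuple (measurableTypeR R)) := cos (2 * pi * tdot k t + b).
have mf : measurable_fun setT f by exact: measurable_cos_tdot.
have fb d (T : measurableType d) (P : probability T R)
    (phi : T -> n.+1.-tuple (measurableTypeR R)) :
    measurable_fun setT phi -> P.-integrable setT ((EFin \o f) \o phi).
  move=> mphi; apply: (@bounded_integrable _ _ _ (f \o phi) 1).
    exact: measurableT_comp.
  by move=> x; exact: cos_max.
pose k' (i : 'I_n) := k (lift ord0 i).
have fcons p : f (cons_pair p) =
    cos (2 * pi * tdot k' p.2 + (2 * pi * ((k ord0)%:~R * p.1) + b)).
  have tE : tdot k (cons_pair p) = (k ord0)%:~R * p.1 + tdot k' p.2.
    rewrite /tdot big_ord_recl; congr (_ + _).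
    by apply: eq_bigr => i _; rewrite tnthS.
  by rewrite /f tE mulrDr [X in cos (X + _)]addrC addrA.
rewrite /= integral_distribution; last 2 first.
- exact/measurable_EFinP.
- by apply: fb; exact: measurable_cons_pair.
rewrite -integral12_prod_meas1; last by apply: fb; exact: measurable_cons_pair.
transitivity (\int[unif]_x (if [forall i, k' i == 0]
    then cos (2 * pi * ((k ord0)%:~R * x) + b) else 0)%:E)%E.
  apply: eq_integral => x _; rewrite -IH; apply: eq_integral => y _ /=.
  by congr EFin; exact: (fcons (x, y)).
have -> : [forall i, k i == 0] = (k ord0 == 0) && [forall i, k' i == 0].
  apply/forallP/andP => [k0|[k0 /forallP k'0] i].
    by split=> //; apply/forallP => i; exact: k0.
  by have [j ->|->] := unliftP ord0 i; [exact: k'0|].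
have [k'0|k'0] := boolP [forall i, k' i == 0]; last by rewrite andbF integral0.
by rewrite andbT; exact: integral_uniform_cos.
Qed.

Lemma integral_Re_echar n (k : 'rV[int]_n) (c : R[i]) :
  measurable_fun setT (fun t : n.-tuple (measurableTypeR R) =>
    complex.Re (c * echar k (real_vec (\row_i tnth t i)))) /\
  (\int[@lebesgue_cube R n]_t
     (complex.Re (c * echar k (real_vec (\row_i tnth t i))))%:E =
   (if k == 0 then complex.Re c else 0)%:E)%E.
Proof.
pose kf i := k 0 i.
(* the sine is a cosine with phase pi / 2 *)
have E t : complex.Re (c * echar k (real_vec (\row_i tnth t i))) =
    complex.Re c * cos (2 * pi * tdot kf t + 0) +
    complex.Im c * cos (2 * pi * tdot kf t + pi / 2).
  rewrite echar_real_dot e1_real cReM/= cosDpihalf addr0 mulrN.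
  suff -> : dotZ k (\row_i tnth t i) = tdot kf t by [].
  by rewrite /dotZ /tdot; apply: eq_bigr => i _; rewrite mxE.
have mf b : measurable_fun setT (fun t : n.-tuple (measurableTypeR R) =>
    cos (2 * pi * tdot kf t + b)) by exact: measurable_cos_tdot.
have kE : [forall i, kf i == 0] = (k == 0).
  apply/forallP/eqP => [k0|k0 i]; last by rewrite /kf k0 mxE.
  by apply/rowP => i; rewrite mxE; apply/eqP; exact: k0.
have iF (x b : R) : (@lebesgue_cube R n).-integrable setT
    (fun t => (x * cos (2 * pi * tdot kf t + b))%:E).
  apply: (@bounded_integrable _ _ _ _ `|x|).
    exact: measurable_funM.
  by move=> t; rewrite normrM ler_piMr// cos_max.
split.
  under eq_fun do rewrite E.
  by apply: measurable_funD; apply: measurable_funM.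
under eq_integral do rewrite E EFinD.
rewrite integralD//.
under eq_integral do rewrite EFinM.
rewrite integralZl//; last by have := iF 1 0; under eq_fun do rewrite mul1r.
under [X in (_ + X)%E]eq_integral do rewrite EFinM.
rewrite integralZl//; last by have := iF 1 (pi / 2); under eq_fun do rewrite mul1r.
rewrite !integral_cube_cos kE; case: ifPn => _; rewrite ?mule0 ?adde0//.
by rewrite cos0 cos_pihalf mule1 mule0 adde0.
Qed.

(** By dominated convergence, it is enough to integrate finite sums of
    characters. *)
Lemma integral_Re_tseries n (a : 'rV[int]_n -> R[i]) (B : R)
    (U : 'rV[R]_n -> R[i]) :
  (forall A : {fset 'rV[int]_n}, \sum_(k <- A) cmod (a k) <= B) ->
  (forall x, has_sum (fun k => a k * echar k (real_vec x)) (U x)) ->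
  (\int[@lebesgue_cube R n]_t (complex.Re (U (\row_i tnth t i)))%:E =
   (complex.Re (a 0))%:E)%E.
Proof.
move=> aB aU.
have /choice[F FP] : forall N : nat, exists A : {fset 'rV[int]_n},
    0 \in A /\ forall x, cmod (U x - \sum_(k <- A) a k * echar k (real_vec x)) <= N.+1%:R^-1.
  move=> N; have [|A [A0 _]] := @abs_tail R _ (fun k => cmod (a k)) B (fun=> cmod_ge0 _) aB N.+1%:R^-1.
    by rewrite invr_gt0.
  exists (A `|` [fset 0])%fset; split; first by rewrite !inE eqxx orbT.
  move=> x; apply: has_sum_tail (aU x) _ => C AC.
  apply: (@le_trans _ _ (\sum_(k <- C) cmod (a k))).
    by apply: ler_sum => k _; rewrite cmodM cmod_echar_real mulr1.
  by apply: A0; apply: fdisjointWl AC; exact: fsubsetUl.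
pose s N (x : 'rV[R]_n) := \sum_(k <- F N) a k * echar k (real_vec x).
pose row t : 'rV[R]_n := \row_(i < n) tnth t i.
have ms N : measurable_fun setT (fun t : n.-tuple (measurableTypeR R) =>
    complex.Re (s N (row t))).
  rewrite /s; under eq_fun do rewrite cRe_sum.
  by apply: measurable_sum => k; have [] := integral_Re_echar k (a k).
have sB N x : cmod (s N x) <= B.
  rewrite (le_trans _ (aB (F N)))// (le_trans (cmod_sum _ _ _))//.
  by apply: ler_sum => k _; rewrite cmodM cmod_echar_real mulr1.
have intS N : (\int[@lebesgue_cube R n]_t (complex.Re (s N (row t)))%:E =
    (complex.Re (a 0))%:E)%E.
  rewrite /s; under eq_integral do rewrite cRe_sum -sumEFin.
  rewrite integral_sum//; last first.
    move=> k; apply: (@bounded_integrable _ _ _ _ (cmod (a k))).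
      by have [] := integral_Re_echar k (a k).
    move=> t; rewrite (le_trans (Re_le_cmod _))// cmodM cmod_echar_real mulr1//.
  rewrite (big_fsetD1 0)/=; last by have [] := FP N.
  rewrite (integral_Re_echar 0 (a 0)).2 eqxx.
  rewrite big_seq big1 ?adde0// => k; rewrite in_fsetD1 => /andP[k0 _].
  by rewrite (integral_Re_echar k (a k)).2 (negbTE k0).
have sU x : complex.Re (s N x) @[N --> \oo] --> complex.Re (U x).
  apply/cvgrPdist_le => e e0; near=> N.
  have [_ /(_ x) le1] := FP N.
  have -> : complex.Re (U x) - complex.Re (s N x) = complex.Re (U x - s N x).
    by rewrite cReD cReN.
  rewrite (le_trans (Re_le_cmod _))// (le_trans le1)// ltW//.
  by near: N; exact: near_infty_natSinv_lt (PosNum e0).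
have mU : measurable_fun setT (fun t : n.-tuple (measurableTypeR R) =>
    complex.Re (U (row t))).
  by apply: (measurable_fun_cvg ms) => t _; exact: sU.
have [] := @dominated_convergence _ _ _ (@lebesgue_cube R n) setT measurableT
  (fun N t => (complex.Re (s N (row t)))%:E) (fun t => (complex.Re (U (row t)))%:E)
  (fun=> B%:E).
- by move=> N; exact/measurable_EFinP.
- exact/measurable_EFinP.
- by apply: aeW => t _; apply: cvg_EFin; [exact: nearW|exact: sU].
- apply: (@bounded_integrable _ _ _ _ `|B|) => // t.
- by apply: aeW => t N _; rewrite lee_fin (le_trans (Re_le_cmod _)).
move=> _ _; under [X in X @ _]eq_fun do rewrite intS.
move=> lim; apply/esym; apply: (@cvg_unique _ _ _ _ _ _ (@cvg_cst _ _ _ _ _) lim).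
Unshelve. all: by end_near.
Qed.

Lemma average_tseries n (a : 'rV[int]_n -> R[i]) (B : R) (u : 'rV[R[i]]_n -> R[i]) :
  (forall A : {fset 'rV[int]_n}, \sum_(k <- A) cmod (a k) <= B) ->
  (forall x, has_sum (fun k => a k * echar k (real_vec x)) (u (real_vec x))) ->
  average u = a 0.
Proof.
move=> aB au; rewrite /average /Rintegral.
rewrite (integral_Re_tseries (U := fun x => u (real_vec x)) aB au).
have := @integral_Re_tseries n (fun k => (- 'i%C) * a k) B
  (fun x => (- 'i%C) * u (real_vec x)).
(* the imaginary part is the real part of - i times the series *)
have ImE (z : R[i]) : complex.Re (- 'i%C * z) = complex.Im z.
  by case: z => x y /=; ring.
have -> : (\int[@lebesgue_cube R n]_t
    (complex.Re (- 'i%C * u (real_vec (\row_i tnth t i))))%:E =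
    \int[@lebesgue_cube R n]_t (complex.Im (u (real_vec (\row_i tnth t i))))%:E)%E.
  by apply: eq_integral => t _; rewrite ImE.
rewrite ImE => ->.
- by case: (a 0).
- move=> A; apply: le_trans (aB A); apply: ler_sum => k _; rewrite cmodM.
  rewrite (_ : cmod (- 'i%C) = 1) ?mul1r// cmodN.
  by apply/eqP; rewrite -(@eqrXn2 _ 2) ?cmod_ge0// cmod_sqr/= expr0n add0r.
- move=> x; have := has_sumZ (c := - 'i%C) (au x).
  by apply: eq_has_sum => k; rewrite mulrA.
Qed.

End Averages.

(** * Small divisors *)

Section HurwitzZeta.
Context {R : realType}.
Implicit Types (b : R).

Lemma hurwitz_term b j : 1 <= b -> (b + j%:R) `^ (- 2) = ((b + j%:R) ^+ 2)^-1.
Proof.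
by move=> b1; rewrite powRN (powR_mulrn 2)// addr_ge0// (le_trans ler01).
Qed.

Lemma hurwitz_partial b N : 1 <= b ->
  \sum_(j < N) ((b + j%:R) ^+ 2)^-1 <= hurwitz_zeta 2 b.
Proof.
move=> b1; have b0 j : 0 < b + j%:R by rewrite ltr_pwDl// (lt_le_trans ltr01).
pose u := series (fun j : nat => (b + j%:R) `^ (- 2)).
have uE M : u M = \sum_(j < M) ((b + j%:R) ^+ 2)^-1.
  by rewrite /u /series/= big_mkord; apply: eq_bigr => j _; rewrite hurwitz_term.
(* the j-th term is at most 2 / ((j + 1) (j + 2)), and these telescope *)
have u_bound M : u M <= 2 - 2 / M.+1%:R.
  elim: M => [|M IH]; first by rewrite uE big_ord0 divr1 subrr.
  rewrite uE big_ord_recr/= -uE; apply: (le_trans (lerD IH (lexx _))).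
  have M0 : (0 : R) <= M%:R by [].
  have -> : 2 - 2 / M.+2%:R = 2 - 2 / M.+1%:R + 2 / (M.+1%:R * M.+2%:R) :> R.
    by rewrite -[M.+2%:R]natr1 -[M.+1%:R]natr1; field; rewrite !gt_eqF//; lra.
  rewrite lerD2l -[leLHS]mul1r ler_pdivrMr ?exprn_gt0// mulrAC ler_pdivlMr ?mulr_gt0//.
  rewrite mul1r (@le_trans _ _ (2 * M.+1%:R ^+ 2))//.
    by rewrite -[M.+2%:R]natr1 -[M.+1%:R]natr1; nra.
  by rewrite ler_pM2l// lerXn2r ?nnegrE//; [exact: ltW|rewrite -natr1; lra].
have und : nondecreasing_seq u.
  apply/nondecreasing_seqP => M; rewrite !uE big_ord_recr/= lerDl invr_ge0.
  exact: sqr_ge0.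
rewrite -uE /hurwitz_zeta -/u; apply: nondecreasing_cvgn_le => //.
apply: nondecreasing_is_cvgn => //; exists 2 => _ [M _ <-].
by rewrite (le_trans (u_bound M))// gerBl.
Qed.

Lemma hurwitz_ge0 b : 1 <= b -> 0 <= hurwitz_zeta 2 b.
Proof. by move=> b1; have := hurwitz_partial 0 b1; rewrite big_ord0. Qed.

End HurwitzZeta.

(** Grouping the terms by the value of J leaves a sum over distinct indices in
    which each term occurs at most twice. *)
Lemma sum_paired_fibers (R : realType) (K : choiceType) (s : seq K)
    (J : K -> nat) (opp : K -> K) (g : nat -> R) (B : R) :
  uniq s -> (forall j, 0 <= g j) -> (forall N, \sum_(j < N) g j <= B) ->
  (forall k k', k \in s -> k' \in s -> J k = J k' -> k' = k \/ k' = opp k) ->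
  \sum_(k <- s) g (J k) <= 2 * B.
Proof.
move=> us g0 gB Jinj; pose N := (\max_(k <- s) J k).+1.
have JN k : k \in s -> (J k < N)%N.
  by move=> ks; rewrite ltnS; apply: leq_bigmax_seq.
have -> : \sum_(k <- s) g (J k) =
    \sum_(k <- s) \sum_(j < N) (if J k == j then g j else 0).
  rewrite big_seq [RHS]big_seq; apply: eq_bigr => k ks.
  rewrite (bigD1 (Ordinal (JN k ks)))//= eqxx big1 ?addr0// => j jk.
  by case: eqP => // jE; move: jk; rewrite -val_eqE/= jE eqxx.
rewrite exchange_big/= (@le_trans _ _ (\sum_(j < N) 2 * g j))//; last first.
  by rewrite -mulr_sumr ler_pM2l.
apply: ler_sum => j _; rewrite -big_mkcond/= big_const_seq iter_addr_0 -(mulr_natl (g j)).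
rewrite ler_wpM2r// ler_nat -size_filter.
case sE : [seq x <- s | J x == j] => [//|k0 l]; rewrite -sE.
have : k0 \in [seq x <- s | J x == j] by rewrite sE mem_head.
rewrite mem_filter => /andP[/eqP k0j k0s].
apply: (@uniq_leq_size _ _ [:: k0; opp k0]); first exact: filter_uniq.
move=> k; rewrite mem_filter => /andP[/eqP kj ks].
have [//| |] := Jinj k0 k k0s ks; rewrite ?k0j ?kj// => ->; rewrite !inE eqxx ?orbT//.
Qed.

Section SmallDivisors.
Context {R : realType} {n : nat}.
Variables (omega : 'rV[R]_n) (gamma tau : R).
Hypotheses (gamma_gt0 : 0 < gamma) (tau_ge0 : 0 <= tau)
  (omega_dioph : diophantine gamma tau omega).
Implicit Types (k : 'rV[int]_n).

(** The square of the factor by which the cohomological equation amplifies the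
    k-th Fourier coefficient. *)
Definition small_div k : R := (cmod (1 - e1 (dotZ k omega)%:C) ^+ 2)^-1.

Lemma small_div_ge0 k : 0 <= small_div k.
Proof. by rewrite invr_ge0 sqr_ge0. Qed.

Lemma small_divE k : small_div k = (4 * `|sin (pi * dotZ k omega)| ^+ 2)^-1.
Proof. by rewrite /small_div cmod_1Be1_sin exprMn -natrX. Qed.

Lemma dotZD k k' : dotZ (k + k') omega = dotZ k omega + dotZ k' omega.
Proof.
by rewrite /dotZ -big_split/=; apply: eq_bigr => i _; rewrite mxE intrD mulrDl.
Qed.

Lemma dotZN k : dotZ (- k) omega = - dotZ k omega.
Proof.
by rewrite /dotZ -sumrN; apply: eq_bigr => i _; rewrite mxE rmorphN mulNr.
Qed.

Lemma norm1D k k' : (norm1 (k + k') <= norm1 k + norm1 k')%N.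
Proof.
rewrite /norm1 -big_split/=; apply: leq_sum => i _; rewrite mxE.
by rewrite -lez_nat PoszD !abszE ler_normD.
Qed.

Lemma norm1N k : norm1 (- k) = norm1 k.
Proof. by rewrite /norm1; apply: eq_bigr => i _; rewrite mxE abszN. Qed.

Lemma norm1_eq0 k : (norm1 k == 0%N) = (k == 0).
Proof.
rewrite /norm1 sum_nat_eq0; apply/forallP/eqP => [k0|-> i]; last by rewrite mxE.
by apply/rowP => i; rewrite mxE; apply/eqP; rewrite -absz_eq0; exact: k0.
Qed.

Lemma diophantine_le k (m : int) (x : nat) : k != 0 -> (norm1 k <= x)%N ->
  gamma * x%:R `^ (- tau) <= `|dotZ k omega - m%:~R|.
Proof.
move=> k0 kx; apply: le_trans (omega_dioph k0 m); rewrite ler_pM2l// !powRN.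
have k1 : (0 < norm1 k)%N by rewrite lt0n norm1_eq0.
have x0 := leq_trans k1 kx.
rewrite lef_pV2 ?posrE ?powR_gt0 ?ltr0n//.
by rewrite ge0_ler_powR ?nnegrE// ler_nat.
Qed.

Lemma e1_dotZ_neq1 k : k != 0 -> 1 - e1 (dotZ k omega)%:C != 0.
Proof.
move=> k0; have [m mP] := near_int (dotZ k omega).
rewrite -cmod_eq0 gt_eqF// (lt_le_trans _ (cmod_1Be1_ge mP))// mulr_gt0//.
rewrite (lt_le_trans _ (diophantine_le m k0 (leqnn _)))// mulr_gt0// powR_gt0//.
by rewrite ltr0n lt0n norm1_eq0.
Qed.

(** The points k . omega with |k| <= x are at distance at least
    eta = gamma (2 x) ^ (- tau) from one another modulo the integers, and at
    distance at least 2 ^ tau * eta from the integers. Hence each of the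
    consecutive intervals of length eta starting at 2 ^ tau * eta contains the
    distance to the integers of at most one pair k, - k. *)
Lemma small_div_sum (s : seq 'rV[int]_n) (x : nat) : (0 < x)%N -> uniq s ->
  (forall k, k \in s -> k != 0 /\ (norm1 k <= x)%N) ->
  \sum_(k <- s) small_div k <=
    2 `^ (2 * tau) / (8 * gamma ^+ 2) * hurwitz_zeta 2 (2 `^ tau) *
    x%:R `^ (2 * tau).
Proof.
move=> x0 us sP; have x0R : (0 : R) < x%:R by rewrite ltr0n.
have /choice[m mP] : forall k, exists m : int, `|dotZ k omega - m%:~R| <= 1 / 2.
  by move=> k; exact: near_int.
pose d k := `|dotZ k omega - (m k)%:~R|.
pose b : R := 2 `^ tau; have b1 : 1 <= b by rewrite -(powRr0 2) ler_powR// ler1n.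
pose eta := gamma * (2 * x)%:R `^ (- tau).
have eta0 : 0 < eta by rewrite mulr_gt0// powR_gt0// ltr0n muln_gt0.
have betaE : b * eta = gamma * x%:R `^ (- tau).
  rewrite /eta natrM powRM// mulrCA; congr (_ * _).
  rewrite mulrA (powRN 2) -/b mulfV ?mul1r//.
  by rewrite gt_eqF// (lt_le_trans ltr01).
pose J k := Num.truncn (d k / eta - b).
have Jitv k : k \in s -> (b + (J k)%:R) * eta <= d k < (b + (J k)%:R) * eta + eta.
  move=> /sP[k0 kx]; have : 0 <= d k / eta - b.
    by rewrite subr_ge0 ler_pdivlMr// betaE diophantine_le.
  move=> /truncn_itv/andP[]; rewrite -/(J k) lerBrDl ltrBlDl ler_pdivlMr// => -> /=.
  by rewrite ltr_pdivrMr// -natr1 addrA [(_ + 1) * _]mulrDl mul1r.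
have Jfib k k' : k \in s -> k' \in s -> J k = J k' -> k' = k \/ k' = - k.
  move=> ks k's JE; have [k0 kx] := sP _ ks; have [k'0 k'x] := sP _ k's.
  have dd : `|d k - d k'| < eta.
    have /andP[] := Jitv _ ks; have /andP[] := Jitv _ k's; rewrite -JE.
    set t := (_ * eta); move: (d k) (d k') => y y' h1 h2 h3 h4.
    by rewrite ltr_norml; apply/andP; split; lra.
  have close h (p : int) : `|dotZ h omega - p%:~R| < eta -> (norm1 h <= 2 * x)%N ->
      h = 0.
    move=> hp hx; apply/eqP; apply: contraTT hp => h0.
    by rewrite -leNgt diophantine_le.
  have [sgn|sgn] : `|(dotZ k omega - (m k)%:~R) - (dotZ k' omega - (m k')%:~R)| = `|d k - d k'| \/
     `|(dotZ k omega - (m k)%:~R) + (dotZ k' omega - (m k')%:~R)| = `|d k - d k'|.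
    rewrite /d; set p := dotZ k _ - _; set q := dotZ k' _ - _.
    have [p0|p0] := leP 0 p; have [q0|q0] := leP 0 q.
    - by left; rewrite (ger0_norm p0) (ger0_norm q0).
    - by right; rewrite (ger0_norm p0) (ltr0_norm q0) opprK.
    - by right; rewrite (ger0_norm q0) (ltr0_norm p0) -opprD normrN.
    - by left; rewrite (ltr0_norm q0) (ltr0_norm p0) -opprD normrN.
  - left; apply/esym/eqP; rewrite -subr_eq0; apply/eqP.
    apply: (close _ (m k - m k')).
      rewrite dotZD dotZN rmorphB/=; move: dd; rewrite -sgn; congr (`|_| < _).
      by rewrite !opprD !opprK addrACA.
    by rewrite (leq_trans (norm1D _ _))// norm1N; lia.
  - right; apply/eqP; rewrite -addr_eq0; apply/eqP; rewrite addrC.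
    apply: (close _ (m k + m k')).
      rewrite dotZD rmorphD/=; move: dd; rewrite -sgn; congr (`|_| < _).
      by rewrite !opprD addrACA.
    by rewrite (leq_trans (norm1D _ _))//; lia.
pose g j : R := ((b + j%:R) ^+ 2)^-1.
have g0 j : 0 <= g j by rewrite invr_ge0 sqr_ge0.
have le_g k : k \in s -> small_div k <= (16 * eta ^+ 2)^-1 * g (J k).
  move=> ks; have /andP[dk _] := Jitv _ ks; rewrite -invfM lef_pV2 ?posrE.
  - have sqE (p q : R) : 16 * p ^+ 2 * q ^+ 2 = (4 * (q * p)) ^+ 2 by ring.
    rewrite sqE.
    rewrite lerXn2r ?nnegrE ?cmod_ge0//.
      by rewrite mulr_ge0// mulr_ge0 ?(ltW eta0)// addr_ge0// (le_trans ler01).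
    by rewrite (le_trans _ (cmod_1Be1_ge (mP k)))// ler_pM2l.
  - rewrite exprn_gt0// lt_def cmod_ge0 cmod_eq0 andbT e1_dotZ_neq1//.
    by have [] := sP _ ks.
  - apply: mulr_gt0; first by rewrite mulr_gt0// exprn_gt0.
    by rewrite exprn_gt0// ltr_pwDl// (lt_le_trans ltr01).
rewrite (@le_trans _ _ (\sum_(k <- s) (16 * eta ^+ 2)^-1 * g (J k)))//.
  by rewrite big_seq [leRHS]big_seq; exact: ler_sum.
rewrite -mulr_sumr.
have c0 : 0 < (16 * eta ^+ 2)^-1 by rewrite invr_gt0 mulr_gt0// exprn_gt0.
have := @sum_paired_fibers R _ s J -%R g (hurwitz_zeta 2 b) us g0
  (fun N => hurwitz_partial N b1) Jfib.
rewrite -(ler_pM2l c0).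
move=> /le_trans; apply; rewrite le_eqVlt; apply/orP; left; apply/eqP.
have sq (y : R) : 0 <= y -> y `^ (2 * tau) = (y `^ tau) ^+ 2.
  by move=> y0; rewrite mulrC powRrM powR_mulrn ?powR_ge0.
rewrite (sq 2)// (sq x%:R)// /eta natrM powRN powRM// -/b.
have : x%:R `^ tau != 0 :> R by rewrite gt_eqF// powR_gt0.
have : b != 0 by rewrite gt_eqF// (lt_le_trans ltr01).
have : gamma != 0 by rewrite gt_eqF.
have constE (y c z w : R) : w != 0 -> c != 0 -> y != 0 ->
    (16 * (w * (c * y)^-1) ^+ 2)^-1 * (2 * z) =
    c ^+ 2 / (8 * w ^+ 2) * z * y ^+ 2.
  by move=> w1 c1 y1; field; rewrite w1 c1 y1.
exact: constE.
Qed.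

End SmallDivisors.

(** * The Russmann estimate *)

Section IncompleteGamma.
Context {R : realType}.
Local Notation mu := (@lebesgue_measure R).

Lemma measurable_exp_neg (c : R) : measurable_fun setT (fun u : R => expR (- (c * u))).
Proof.
by apply: (@measurableT_comp _ _ _ _ _ _ (@expR R)) => //; apply: measurableT_comp => //;
  apply: measurable_funM.
Qed.

Lemma integral_exp_tail (c x : R) : 0 < c ->
  (\int[mu]_(u in `[x, +oo[) (expR (- (c * u)))%:E = (c^-1 * expR (- (c * x)))%:E)%E.
Proof.
move=> c0; pose F u : R := - (c^-1 * expR (- (c * u))).
have dF (u : R) : is_derive u 1 F (expR (- (c * u))).
  rewrite /F; apply: is_derive_eq; rewrite /GRing.scale/=.
  by field; rewrite gt_eqF.
have cF : continuous F.
  move=> u; apply: differentiable_continuous; apply/derivable1_diffP.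
  by have [] := dF u.
rewrite (@ge0_continuous_FTC2y R (fun u => expR (- (c * u))) F x 0).
- by rewrite -EFinB /F sub0r opprK.
- by move=> u _; exact: expR_ge0.
- apply: continuous_subspaceT => u; apply: (@continuous_comp _ _ _ (fun u => - (c * u)) expR).
    by apply: cvgN; apply: cvgMr; exact: cvg_id.
  exact: continuous_expR.
- rewrite /F -[X in _ --> X]oppr0 -(mulr0 c^-1); apply: cvgN; apply: cvgMr.
  have -> : (fun u => expR (- (c * u))) = (fun v => expR (- v)) \o (fun u => c * u) by [].
  apply: (@cvg_comp _ _ _ _ _ _ +oo%R); last exact: cvgr_expR.
  by apply: gt0_cvgMry => //; exact: cvg_id.
- by move=> u _; have [] := dF u.
- by apply: cvg_at_right_filter; exact: cF.
- by move=> u _; rewrite derive1E; exact: derive_val.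
Qed.

(** The logarithm of u / (2 p + 1) is less than u / (2 p + 1), and p / (2 p +
    1) is at most 1 / 2. *)
Lemma powR_le_exp (p u : R) : 0 <= p -> 0 < u ->
  u `^ p <= expR (p * ln (2 * p + 1)) * expR (2^-1 * u).
Proof.
move=> p0 u0; have c0 : 0 < 2 * p + 1 by lra.
have -> : u = (u / (2 * p + 1)) * (2 * p + 1) by rewrite divfK// gt_eqF.
set t := u / _; have t0 : 0 < t by rewrite divr_gt0.
have -> : (t * (2 * p + 1)) `^ p = expR (p * ln (t * (2 * p + 1))).
  by rewrite /powR gt_eqF// mulr_gt0.
rewrite -expRD ler_expR lnM ?posrE//.
have := ln_sublinear t0; move: (ln t) (ln (2 * p + 1)) => y z; nra.
Qed.

(** The integrand is dominated by a multiple of exp (- u / 2), so that the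
    extended integral is finite and equal to its real-valued version. *)
Lemma upper_incomplete_integral_fin (tau x : R) : 0 <= tau -> 0 < x ->
  (\int[mu]_(u in `[x, +oo[) (u `^ (2 * tau) * expR (- u))%:E =
   (upper_incomplete_integral tau x)%:E)%E.
Proof.
move=> t0 x0; rewrite /upper_incomplete_integral /Rintegral fineK//.
have m1 : measurable_fun `[x, +oo[ (fun u : R => (u `^ (2 * tau) * expR (- u))%:E).
  apply/measurable_EFinP/measurable_funTS/measurable_funM; first exact: measurable_powR.
  by have := measurable_exp_neg 1; under eq_fun do rewrite mul1r.
rewrite ge0_fin_numE; last first.
  by apply: integral_ge0 => u _; rewrite lee_fin mulr_ge0 ?powR_ge0 ?expR_ge0.
pose C := expR (2 * tau * ln (2 * (2 * tau) + 1)).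
have I := integral_exp_tail x (c := 2^-1) (ltac:(by rewrite invr_gt0)).
apply: (@le_lt_trans _ _ (\int[mu]_(u in `[x, +oo[) (C%:E * (expR (- (2^-1 * u)))%:E))%E); last first.
  rewrite ge0_integralZl_EFin ?expR_ge0//; first by rewrite I -EFinM ltry.
  by apply/measurable_EFinP/measurable_funTS; exact: measurable_exp_neg.
apply: ge0_le_integral => //.
- by move=> u _; rewrite lee_fin mulr_ge0 ?powR_ge0 ?expR_ge0.
- apply: measurable_funeM; apply/measurable_EFinP/measurable_funTS.
  exact: measurable_exp_neg.
move=> u /=; rewrite in_itv/= andbT => xu; have u0 := lt_le_trans x0 xu.
rewrite -EFinM lee_fin (@le_trans _ _ (C * expR (2^-1 * u) * expR (- u)))//.
  by rewrite ler_wpM2r ?expR_ge0// powR_le_exp// mulr_ge0.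
rewrite -mulrA -expRD ler_pM2l ?expR_gt0// ler_expR; lra.
Qed.

Lemma upper_incomplete_integral_ge0 (tau x : R) : 0 <= upper_incomplete_integral tau x.
Proof. by apply: Rintegral_ge0 => u _; rewrite mulr_ge0 ?powR_ge0 ?expR_ge0. Qed.

End IncompleteGamma.

Section RussmannEstimate.
Context {R : realType} {n : nat}.
Variables (omega : 'rV[R]_n) (gamma tau : R).
Hypotheses (gamma_gt0 : 0 < gamma) (tau_ge0 : 0 <= tau)
  (omega_dioph : diophantine gamma tau omega).
Local Notation mu := (@lebesgue_measure R).
Local Notation A := (2 `^ (2 * tau) / (8 * gamma ^+ 2) * hurwitz_zeta 2 (2 `^ tau)).

Lemma russmann_const_ge0 : 0 <= A.
Proof.
apply: mulr_ge0; first by rewrite divr_ge0 ?powR_ge0// mulr_ge0// sqr_ge0.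
by apply: hurwitz_ge0; rewrite -[leLHS](powRr0 2) ler_powR// ler1n.
Qed.

(** Writing exp (- a |k|) as the integral of exp (- u) over u >= a |k| turns
    the sum over k into an integral over u of the sums over |k| <= u / a, to
    which the count of small divisors applies. *)
Lemma russmann_tail (s : seq 'rV[int]_n) (L : nat) (a : R) : 0 < a -> uniq s ->
  (forall k, k \in s -> (L < norm1 k)%N) ->
  \sum_(k <- s) small_div omega k * expR (- (a * (norm1 k)%:R)) <=
    A / a `^ (2 * tau) * upper_incomplete_integral tau (a * L.+1%:R).
Proof.
move=> a0 us sL; pose D := `[a * L.+1%:R, +oo[%classic : set R.
have x0 : 0 < a * L.+1%:R by rewrite mulr_gt0.
have mD : measurable D by exact: measurable_itv.
pose E (k : 'rV[int]_n) := `[a * (norm1 k)%:R, +oo[%classic : set R.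
pose g (u : R) := (expR (- u))%:E.
pose f (k : 'rV[int]_n) u := ((small_div omega k)%:E * (g \_ (E k)) u)%E.
have mg : measurable_fun setT g.
  apply/measurable_EFinP.
  by have := @measurable_exp_neg R 1; under eq_fun do rewrite mul1r.
have mgE k : measurable_fun D (g \_ (E k)).
  apply: measurable_funTS; apply/(measurable_restrictT _ _).1 => //.
  - exact: measurable_itv.
  - exact: measurable_funTS.
have gE0 k u : (0 <= (g \_ (E k)) u)%E.
  by rewrite patchE; case: ifPn => // _; rewrite lee_fin expR_ge0.
have mf k : measurable_fun D (f k) by apply: measurable_funeM; exact: mgE.
have mh : measurable_fun D (fun u : R => (u `^ (2 * tau) * expR (- u))%:E).
  apply/measurable_EFinP/measurable_funTS/measurable_funM.
    exact: measurable_powR.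
  exact/measurable_EFinP.
have intf k : k \in s -> (\int[mu]_(u in D) f k u =
    (small_div omega k * expR (- (a * (norm1 k)%:R)))%:E)%E.
  move=> /sL kL; rewrite /f ge0_integralZl_EFin ?small_div_ge0//; last exact: mgE.
  rewrite -integral_mkcondr (_ : D `&` E k = E k).
    rewrite EFinM -[X in (_ * X%:E)%E]mul1r -[X in (_ * (X * _)%:E)%E]invr1.
    rewrite -[X in expR (- X)]mul1r -(integral_exp_tail _ ltr01); congr (_ * _)%E.
    by apply: eq_integral => u _; rewrite mul1r.
  apply/setIidPr => u; rewrite /E /D/= !in_itv/= !andbT; apply: le_trans.
  by rewrite ler_pM2l// ler_nat.
rewrite -lee_fin -sumEFin big_seq -(eq_bigr _ intf) -big_seq.
rewrite -(@ge0_integral_sum _ _ _ mu D _ _ f).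
- rewrite EFinM -upper_incomplete_integral_fin// -ge0_integralZl_EFin//.
  + apply: ge0_le_integral => //.
    * by move=> u _; apply: sume_ge0 => k _; rewrite mule_ge0 ?lee_fin ?small_div_ge0.
    * by apply: emeasurable_sum => k; exact: mf.
    * exact: measurable_funeM.
    * move=> u; rewrite /D/= in_itv/= andbT => Du.
      have u0 := lt_le_trans x0 Du.
      have ua0 : 0 <= u / a by rewrite divr_ge0 ?(ltW u0) ?(ltW a0).
      have fE k : f k u = ((if (norm1 k <= Num.truncn (u / a))%N then small_div omega k else 0) *
          expR (- u))%:E.
        rewrite /f patchE; have -> : (u \in E k) = (norm1 k <= Num.truncn (u / a))%N.
          rewrite truncn_ge_nat// ler_pdivlMr// [leLHS]mulrC.
          by apply/idP/idP; rewrite inE /E/= in_itv/= andbT.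
        by case: ifP => _; [rewrite EFinM|rewrite mul0r mule0].
      rewrite (eq_bigr _ (fun k _ => fE k)) sumEFin -EFinM lee_fin -mulr_suml mulrA.
      rewrite ler_wpM2r ?expR_ge0// -big_mkcond/= -big_filter.
      have N0 : (0 < Num.truncn (u / a))%N.
        rewrite truncn_gt0 ler_pdivlMr// mul1r (le_trans _ Du)//.
        by rewrite ler_peMr ?(ltW a0)// ler1n.
      apply: (le_trans (small_div_sum gamma_gt0 tau_ge0 omega_dioph N0 (filter_uniq _ us) _)).
        move=> k; rewrite mem_filter => /andP[kN /sL kL]; split=> //.
        by apply: contraTneq kL => ->; rewrite (eqP (_ : norm1 0 == 0%N)) ?norm1_eq0.
      rewrite -[leRHS]mulrA ler_wpM2l ?russmann_const_ge0//.
      have uaE : (u / a) `^ (2 * tau) * a `^ (2 * tau) = u `^ (2 * tau).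
        by rewrite -powRM ?divr_ge0 ?(ltW u0) ?(ltW a0)// divfK// gt_eqF.
      rewrite -uaE [leRHS]mulrC mulfK ?gt_eqF ?powR_gt0//.
      by apply: ge0_ler_powR; [exact: mulr_ge0|rewrite nnegrE|rewrite nnegrE|rewrite truncn_le].
  + by move=> u _; rewrite lee_fin mulr_ge0 ?powR_ge0 ?expR_ge0.
  + by rewrite divr_ge0 ?russmann_const_ge0 ?powR_ge0.
- exact: mD.
- exact: mf.
- by move=> k u _; rewrite mule_ge0 ?lee_fin ?small_div_ge0.
Qed.

Lemma finite_norm1 (L : nat) :
  finite_set [set k : 'rV[int]_n | (0 < norm1 k <= L)%N].
Proof.
apply: (@sub_finite_set _ _ ((fun f : {ffun 'I_n -> 'I_(2 * L).+1} =>
    \row_i ((f i : nat)%:Z - L%:Z)) @` setT)); last first.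
  exact: finite_image.
move=> k /= /andP[_ kL].
have kiL i : (`|k 0%R i| <= L)%N.
  by rewrite (leq_trans _ kL)// /norm1 (bigD1 i)//= leq_addr.
exists [ffun i => inord `|(k 0 i + L%:Z)%R|%N] => //.
apply/rowP => i; rewrite mxE ffunE inordK.
  by have := kiL i; move: (k 0 i) => p pL; lia.
by have := kiL i; move: (k 0 i) => p pL; lia.
Qed.

(** The frequencies up to order L appear explicitly in the constant, and the
    others are estimated by the integral. *)
Lemma russmann_estimate (F : {fset 'rV[int]_n}) (L : nat) (delta : R) :
  0 < delta -> (forall k, k \in F -> k != 0) ->
  2 ^+ n * \sum_(k <- F) small_div omega k * expR (- (4 * pi * (norm1 k)%:R * delta)) <=
    (russmann_constant omega gamma tau L delta / (gamma * delta `^ tau)) ^+ 2.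
Proof.
move=> d0 F0; have dt0 : 0 < delta `^ tau by rewrite powR_gt0.
have sq (y : R) : 0 <= y -> y `^ (2 * tau) = (y `^ tau) ^+ 2.
  by move=> y0; rewrite mulrC powRrM powR_mulrn ?powR_ge0.
pose G k := small_div omega k * expR (- (4 * pi * (norm1 k)%:R * delta)).
have G0 k : 0 <= G k by rewrite mulr_ge0 ?small_div_ge0 ?expR_ge0.
pose S := fset_set [set k : 'rV[int]_n | (0 < norm1 k <= L)%N].
set Hd := \sum_(k <- S) G k.
pose I := upper_incomplete_integral tau (4 * pi * delta * L.+1%:R).
have I0 : 0 <= I by exact: upper_incomplete_integral_ge0.
have Hd0 : 0 <= Hd by apply: sumr_ge0.
have cE : russmann_constant omega gamma tau L delta ^+ 2 =
    gamma ^+ 2 * delta `^ (2 * tau) * 2 ^+ n * Hd +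
    2 ^ (n%:Z - 3) * hurwitz_zeta 2 (2 `^ tau) * (2 * pi) `^ (- (2 * tau)) * I.
  rewrite /russmann_constant sqr_sqrtr.
    congr (_ * _ + _); rewrite fsbig_finite; last exact: finite_norm1.
    by apply: eq_bigr => k _; rewrite /G small_divE mulrC.
  rewrite addr_ge0//.
    apply: mulr_ge0; first by apply: mulr_ge0; rewrite ?exprn_ge0// mulr_ge0 ?sqr_ge0 ?powR_ge0.
    rewrite fsbig_finite; last exact: finite_norm1.
    by apply: sumr_ge0 => k _; rewrite divr_ge0 ?expR_ge0 ?mulr_ge0 ?sqr_ge0.
  rewrite mulr_ge0// mulr_ge0 ?powR_ge0// mulr_ge0 ?exprz_ge0//.
  by apply: hurwitz_ge0; rewrite -[leLHS](powRr0 2) ler_powR// ler1n.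
have FE : \sum_(k <- F) G k <= Hd + A / (4 * pi * delta) `^ (2 * tau) * I.
  rewrite (@fset_split _ _ _ [fset k in F | (norm1 k <= L)%N]%fset); last first.
    by apply/fsubsetP => k; rewrite !inE/= => /andP[].
  apply: lerD.
    apply: fset_le_sum => //; apply/fsubsetP => k; rewrite !inE/= => /andP[kF kL].
    rewrite in_fset_set; last exact: finite_norm1.
    by rewrite inE/= kL andbT lt0n norm1_eq0 F0.
  have p0 : 0 < 4 * pi * delta :> R by rewrite !mulr_gt0 ?pi_gt0.
  set F' := (F `\` _)%fset.
  have F'L k : k \in F' -> (L < norm1 k)%N.
    by rewrite !inE/= ltnNge => /andP[+ kF]; rewrite kF.
  apply: le_trans (russmann_tail p0 (fset_uniq F') F'L).
  by apply: ler_sum => k _; rewrite /G -!mulrA [delta * _]mulrC.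
rewrite expr_div_n cE exprMn ler_pdivlMr ?mulr_gt0 ?exprn_gt0//.
have two0 : (2 : R) ^+ n != 0 by rewrite expf_neq0.
apply: (@le_trans _ _ (2 ^+ n * (Hd + A / (4 * pi * delta) `^ (2 * tau) * I) *
    (gamma ^+ 2 * delta `^ tau ^+ 2))).
  apply: ler_wpM2r; first by apply: mulr_ge0; exact: sqr_ge0.
  by apply: ler_wpM2l => //; exact: exprn_ge0.
rewrite le_eqVlt; apply/orP; left; apply/eqP.
have -> : 2 ^ (n%:Z - 3) = 2 ^+ n / 8 :> R.
  have -> : 8 = 2 ^+ 3 :> R by ring.
  by rewrite expfzDr// exprnN.
have -> : 4 * pi * delta = 2 * (2 * pi) * delta :> R by ring.
have p0 : 0 < 2 * pi :> R by rewrite mulr_gt0 ?pi_gt0.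
have p1 : 0 <= 2 * (2 * pi) :> R by rewrite mulr_ge0// ltW.
have p2 : 0 <= 2 * (2 * pi) * delta :> R by rewrite mulr_ge0// ltW.
rewrite powRN !sq ?(ltW p0) ?(ltW d0)//.
rewrite (powRM _ p1 (ltW d0)) (powRM _ _ (ltW p0))//.
have : 2 `^ tau != 0 :> R by rewrite gt_eqF// powR_gt0.
have : (2 * pi) `^ tau != 0 :> R by rewrite gt_eqF// powR_gt0.
move: (gt_eqF dt0) (gt_eqF gamma_gt0) => /negbT; move=> + /negbT.
move: (2 ^+ n) (2 `^ tau) ((2 * pi) `^ tau) (delta `^ tau) (hurwitz_zeta 2 _) => p q r d z d1 g1 r1 q1.
by field; rewrite d1 g1 r1 q1.
Qed.

End RussmannEstimate.

(** * Fourier expansions *)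

Section FourierExpansion.
Context {R : realType} {n : nat}.
Implicit Types (z : 'rV[R[i]]_n) (g : 'rV[R[i]]_n -> R[i]) (k : 'rV[int]_n)
  (a : 'rV[int]_n -> R[i]) (rho sigma : R).

Lemma decays_abs0 rho a : 0 < rho -> decays rho a ->
  exists B, forall A : {fset 'rV[int]_n}, \sum_(k <- A) cmod (a k) <= B.
Proof.
move=> r0 /(_ 0 r0)[B aB]; exists B => A; apply: le_trans (aB A).
by apply: ler_sum => k _; rewrite mulr0 expR0 mulr1.
Qed.

Lemma fourier_cvg0 sigma g k : 0 < sigma -> periodic_on_strip sigma g ->
  regular sigma g ->
  gmean N (fun x => g (real_vec x) * echar (- k) (real_vec x))
    @[N --> nat_ultra] --> (fourier g k : R[i]^o).
Proof.
move=> s0 gp gr; have := fourier_cvg (k := k) s0 gp gr (strip0 s0).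
have -> : echar k (0 : 'rV[R[i]]_n) = 1.
  by have := @echar_int R n k 0; rewrite map_mx0.
rewrite mulr1; apply: eq_ccvg => N.
by apply: eq_gmean => x; rewrite add0r.
Qed.

Lemma fourierB sigma g g' k : 0 < sigma ->
  periodic_on_strip sigma g -> regular sigma g ->
  periodic_on_strip sigma g' -> regular sigma g' ->
  periodic_on_strip sigma (fun z => g z - g' z) ->
  regular sigma (fun z => g z - g' z) ->
  fourier (fun z => g z - g' z) k = fourier g k - fourier g' k.
Proof.
move=> s0 gp gr gp' gr' dp dr.
apply: (@ccvg_unique _ _ _ _ _ _ _ (fourier_cvg0 (k := k) s0 dp dr)).
have FF : Filter nat_ultra by exact: nat_ultra_proper.
have := @ccvgD R nat nat_ultra FF _ _ _ _ (fourier_cvg0 (k := k) s0 gp gr)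
  (@ccvgM R nat nat_ultra FF _ _ _ _ (@ccvg_cst R nat nat_ultra FF (-1))
    (fourier_cvg0 (k := k) s0 gp' gr')).
rewrite mulN1r; apply: eq_ccvg => N; rewrite -gmeanZ -gmeanD.
by apply: eq_gmean => x; rewrite mulrBl mulN1r.
Qed.

Lemma regularN sigma g : regular sigma g -> regular sigma (fun z => - g z).
Proof.
move=> [C [eta [C0 e0 gC]]]; exists C, eta; split=> // z /gC[gz gQ].
split=> [|j h s hs ss]; first by rewrite cmodN.
have [lip quad] := gQ j h s hs ss; rewrite /delta.
have dN t : - g (z + t *: delta_mx 0 j) - - g z = - delta g j t z.
  by rewrite /delta opprD.
by rewrite !dN cmodN !mulrN -opprD cmodN.
Qed.

(** The Fourier coefficients of an absolutely convergent trigonometric series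
    are its coefficients: a finite part dominates, and its grid means pick the
    right coefficient as soon as the grid is fine enough. *)
Lemma fourier_tseries rho a k : 0 < rho -> decays rho a ->
  fourier (tseries a : 'rV[R[i]]_n -> R[i]) k = a k.
Proof.
move=> r0 da; have [B aB] := decays_abs0 r0 da.
have s0 : 0 < rho / 2 by rewrite divr_gt0.
have tr := analytic_regular (ltac:(lra) : rho / 2 < rho) (tseries_analytic_on r0 da).
have tp : periodic_on_strip (rho / 2) (tseries a) by exact: tseries_periodic.
have lim := fourier_cvg0 (k := k) s0 tp tr.
apply/eqP; rewrite -subr_eq0 -cmod_eq0 eq_le cmod_ge0 andbT.
apply/ler_addgt0Pl => e e0; rewrite addr0.
have [A0 [A0P _]] := abs_tail (fun k => cmod_ge0 (a k)) aB e0.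
pose A := (A0 `|` [fset k])%fset.
have Ak : k \in A by rewrite !inE eqxx orbT.
have tail x : cmod (tseries a (real_vec x) -
    \sum_(l <- A) a l * echar l (real_vec x)) <= e.
  apply: has_sum_tail (has_sum_tseries r0 da (strip_real x r0)) _ => D AD.
  apply: (@le_trans _ _ (\sum_(l <- D) cmod (a l))).
    by apply: ler_sum => l _; rewrite cmodM cmod_echar_real mulr1.
  by apply: A0P; apply: fdisjointWl AD; exact: fsubsetUl.
have orth : \forall N \near \oo, forall l, l \in (A `\ k)%fset ->
    gmean N (fun x => echar (l - k) (real_vec x) : R[i]) = 0.
  apply: near_fset => l; rewrite in_fsetD1 => /andP[lk _].
  by apply: near_orthogonal; rewrite subr_eq0.
have FF : Filter nat_ultra by exact: nat_ultra_proper.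
have lim' := @ccvgD R nat nat_ultra FF _ _ _ _ lim (@ccvg_cst R nat nat_ultra FF (- a k)).
apply: (ccvg_bound lim'); apply: nat_ultra_oo; apply: filterS orth => N orthN.
have <- : gmean N (fun x => (\sum_(l <- A) a l * echar l (real_vec x)) *
    echar (- k) (real_vec x)) = a k.
  transitivity (\sum_(l <- A) a l * gmean N (fun x => echar (l - k) (real_vec x) : R[i])).
    under [RHS]eq_bigr do rewrite -gmeanZ.
    rewrite -gmean_sum; apply: eq_gmean => x; rewrite mulr_suml.
    by apply: eq_bigr => l _; rewrite echarDl mulrA.
  rewrite (big_fsetD1 k)//= subrr [X in _ + X]big_seq big1 ?addr0.
    by rewrite (eq_gmean _ (fun x => echar0 _)) gmean_cst mulr1.
  by move=> l lA; rewrite orthN ?mulr0.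
rewrite -gmeanB; apply: gmean_bound => x; rewrite -mulrBl cmodM cmod_echar_real mulr1.
exact: tail.
Qed.

(** The difference of both sides has all its Fourier coefficients equal to 0.
    *)
Lemma fourier_expansion rho g : 0 < rho -> periodic_on_strip rho g ->
  (forall sigma, sigma < rho -> regular sigma g) -> decays rho (fourier g) ->
  forall z, strip rho z -> g z = tseries (fourier g) z.
Proof.
move=> r0 gp gr da z sz; have [s [s0 srho zs]] := strip_sub r0 sz.
pose sigma := (s + rho) / 2.
have sig0 : 0 < sigma by rewrite /sigma; lra.
have sigr : sigma < rho by rewrite /sigma; lra.
have szs : strip sigma z.
  by move=> i; rewrite (le_lt_trans (zs i))// /sigma; lra.
have sub (h : 'rV[R[i]]_n -> R[i]) : periodic_on_strip rho h -> periodic_on_strip sigma h.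
  by move=> hp y sy k; apply: hp; exact: strip_le (ltW sigr) sy.
have tp : periodic_on_strip rho (tseries (fourier g)) by exact: tseries_periodic.
have tr := analytic_regular sigr (tseries_analytic_on r0 da).
have dp : periodic_on_strip sigma (fun z => g z - tseries (fourier g) z).
  by move=> y sy k; rewrite (sub _ gp)// (sub _ tp).
have dr := regularD (gr _ sigr) (regularN tr).
apply/eqP; rewrite -subr_eq0; apply/eqP.
apply: (fourier_eq0 (g := fun z => g z - tseries (fourier g) z) sig0 dp dr) szs => k.
rewrite (fourierB _ sig0 (sub _ gp) (gr _ sigr) (sub _ tp) tr dp dr).
by rewrite (fourier_tseries _ r0 da) subrr.
Qed.

Lemma has_sum_pred1 k (x : R[i]) : has_sum (fun l : 'rV[int]_n => if l == k then x else 0) x.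
Proof.
apply/has_sumP => e e0; exists [fset k]%fset => A /fsubsetP kA.
rewrite (big_fsetD1 k) ?kA ?inE//= eqxx big_seq big1 ?addr0 ?subrr ?cmod0 ?ltW//.
by move=> l; rewrite in_fsetD1 => /andP[/negbTE->].
Qed.

Lemma average_fourier rho g : 0 < rho -> decays rho (fourier g) ->
  (forall z, strip rho z -> g z = tseries (fourier g) z) -> average g = fourier g 0.
Proof.
move=> r0 dg gE; have [B aB] := decays_abs0 r0 dg.
apply: (average_tseries aB) => x; rewrite gE; last exact: strip_real.
exact: (has_sum_tseries r0 dg (strip_real x r0)).
Qed.

End FourierExpansion.

(** * The cohomological equation *)

(** The difference is half of the sum of the squares (x_i y_j - y_i x_j)^2. *)
Lemma cauchy_schwarz_seq (R : realFieldType) (I : Type) (s : seq I) (x y : I -> R) :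
  (\sum_(i <- s) x i * y i) ^+ 2 <= (\sum_(i <- s) x i ^+ 2) * (\sum_(i <- s) y i ^+ 2).
Proof.
set S := \sum_(i <- s) x i * y i; set X := \sum_(i <- s) x i ^+ 2.
set Y := \sum_(i <- s) y i ^+ 2.
suff : 0 <= X * Y + Y * X - (S * S + S * S) by rewrite expr2 [Y * X]mulrC; lra.
rewrite /X /Y /S !big_distrlr/= -!big_split/= -sumrB; apply: sumr_ge0 => i _.
rewrite -!big_split/= -sumrB; apply: sumr_ge0 => j _.
by rewrite (_ : _ - _ = (x i * y j - y i * x j) ^+ 2) ?sqr_ge0//; ring.
Qed.

Section CohomologicalEquation.
Context {R : realType} {n : nat}.
Variables (omega : 'rV[R]_n) (gamma tau : R).
Hypotheses (gamma_gt0 : 0 < gamma) (tau_ge0 : 0 <= tau)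
  (omega_dioph : diophantine gamma tau omega).
Implicit Types (g : 'rV[R[i]]_n -> R[i]) (k : 'rV[int]_n) (rho : R).

Definition sol_coef g k : R[i] :=
  if k == 0 then 0 else fourier g k / (1 - e1 (dotZ k omega)%:C).

Lemma sol_coefE g k : k != 0 ->
  sol_coef g k * (1 - e1 (dotZ k omega)%:C) = fourier g k.
Proof.
move=> k0; rewrite /sol_coef (negbTE k0) divfK//.
exact: (e1_dotZ_neq1 gamma_gt0 tau_ge0 omega_dioph k0).
Qed.

(** The Cauchy-Schwarz inequality separates the Fourier coefficients, weighted
    by exp (2 pi |k| (s + delta)), from the divisors, weighted by exp (- 2 pi
    |k| delta). *)
Lemma sol_coef_bound rho g (M s delta : R) (L : nat) (F : {fset 'rV[int]_n}) :
  analytic_on_torus rho g -> (forall z, strip rho z -> cmod (g z) <= M) ->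
  0 <= s -> 0 < delta -> s + delta < rho ->
  \sum_(k <- F) cmod (sol_coef g k) * expR (2 * pi * (norm1 k)%:R * s) <=
    russmann_constant omega gamma tau L delta / (gamma * delta `^ tau) * M.
Proof.
move=> ga gM s0 d0 sdr.
pose sigma := (s + delta + rho) / 2.
have sig0 : 0 < sigma by rewrite /sigma; lra.
have sigr : sigma < rho by rewrite /sigma; lra.
have sdsig : s + delta < sigma by rewrite /sigma; lra.
have M0 : 0 <= M.
  by rewrite (le_trans (cmod_ge0 _) (gM 0 _))//; apply: strip0; lra.
have gp : periodic_on_strip sigma g.
  by move=> z sz k; apply: ga.1; exact: strip_le (ltW sigr) sz.
have gMs z : strip sigma z -> cmod (g z) <= M.
  by move=> sz; apply: gM; exact: strip_le (ltW sigr) sz.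
set K := _ / _; have K0 : 0 <= K.
  by rewrite divr_ge0 ?sqrtr_ge0// mulr_ge0 ?powR_ge0// ltW.
pose E k := cmod (sol_coef g k) * expR (2 * pi * (norm1 k)%:R * s).
have -> : \sum_(k <- F) E k = \sum_(k <- (F `\ 0)%fset) E k.
  have E0 : E 0 = 0 by rewrite /E /sol_coef eqxx cmod0 mul0r.
  have [F0|F0] := boolP (0 \in F); first by rewrite (big_fsetD1 0)//= E0 add0r.
  by rewrite (_ : (F `\ 0)%fset = F)//; apply/fsetDidPl; rewrite fdisjointX1.
pose x k := cmod (fourier g k) * expR (2 * pi * (norm1 k)%:R * (s + delta)).
pose y k := expR (- (2 * pi * (norm1 k)%:R * delta)) / cmod (1 - e1 (dotZ k omega)%:C).
have Exy k : k \in (F `\ 0)%fset -> E k = x k * y k.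
  rewrite in_fsetD1 => /andP[k0 _].
  rewrite /E /sol_coef (negbTE k0) cmodM cmodV /x /y [_ * (s + delta)]mulrDr expRD expRN.
  have : cmod (1 - e1 (dotZ k omega)%:C) != 0.
    by rewrite cmod_eq0 (e1_dotZ_neq1 gamma_gt0 tau_ge0 omega_dioph k0).
  have := expR_gt0 (2 * pi * (norm1 k)%:R * delta).
  set p := cmod _; set q := expR _; set r := expR _; set t := cmod _ => q0 t0.
  by field; rewrite t0 gt_eqF.
rewrite big_seq (eq_bigr _ Exy) -big_seq.
have xx : \sum_(k <- (F `\ 0)%fset) x k ^+ 2 <= 2 ^+ n * M ^+ 2.
  have sd : 0 <= s + delta < sigma by apply/andP; split=> //; lra.
  have := weighted_bessel (F `\ 0)%fset sig0 gp (analytic_regular sigr ga) gMs sd.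
  apply: le_trans; apply: ler_sum => k _; rewrite /x exprMn -expRM_natl.
  rewrite ler_wpM2l ?sqr_ge0// ler_expR.
  by rewrite le_eqVlt; apply/orP; left; apply/eqP; ring.
have yy : 2 ^+ n * \sum_(k <- (F `\ 0)%fset) y k ^+ 2 <= K ^+ 2.
  have F0 k : k \in (F `\ 0)%fset -> k != 0 by rewrite in_fsetD1 => /andP[].
  apply: le_trans (russmann_estimate gamma_gt0 tau_ge0 omega_dioph L d0 F0).
  rewrite ler_wpM2l ?exprn_ge0//; apply: ler_sum => k _.
  rewrite /y expr_div_n -expRM_natl mulrC /small_div ler_wpM2l ?invr_ge0 ?sqr_ge0//.
  rewrite ler_expR.
  by rewrite le_eqVlt; apply/orP; left; apply/eqP; ring.
have Y0 : 0 <= \sum_(k <- (F `\ 0)%fset) y k ^+ 2 by apply: sumr_ge0 => k _; exact: sqr_ge0.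
have KM0 : 0 <= K * M by exact: mulr_ge0.
have S0 : 0 <= \sum_(k <- (F `\ 0)%fset) x k * y k.
  apply: sumr_ge0 => k _; rewrite mulr_ge0 ?divr_ge0 ?cmod_ge0 ?expR_ge0//.
  by rewrite mulr_ge0 ?cmod_ge0 ?expR_ge0.
rewrite -(@ler_sqr _ _ (K * M)) ?nnegrE ?KM0 ?S0//.
apply: (le_trans (cauchy_schwarz_seq _ _ _)).
apply: (le_trans (ler_wpM2r Y0 xx)).
rewrite -mulrA mulrCA [_ * (_ * _)]mulrC exprMn ler_wpM2r ?sqr_ge0//.
Qed.

Lemma sol_coef_decays rho g (M : R) : 0 < rho -> analytic_on_torus rho g ->
  (forall z, strip rho z -> cmod (g z) <= M) -> decays rho (sol_coef g).
Proof.
move=> r0 ga gM s sr; pose s' := Num.max s 0; pose delta := (rho - s') / 2.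
have s's : s <= s' by rewrite le_max lexx.
have s'0 : 0 <= s' by rewrite le_max lexx orbT.
have s'r : s' < rho by rewrite gt_max sr.
have d0 : 0 < delta by rewrite /delta; lra.
exists (russmann_constant omega gamma tau 0 delta / (gamma * delta `^ tau) * M) => F.
apply: le_trans (sol_coef_bound 0 F ga gM s'0 d0 _); last by rewrite /delta; lra.
apply: ler_sum => k _; rewrite ler_wpM2l ?cmod_ge0// ler_expR ler_wpM2l//.
by rewrite !mulr_ge0 ?pi_ge0.
Qed.

(** A divisor has modulus at most 2. *)
Lemma fourier_decays rho g : decays rho (sol_coef g) -> decays rho (fourier g).
Proof.
move=> da s /da[B aB]; exists (cmod (fourier g 0) + 2 * B) => A.
apply: (@le_trans _ _ (\sum_(k <- (0 |` A)%fset)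
    cmod (fourier g k) * expR (2 * pi * (norm1 k)%:R * s))).
  apply: fset_le_sum; last exact: fsubsetUr.
  by move=> k; rewrite mulr_ge0 ?cmod_ge0 ?expR_ge0.
rewrite (big_fsetD1 0) ?fset1U1//=; apply: lerD.
  have /eqP -> : norm1 (0 : 'rV[int]_n) == 0%N by rewrite norm1_eq0.
  by rewrite mulr0 mul0r expR0 mulr1.
apply: (@le_trans _ _ (2 * \sum_(k <- ((0 |` A) `\ 0)%fset)
    cmod (sol_coef g k) * expR (2 * pi * (norm1 k)%:R * s))); last first.
  by rewrite ler_wpM2l.
rewrite mulr_sumr big_seq [leRHS]big_seq; apply: ler_sum => k.
rewrite in_fsetD1 => /andP[k0 _]; rewrite mulrA ler_wpM2r ?expR_ge0//.
rewrite -(sol_coefE g k0) cmodM mulrC ler_wpM2r ?cmod_ge0//.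
rewrite (le_trans (cmodB _ _))// cmod1 cmod_e1_real.
by [].
Qed.

(** On the spectral side, translation by omega multiplies the k-th Fourier
    coefficient by exp (2 pi i k . omega), which is 1 only for k = 0. *)
Lemma invariant_constant rho g : 0 < rho -> analytic_on_torus rho g ->
  (forall z, strip rho z -> g (z + real_vec omega) = g z) ->
  forall z, strip rho z -> g z = fourier g 0.
Proof.
move=> r0 ga inv.
have c0 k : k != 0 -> fourier g k = 0.
  move=> k0; have s0 : 0 < rho / 2 by rewrite divr_gt0.
  have sr : rho / 2 < rho by lra.
  have gp : periodic_on_strip (rho / 2) g.
    by move=> z sz l; apply: ga.1; exact: strip_le (ltW sr) sz.
  have gr := analytic_regular sr ga.
  have lim := fourier_cvg (k := k) s0 gp gr (strip_real omega s0).
  have lim0 := fourier_cvg0 (k := k) s0 gp gr.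
  have : fourier g k * echar k (real_vec omega) = fourier g k.
    apply: (@ccvg_unique _ _ _ _ _ _ _ lim); move: lim0; apply: eq_ccvg => N.
    by apply: eq_gmean => x; rewrite addrC inv//; exact: strip_real.
  rewrite echar_real_dot => /eqP; rewrite -subr_eq0 -{2}[fourier g k]mulr1 -mulrBr.
  rewrite mulf_eq0 => /orP[/eqP//|]; rewrite -opprB oppr_eq0.
  by rewrite (negbTE (e1_dotZ_neq1 gamma_gt0 tau_ge0 omega_dioph k0)).
have dg : decays rho (fourier g).
  move=> s sr; exists (cmod (fourier g 0)) => A.
  apply: (@le_trans _ _ (\sum_(k <- (0 |` A)%fset)
      cmod (fourier g k) * expR (2 * pi * (norm1 k)%:R * s))).
    apply: fset_le_sum; last exact: fsubsetUr.
    by move=> k; rewrite mulr_ge0 ?cmod_ge0 ?expR_ge0.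
  rewrite (big_fsetD1 0) ?fset1U1//=.
  have /eqP -> : norm1 (0 : 'rV[int]_n) == 0%N by rewrite norm1_eq0.
  rewrite mulr0 mul0r expR0 mulr1 big_seq big1 ?addr0// => k.
  by rewrite in_fsetD1 => /andP[k0 _]; rewrite c0// cmod0 mul0r.
move=> z sz.
rewrite (fourier_expansion r0 ga.1 (fun sigma sr => analytic_regular sr ga) dg sz).
apply: (has_sum_unique (has_sum_tseries r0 dg sz)).
have := @has_sum_pred1 R n 0 (fourier g 0); apply: eq_has_sum => k.
have [->|k0] := eqVneq k 0; first by rewrite echar0 mulr1.
by rewrite c0// mul0r.
Qed.

End CohomologicalEquation.

Lemma analytic_on_torusB (R : realType) n (rho : R) (f g : 'rV[R[i]]_n -> R[i]) :
  analytic_on_torus rho f -> analytic_on_torus rho g ->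
  analytic_on_torus rho (fun z => f z - g z).
Proof.
move=> [fp fa] [gp ga]; split=> [z sz k|z sz]; first by rewrite fp// gp.
have [a [r [r0 ar]]] := fa z sz; have [b [q [q0 bq]]] := ga z sz.
exists (fun m => a m - b m), (Num.min r q); split; first by rewrite lt_min r0.
move=> h hr.
have ha : has_sum (fun m : {ffun 'I_n -> nat} => a m * \prod_i h 0 i ^+ m i) (f (z + h)).
  by apply: ar => i; rewrite (lt_le_trans (hr i))// lecR ge_min lexx.
have hb : has_sum (fun m : {ffun 'I_n -> nat} => b m * \prod_i h 0 i ^+ m i) (g (z + h)).
  by apply: bq => i; rewrite (lt_le_trans (hr i))// lecR ge_min lexx orbT.
have := has_sumD ha (has_sumZ (c := -1) hb); rewrite mulN1r.
by apply: eq_has_sum => m; rewrite mulN1r mulrBl.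
Qed.

Theorem lemma4p3 (R : realType) (n : nat) (omega : 'rV[R]_n) (gamma tau : R)
    (gamma_gt0 : 0 < gamma) (tau_ge : n%:R <= tau)
    (omega_dioph : diophantine gamma tau omega)
    (rho : R) (rho_gt0 : 0 < rho) (v : 'rV[R[i]]_n -> R[i])
    (v_analytic : analytic_on_torus rho v)
    (v_bounded : (sup_norm rho v < +oo)%E) :
  exists u : 'rV[R[i]]_n -> R[i],
    [/\ zero_average_solution rho omega v u,
        forall u' : 'rV[R[i]]_n -> R[i], zero_average_solution rho omega v u' ->
          forall theta, strip rho theta -> u' theta = u theta
      & forall (L : nat) (delta : R), 0 < delta -> delta < rho ->
          (sup_norm (rho - delta) u <=
             (russmann_constant omega gamma tau L delta /
                (gamma * delta `^ tau))%:E * sup_norm rho v)%E].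
Proof.
have tau0 : 0 <= tau by exact: le_trans tau_ge.
have v_le z : strip rho z -> ((cmod (v z))%:E <= sup_norm rho v)%E.
  by move=> sz; apply: ereal_sup_ubound; exists z.
pose M := fine (sup_norm rho v).
have ME : sup_norm rho v = M%:E.
  rewrite /M fineK// fin_numE -ltey v_bounded andbT.
  by rewrite gt_eqF// (lt_le_trans _ (v_le 0 (strip0 rho_gt0)))// ltNyr.
have vM z : strip rho z -> cmod (v z) <= M.
  by move=> /v_le; rewrite ME lee_fin.
pose a := sol_coef omega v; pose u : 'rV[R[i]]_n -> R[i] := tseries a.
have da : decays rho a by exact: (sol_coef_decays gamma_gt0 tau0 omega_dioph rho_gt0 v_analytic vM).
have dv := fourier_decays gamma_gt0 tau0 omega_dioph da.
have vE := fourier_expansion rho_gt0 v_analytic.1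
  (fun sigma sr => analytic_regular sr v_analytic) dv.
have v0 := average_fourier rho_gt0 dv vE.
have a0 : a 0 = 0 by rewrite /a /sol_coef eqxx.
have [B aB] := decays_abs0 rho_gt0 da.
have ua : analytic_on_torus rho u := tseries_analytic_on rho_gt0 da.
have uS z (sz : strip rho z) := has_sum_tseries rho_gt0 da sz.
have ueq z : strip rho z -> u z - u (z + real_vec omega) = v z - average v.
  move=> sz; rewrite v0 vE//.
  have szo : strip rho (z + real_vec omega) by exact: strip_add_real.
  have hu := has_sumD (uS z sz) (has_sumZ (c := -1) (uS _ szo)).
  have hv := has_sumD (has_sum_tseries rho_gt0 dv sz)
    (has_sumZ (c := -1) (@has_sum_pred1 R n 0 (fourier v 0))).
  rewrite !mulN1r in hu hv.
  apply: (has_sum_unique hu); apply: eq_has_sum hv => k.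
  have [->|k0] := eqVneq k 0.
    by rewrite a0 echar0 mulr1 !mul0r mulr0 addr0 mulN1r subrr.
  rewrite mulr0 addr0 echarDr echar_real_dot.
  by rewrite -(sol_coefE gamma_gt0 tau0 omega_dioph v k0) -/a; ring.
exists u; split.
- split=> //; rewrite -[RHS]a0; apply: (average_tseries aB) => x.
  by apply: uS; exact: strip_real.
- move=> u' [u'a u'0 u'eq].
  pose w z := u' z - u z.
  have wa : analytic_on_torus rho w by exact: analytic_on_torusB.
  have winv z : strip rho z -> w (z + real_vec omega) = w z.
    move=> sz; have uu' := u'eq z sz; rewrite -ueq// in uu'.
    have -> : w (z + real_vec omega) =
        w z - (u' z - u' (z + real_vec omega)) + (u z - u (z + real_vec omega)).
      by rewrite /w; ring.
    by rewrite uu' subrK.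
  have wc := invariant_constant gamma_gt0 tau0 omega_dioph rho_gt0 wa winv.
  set c := fourier w 0 in wc.
  have : average u' = a 0 + c.
    pose a' k := a k + (if k == 0 then c else 0).
    have -> : a 0 + c = a' 0 by rewrite /a' eqxx.
    apply: (@average_tseries R n a' (B + cmod c)) => [A|x].
      apply: (@le_trans _ _ (\sum_(k <- A) (cmod (a k) + cmod (if k == 0 then c else 0)))).
        by apply: ler_sum => k _; exact: cmodD.
      rewrite big_split lerD//.
      apply: (@le_trans _ _ (\sum_(k <- (0 |` A)%fset) cmod (if k == 0 then c else 0))).
        by apply: fset_le_sum; [move=> k; exact: cmod_ge0|exact: fsubsetUr].
      rewrite (big_fsetD1 0) ?fset1U1//= eqxx big_seq big1 ?addr0// => k.
      by rewrite in_fsetD1 => /andP[/negbTE-> _]; rewrite cmod0.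
    have sx := strip_real x rho_gt0.
    have -> : u' (real_vec x) = u (real_vec x) + c.
      by rewrite -(wc _ sx) /w addrC subrK.
    have := has_sumD (uS _ sx) (@has_sum_pred1 R n 0 c).
    apply: eq_has_sum => k; rewrite /a' mulrDl; congr (_ + _).
    by case: eqP => [->|]; rewrite ?echar0 ?mulr1 ?mul0r.
  rewrite u'0 a0 add0r => c0 z sz; apply/eqP; rewrite -subr_eq0; apply/eqP.
  by rewrite c0; exact: wc.
- move=> L delta d0 dr; apply: ge_ereal_sup => _ [z sz <-].
  have rd0 : 0 < rho - delta by rewrite subr_gt0.
  have [s [s0 srd zs]] := strip_sub rd0 sz.
  have szr : strip rho z by apply: strip_le sz; rewrite gerBl ltW.
  rewrite ME -EFinM lee_fin; apply: (has_sum_abs_bound (uS z szr)) => A.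
  have sdr : s + delta < rho by lra.
  apply: le_trans (sol_coef_bound gamma_gt0 tau0 omega_dioph L A v_analytic vM s0 d0 sdr).
  apply: ler_sum => k _; rewrite cmodM ler_wpM2l ?cmod_ge0//.
  exact: cmod_echar_le.
Qed.
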